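(* Let $F$ be a strongly convex norm on $\mathbb{R}^n$ (in the sense of the context), let $\Omega\subset\mathbb{R}^n$ be a domain with non-empty boundary, and let $d_F$ be the anisotropic distance function to $\partial\Omega$. Suppose that $d_F$ is $\Delta_F$-superharmonic in $\Omega$ and that $\sup_{x\in\Omega}d_F(x)<+\infty$. Set $D=e\cdot\sup_{x\in\Omega}d_F(x)$. Then for every $u\in H_0^1(\Omega)$, $$\int_{\Omega}F(\nabla u)^2\,dx-\frac14\int_\Omega\frac{u^2}{d_F^2}\,dx\;\ge\;\frac14\int_\Omega\frac{u^2}{d_F^2}\left(\log\frac{D}{d_F}\right)^{-2}dx .$$
   Context: Standing assumptions on $F$: $F:\mathbb{R}^n\to[0,+\infty)$ is convex, satisfies $F(t\xi)=|t|F(\xi)$ for all $t\in\mathbb{R}$, $\xi\in\mathbb{R}^n$, and $\alpha_1|\xi|\le F(\xi)$ for all $\xi$ for some constant $\alpha_1>0$; moreover $F\in C^2(\mathbb{R}^n\setminus\{0\})$ and the Hessian $\nabla^2_\xi F^2$ is positive definite on $\mathbb{R}^n\setminus\{0\}$. $F_\xi$ denotes the gradient of $F$. Polar function: $F^o(x)=\sup_{\xi\ne0}\frac{\xi\cdot x}{F(\xi)}$. A domain is a connected open set. For a domain $\Omega$ with non-empty boundary, the anisotropic distance to the boundary is $d_F(x)=\inf_{y\in\partial\Omega}F^o(x-y)$, $x\in\overline\Omega$. It is Lipschitz and satisfies $F(\nabla d_F)=1$ a.e. in $\Omega$. Finsler Laplacian: $\Delta_F u=\operatorname{div}(F(\nabla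 u)F_\xi(\nabla u))$. The function $d_F$ is $\Delta_F$-superharmonic in $\Omega$ if $-\Delta_F d_F\ge0$ in the sense of distributions, i.e. $\int_\Omega F(\nabla d_F)F_\xi(\nabla d_F)\cdot\nabla\varphi\,dx\ge0$ for all $\varphi\in C_0^\infty(\Omega)$ with $\varphi\ge0$. *)

(* Defs.v *)
From HB Require Import structures.
From mathcomp Require Import all_boot all_order all_algebra.
From mathcomp Require Import all_classical all_reals all_analysis.
Import Order.TTheory GRing.Theory Num.Theory.
Import numFieldNormedType.Exports.

Set Implicit Arguments.
Unset Strict Implicit.
Unset Printing Implicit Defensive.

Local Open Scope classical_set_scope.
Local Open Scope ring_scope.

Definition measure_rV_display : measure_display -> measure_display.
Proof. exact. Qed.

(* 'rV[R]_n carries the product sigma-algebra (the one generated by the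
   coordinate functions), as n.-tuple R does in the library; it is the Borel
   sigma-algebra of the usual topology of 'rV[R]_n. *)
Section measurable_rV.
Variables (R : realType) (n : nat).

Let coors : 'I_n -> 'rV[R]_n -> R := fun i x => x ord0 i.

Let rV_set0 : g_sigma_preimage coors set0.
Proof. exact: sigma_algebra0. Qed.

Let rV_setC A : g_sigma_preimage coors A -> g_sigma_preimage coors (~` A).
Proof. exact: sigma_algebraC. Qed.

Let rV_bigcup (A : (set 'rV[R]_n)^nat) :
  (forall i, g_sigma_preimage coors (A i)) ->
  g_sigma_preimage coors (\bigcup_i (A i)).
Proof. exact: sigma_algebra_bigcup. Qed.

HB.instance Definition _ :=
  @isMeasurable.Build (measure_rV_display default_measure_display)
    'rV[R]_n (g_sigma_preimage coors) rV_set0 rV_setC rV_bigcup.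

End measurable_rV.

Lemma measurable_coord (R : realType) n (i : 'I_n) :
  measurable_fun [set: 'rV[R]_n] (fun x => x ord0 i).
Proof.
move=> _ Y mY; rewrite setTI; apply: sub_sigma_algebra => /=.
rewrite -bigcup_seq/=; exists i => /=; first by rewrite mem_index_enum.
by exists Y => //; rewrite setTI.
Qed.

Lemma measurable_fun_rVP (R : realType) d (T : measurableType d) n
    (f : T -> 'rV[R]_n) :
  (forall i, measurable_fun [set: T] (fun t => f t ord0 i)) ->
  measurable_fun [set: T] f.
Proof.
move=> mf _ Y mY; rewrite setTI; move: Y mY.
suff : @measurable _ 'rV[R]_n `<=` [set Y | measurable (f @^-1` Y)] by [].
apply: smallest_sub => /=.
  split=> [|Y mY|G mG] /=.
  - by rewrite preimage_set0.
  - by rewrite setTD -preimage_setC; exact: measurableC.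
  - by rewrite preimage_bigcup; exact: bigcupT_measurable.
rewrite -bigcup_seq => Y [i _ [Z mZ <-]] /=.
by rewrite setTI -[X in measurable X]setTI; exact: mf.
Qed.

Section lebesgue_rV.
Variable R : realType.

Definition cons_rV n (p : R * 'rV[R]_n) : 'rV[R]_n.+1 :=
  \row_i (if unlift ord0 i is Some j then p.2 ord0 j else p.1).

Definition uncons_rV n (x : 'rV[R]_n.+1) : R * 'rV[R]_n :=
  (x ord0 ord0, \row_i x ord0 (lift ord0 i)).

Lemma cons_rVK n : cancel (@cons_rV n) (@uncons_rV n).
Proof.
move=> [a x]; rewrite /uncons_rV /cons_rV; congr (_, _).
  by rewrite mxE unlift_none.
by apply/rowP => i; rewrite !mxE liftK.
Qed.

Lemma measurable_cons_rV n : measurable_fun [set: _] (@cons_rV n).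
Proof.
apply: measurable_fun_rVP => i; case: (unliftP ord0 i) => [j ->|->].
  apply: (eq_measurable_fun (fun p : R * 'rV[R]_n => p.2 ord0 j)).
    by move=> p _; rewrite mxE liftK.
  apply: (measurableT_comp (f := fun x : 'rV[R]_n => x ord0 j)) => //.
  exact: measurable_coord.
by apply: (eq_measurable_fun fst) => // p _; rewrite mxE unlift_none.
Qed.

Lemma measurable_uncons_rV n : measurable_fun [set: _] (@uncons_rV n).
Proof.
apply/measurable_fun_pairP; split; first exact: measurable_coord.
apply: measurable_fun_rVP => i.
apply: (eq_measurable_fun (fun x : 'rV[R]_n.+1 => x ord0 (lift ord0 i))).
  by move=> x _; rewrite /= mxE.
exact: measurable_coord.
Qed.

Section step.
Variables (n : nat) (mu : {sigma_finite_measure set 'rV[R]_n -> \bar R}).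

Definition cons_measure : set 'rV[R]_n.+1 -> \bar R :=
  pushforward (lebesgue_measure \x mu)%E (@cons_rV n).

Let cons_measure0 : cons_measure set0 = 0%E.
Proof. by rewrite /cons_measure /pushforward preimage_set0 measure0. Qed.

Let cons_measure_ge0 A : (0 <= cons_measure A)%E.
Proof. by rewrite /cons_measure /pushforward; exact: measure_ge0. Qed.

Let cons_measure_sigma_additive : semi_sigma_additive cons_measure.
Proof.
move=> A mA tA mUA; rewrite /cons_measure /pushforward preimage_bigcup.
apply: measure_semi_sigma_additive.
- by move=> k; rewrite -[X in measurable X]setTI; exact: measurable_cons_rV.
- apply/trivIsetP => /= i j _ _ ij; rewrite -preimage_setI.
  by move/trivIsetP : tA => /(_ _ _ _ _ ij) ->//; rewrite preimage_set0.
- rewrite -preimage_bigcup -[X in measurable X]setTI.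
  exact: measurable_cons_rV.
Qed.

HB.instance Definition _ := isMeasure.Build _ _ _ cons_measure
  cons_measure0 cons_measure_ge0 cons_measure_sigma_additive.

Let cons_measure_sigma_finite : sigma_finite setT cons_measure.
Proof.
have /sigma_finiteP[A [AT ndA Afin]] :
    sigma_finite setT (lebesgue_measure : set (measurableTypeR R) -> \bar R).
  exact: sigma_finiteT.
have /sigma_finiteP[B [BT ndB Bfin]] := sigma_finiteT mu.
exists (fun k => @uncons_rV n @^-1` (A k `*` B k)).
  rewrite -preimage_bigcup (_ : \bigcup_k _ = setT) ?preimage_setT//.
  rewrite -subTset => -[a x] _.
  have [i _ Aa] : (\bigcup_k A k) a by rewrite -AT.
  have [j _ Bx] : (\bigcup_k B k) x by rewrite -BT.
  exists (maxn i j) => //; split.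
    by move: a Aa; exact/subsetPset/ndA/leq_maxl.
  by move: x Bx; exact/subsetPset/ndB/leq_maxr.
move=> k; have [mA oA] := Afin k; have [mB oB] := Bfin k; split.
  rewrite -[X in measurable X]setTI.
  by apply: measurable_uncons_rV => //; exact: measurableX.
rewrite /cons_measure /pushforward -comp_preimage.
rewrite (_ : _ \o _ = id); last by apply/funext => p /=; rewrite cons_rVK.
by rewrite preimage_id product_measure1E// lte_mul_pinfty// ge0_fin_numE.
Qed.

HB.instance Definition _ := Measure_isSigmaFinite.Build _ _ _ cons_measure
  cons_measure_sigma_finite.

End step.

Fixpoint leb n : {sigma_finite_measure set 'rV[R]_n -> \bar R} :=
  if n is n'.+1 then cons_measure (leb n') else dirac (0 : 'rV[R]_0).

Lemma measurable_box n (A : 'I_n -> set R) : (forall i, measurable (A i)) ->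
  measurable [set x : 'rV[R]_n | forall i, A i (x ord0 i)].
Proof.
move=> mA; rewrite (_ : [set _ | _] =
    \bigcap_(i in [set: 'I_n]) [set x : 'rV[R]_n | A i (x ord0 i)]).
  apply: fin_bigcap_measurable => // i _.
  by rewrite -[X in measurable X]setTI; exact: measurable_coord.
by apply/seteqP; split=> x /= h i => [_|]; exact: h.
Qed.

(* [leb n] is the usual Lebesgue measure: boxes have the expected volume. *)
Lemma leb_box n (A : 'I_n -> set (measurableTypeR R)) :
  (forall i, measurable (A i)) ->
  leb n [set x | forall i, A i (x ord0 i)] =
  (\prod_(i < n) lebesgue_measure (A i))%E.
Proof.
elim: n A => [|n IHn] A mA.
  rewrite big_ord0 /= diracE mem_set//; first by case.
rewrite big_ord_recl -IHn; last by move=> i; exact: mA.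
rewrite /= /cons_measure /pushforward -product_measure1E//; last first.
  by apply: (@measurable_box n (fun i => A (lift ord0 i))) => i; exact: mA.
congr (_ _); apply/seteqP; split=> [[a x]/= h|[a x] /= [Aa Ax] i].
  split=> [|i]; first by have := h ord0; rewrite mxE unlift_none.
  by have := h (lift ord0 i); rewrite mxE liftK.
by rewrite mxE; case: unliftP => [j ->|->].
Qed.

End lebesgue_rV.

Section calculus.
Variables (R : realType) (n : nat).
Implicit Types (f : 'rV[R]_n -> R) (A : set 'rV[R]_n).

Definition dotr (x y : 'rV[R]_n) : R := \sum_i x ord0 i * y ord0 i.

(* [`|x|] on 'rV[R]_n is the sup norm. *)
Definition enorm (x : 'rV[R]_n) : R := Num.sqrt (dotr x x).

Definition partial (i : 'I_n) f : 'rV[R]_n -> R :=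
  fun x => 'D_(delta_mx ord0 i) f x.

Definition gradient f (x : 'rV[R]_n) : 'rV[R]_n := \row_i partial i f x.

Definition hessian f (x : 'rV[R]_n) : 'M[R]_n :=
  \matrix_(i, j) partial j (partial i f) x.

Definition posdef (M : 'M[R]_n) : Prop :=
  forall v : 'rV[R]_n, v != 0 -> 0 < (v *m M *m v^T) ord0 ord0.

(* Meant for open [A]: iterated partial derivatives up to order [k] exist and
   are continuous on [A]. *)
Fixpoint class_C (k : nat) A f : Prop :=
  (forall x, A x -> {for x, continuous f}) /\
  if k is k'.+1 then
    forall i, (forall x, A x -> derivable f x (delta_mx ord0 i)) /\
              class_C k' A (partial i f)
  else True.

Definition test_function (Omega : set 'rV[R]_n) (phi : 'rV[R]_n -> R) : Prop :=
  [/\ forall k, class_C k setT phi,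
      compact (closure [set x | phi x != 0]) &
      closure [set x | phi x != 0] `<=` Omega].

End calculus.

Section sobolev.
Variables (R : realType) (n : nat) (Omega : set 'rV[R]_n).

Definition L2 (f : 'rV[R]_n -> R) : Prop :=
  measurable_fun Omega f /\
  (\int[leb R n]_(x in Omega) (f x ^+ 2)%:E < +oo)%E.

Definition weak_gradient (u : 'rV[R]_n -> R) (Du : 'rV[R]_n -> 'rV[R]_n) :=
  forall phi, test_function Omega phi -> forall i,
    (\int[leb R n]_(x in Omega) (u x * partial i phi x)%:E =
     - \int[leb R n]_(x in Omega) (Du x ord0 i * phi x)%:E)%E.

Definition H1 (u : 'rV[R]_n -> R) (Du : 'rV[R]_n -> 'rV[R]_n) : Prop :=
  [/\ L2 u, forall i, L2 (fun x => Du x ord0 i) & weak_gradient u Du].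

Definition H1_normsq (u : 'rV[R]_n -> R) (Du : 'rV[R]_n -> 'rV[R]_n) : \bar R :=
  (\int[leb R n]_(x in Omega) (u x ^+ 2 + enorm (Du x) ^+ 2)%:E)%E.

(* [H01 u Du]: u belongs to H_0^1(Omega), the closure of C_0^oo(Omega) in
   H^1(Omega), and Du is its weak gradient (unique almost everywhere). *)
Definition H01 (u : 'rV[R]_n -> R) (Du : 'rV[R]_n -> 'rV[R]_n) : Prop :=
  H1 u Du /\
  exists phi : ('rV[R]_n -> R)^nat,
    (forall k, test_function Omega (phi k)) /\
    H1_normsq (fun x => u x - phi k x) (fun x => Du x - gradient (phi k) x)
      @[k --> \oo] --> 0%E.

End sobolev.

Section finsler.
Variables (R : realType) (n : nat) (F : 'rV[R]_n -> R).

Record strongly_convex_norm : Prop := StronglyConvexNorm {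
  norm_ge0 : forall xi, 0 <= F xi ;
  norm_convex : convex_function setT F ;
  norm_homogeneous : forall t xi, F (t *: xi) = `|t| * F xi ;
  norm_coercive :
    exists2 alpha1, 0 < alpha1 & forall xi, alpha1 * enorm xi <= F xi ;
  norm_C2 : class_C 2 [set xi | xi != 0] F ;
  norm_hessian :
    forall xi, xi != 0 -> posdef (hessian (fun eta => F eta ^+ 2) xi) }.

Definition polar (x : 'rV[R]_n) : R :=
  sup [set dotr xi x / F xi | xi in [set xi | xi != 0]].

Definition boundary (Omega : set 'rV[R]_n) := closure Omega `\` interior Omega.

Definition dist_F (Omega : set 'rV[R]_n) (x : 'rV[R]_n) : R :=
  inf [set polar (x - y) | y in boundary Omega].

(* - Delta_F d >= 0 in the sense of distributions. The gradient of [d] is the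
   pointwise one: where a partial derivative does not exist it takes a default
   value, which for Lipschitz [d] only matters on a null set. The value of
   [gradient F] at 0 is irrelevant, being multiplied by [F 0 = 0]. *)
Definition superharmonic (Omega : set 'rV[R]_n) (d : 'rV[R]_n -> R) : Prop :=
  forall phi, test_function Omega phi -> (forall x, 0 <= phi x) ->
    (0 <= \int[leb R n]_(x in Omega)
      (F (gradient d x) *
       dotr (gradient F (gradient d x)) (gradient phi x))%:E)%E.

End finsler.

(* Main.v *)
Require Import Defs.
From HB Require Import structures.
From mathcomp Require Import all_boot all_order all_algebra.
From mathcomp Require Import all_classical all_reals all_analysis.
From mathcomp Require Import measurable_realfun ring lra.
Import Order.TTheory GRing.Theory Num.Theory.
Import numFieldNormedType.Exports.

Set Implicit Arguments.
Unset Strict Implicit.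
Unset Printing Implicit Defensive.

Local Open Scope classical_set_scope.
Local Open Scope ring_scope.

(** The function [f(t) = sqrt (t log (D / t))] satisfies
    [- f'' = (4 t ^ 2)^-1 (1 + (log (D / t))^-2) f] and is nondecreasing up to
    [t = D / e = sup d], so [f (d)] is a positive supersolution of
    [- Delta_F v = w v], where [w] is the weight of the inequality: [d] is
    superharmonic and [F (grad d) = 1]. A positive supersolution gives the inequality
    for test functions: use [phi ^ 2 / v] in the supersolution inequality and complete
    the square ([norm_square_completion]). In terms of [d], this means testing
    superharmonicity with [phi ^ 2 G], where [G = f' (d) / f (d)] is the multiplier
    [mult] at [d ^ 2], and [riccati] is the differential equation of [G].

    The test function [phi ^ 2 G] is not smooth, since [d] is only Lipschitz. The
    remedy is semiconcavity. [F ^ 2] is strongly convex ([norm_sqr_strongly_convex]),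
    so [polar F ^ 2], its conjugate up to scaling, is semiconcave
    ([polar_sqr_semiconcave]), and so is [d ^ 2], an infimum of translates of [polar F
    ^ 2] ([dist_sqr_semiconcave]). Three things follow from this. The partial
    derivatives of [d] exist almost everywhere: a concave function of one variable has
    countably many kinks, and Fubini's theorem does the rest ([kinks_null],
    [dist_exceptional_set]). At every point of [Omega] where they exist, [1 <= F (grad
    d)], because [d] drops at unit speed towards a nearest boundary point
    ([dist_eikonal]); this half of the eikonal equation is what the argument uses. And
    [d ^ 2] is, up to a paraboloid, a limit of Bernstein polynomials that are concave
    along the axes, so that their partial derivatives stay bounded and converge to
    those of [d ^ 2] almost everywhere ([smooth_concave_approx],
    [concave_partial_cvg], [dist_sqr_approximants]). Testing with [phi ^ 2] times the
    multiplier at these polynomials and passing to the limit by dominated convergence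
    proves the inequality for [phi] ([hardy_test]).

    Density of the test functions in [H_0^1] gives the general case: both sides are
    compared along an approximating sequence with a truncated weight
    ([hardy_closure]). The quadratic weight is then the sum of the two zero-order
    terms, each of which is finite because the energy of [u] is. *)

(** * Derivatives along lines and convexity *)

Lemma eq_ler (R : porderType ring_display) (x y : R) : x = y -> x <= y.
Proof. by move=> ->. Qed.

Lemma lipschitz_continuous (R : realType) (V W : normedModType R) (f : V -> W) (K : R) :
  (forall x y : V, `|f x - f y| <= K * `|x - y|) -> continuous f.
Proof.
move=> Hf x; apply: (proj2 (@cvgrPdist_lt R _ _ (nbhs x) _ _ _)) => e e0.
have K1 : 0 < `|K| + 1 by rewrite ltr_wpDl.
apply/nbhs_ballP; exists (e / (`|K| + 1)); first exact: divr_gt0.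
move=> y; rewrite -ball_normE/= ltr_pdivlMr// => xy.
apply: le_lt_trans xy; apply: le_trans (Hf _ _) _; rewrite mulrC.
by apply: ler_wpM2l => //; apply: le_trans (ler_norm _) _; rewrite lerDl.
Qed.

Lemma nonexpansive_continuous (R : realType) (V W : normedModType R) (f : V -> W) :
  (forall x y, `|f x - f y| <= `|x - y|) -> continuous f.
Proof. by move=> Hf; apply: (lipschitz_continuous (K := 1)) => x y; rewrite mul1r. Qed.

Section directional.
Context (R : realType) (V : normedModType R).
Implicit Types (f : V -> R) (x v w : V).

(** Clearing the quotient turns derivability into an inequality that the rest of the
    calculus can feed to linear arithmetic. *)
Lemma is_deriveP f x v (l : R) : is_derive x v f l <->
  forall e : R, 0 < e -> exists2 r : R, 0 < r &
    forall h : R, `|h| < r -> `|f (x + h *: v) - f x - h * l| <= e * `|h|.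
Proof.
split=> [df e e0|H].
  have [df1 df2] := df.
  have : (fun h => h^-1 *: ((f \o shift x) (h *: v) - f x)) @ 0^' --> l.
    by rewrite -df2; exact: df1.
  move=> /cvgrPdist_le /(_ _ e0) /nbhs_ballP[r /= r0 Hr].
  exists r => // h hr; have [->|h0] := eqVneq h 0.
    by rewrite scale0r addr0 mul0r !subrr normr0 mulr0.
  have := Hr h; rewrite /ball/= sub0r normrN => /(_ hr h0)/=.
  rewrite [h *: v + x]addrC distrC => H.
  rewrite -ler_pdivrMr ?normr_gt0// -normfV -normrM.
  apply: le_trans H; apply: eq_ler; congr (`|_|).
  rewrite [_ *: (_ - _)]/GRing.scale/=; field.
  exact: h0.
have cv : (fun h => h^-1 *: ((f \o shift x) (h *: v) - f x)) @ 0^' --> l.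
  apply/cvgrPdist_le => e e0; have [r r0 Hr] := H e e0.
  apply/nbhs_ballP; exists r => //= h; rewrite /ball/= sub0r normrN => hr h0.
  have := Hr h hr; rewrite -ler_pdivrMr ?normr_gt0// -normfV -normrM.
  apply: le_trans; rewrite distrC [h *: v + x]addrC.
  apply: eq_ler; congr (`|_|); rewrite [_ *: (_ - _)]/GRing.scale/=; field.
  exact: h0.
by apply: DeriveDef; [apply/cvg_ex; exists l|apply: cvg_lim].
Qed.

Lemma is_derive_val f x v l l' : is_derive x v f l -> is_derive x v f l' ->
  l = l'.
Proof. by move=> [_ <-] [_ <-]. Qed.

Lemma is_derive_scale f x v (c l : R) :
  is_derive x v f l -> is_derive x (c *: v) f (c * l).
Proof.
move=> /is_deriveP df; apply/is_deriveP => e e0.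
have c1 : 0 < `|c| + 1 by rewrite ltr_wpDl.
have [r r0 Hr] := df (e / (`|c| + 1)) (divr_gt0 e0 c1).
exists (r / (`|c| + 1)); first exact: divr_gt0.
move=> h hr; rewrite scalerA [h * (c * l)]mulrA.
have hc : `|h * c| <= `|h| * (`|c| + 1).
  by rewrite normrM ler_wpM2l// lerDl.
have hcr : `|h * c| < r.
  by apply: le_lt_trans hc _; rewrite -ltr_pdivlMr.
apply: le_trans (Hr _ hcr) _.
rewrite mulrAC ler_pdivrMr// -mulrA ler_pM2l//.
Qed.

End directional.

Section lines.
Context (R : realType) (V : normedModType R).
Implicit Types (f : V -> R) (x v w : V).

Lemma is_derive_line f x v (t l : R) :
  is_derive (x + t *: v) v f l <-> is_derive t 1 (fun s : R => f (x + s *: v)) l.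
Proof.
have E (h : R) : x + (t + h *: 1) *: v = x + t *: v + h *: v.
  by rewrite scalerDl addrA [_ *: 1]mulr1.
split=> /is_deriveP df; apply/is_deriveP => e e0; have [r r0 Hr] := df e e0.
  by exists r => // h hr; rewrite E; exact: Hr.
by exists r => // h hr; rewrite -E; exact: Hr.
Qed.

Lemma is_derive_line0 f x v (l : R) :
  is_derive x v f l <-> is_derive (0 : R) 1 (fun s : R => f (x + s *: v)) l.
Proof. by rewrite -is_derive_line scale0r addr0. Qed.

Lemma is_derive_chain f (g : R -> R) x v (l m : R) :
  is_derive x v f l -> is_derive (f x) 1 g m -> is_derive x v (g \o f) (m * l).
Proof.
move=> /is_derive_line0 df dg; apply/is_derive_line0.
have -> : (fun s : R => (g \o f) (x + s *: v)) = g \o (fun s => f (x + s *: v)).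
  by [].
have dg' : is_derive ((fun s => f (x + s *: v)) (0 : R)) 1 g m.
  by rewrite /= scale0r addr0.
exact: is_derive1_comp.
Qed.

(** One-sided differentiability along [w]. Convexity makes it additive in the direction
    ([updirD]), so that partial derivatives alone bound the growth in every
    direction. *)
Definition updir f x w (l : R) := forall e : R, 0 < e -> exists2 r : R, 0 < r &
  forall h : R, `|h| < r -> f (x + h *: w) <= f x + h * l + e * `|h|.

Lemma is_derive_updir f x w l : is_derive x w f l -> updir f x w l.
Proof.
move=> /is_deriveP df e e0; have [r r0 Hr] := df e e0; exists r => // h hr.
by move: (Hr h hr); rewrite ler_norml => /andP[_]; lra.
Qed.

Lemma updir0 f x : updir f x 0 0.
Proof.
move=> e e0; exists 1 => // h _.
by rewrite scaler0 mulr0 !addr0 lerDl mulr_ge0// ltW.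
Qed.

Definition is_convex f := forall x y (t : R), 0 <= t -> t <= 1 ->
  f (t *: x + (1 - t) *: y) <= t * f x + (1 - t) * f y.

(** The midpoint of [x + 2 h w1] and [x + 2 h w2] is [x + h (w1 + w2)]. *)
Lemma updirD f x w1 w2 l1 l2 : is_convex f ->
  updir f x w1 l1 -> updir f x w2 l2 -> updir f x (w1 + w2) (l1 + l2).
Proof.
move=> cf H1 H2 e e0.
have e20 : 0 < e / 2 by rewrite divr_gt0.
have [r1 r10 {}H1] := H1 _ e20; have [r2 r20 {}H2] := H2 _ e20.
exists (Num.min r1 r2 / 2); first by rewrite divr_gt0// lt_min r10.
move=> h; rewrite ltr_pdivlMr// lt_min => /andP[h1 h2].
have N2 : `|2 * h| = `|h| * 2 by rewrite normrM normr_nat mulrC.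
have {}H1 := H1 (2 * h); rewrite N2 in H1; have {}H1 := H1 h1.
have {}H2 := H2 (2 * h); rewrite N2 in H2; have {}H2 := H2 h2.
have := cf (x + (2 * h) *: w1) (x + (2 * h) *: w2) (1 / 2).
have -> : (1 / 2 : R) *: (x + (2 * h) *: w1) +
    (1 - 1 / 2) *: (x + (2 * h) *: w2) = x + h *: (w1 + w2).
  rewrite (_ : 1 - 1 / 2 = 1 / 2 :> R); last by field.
  rewrite !scalerDr !scalerA addrACA -scalerDl.
  rewrite (_ : 1 / 2 + 1 / 2 = 1 :> R); last by field.
  by rewrite scale1r (_ : 1 / 2 * (2 * h) = h)//; field.
move=> /(_ ltac:(lra) ltac:(lra)); move: H1 H2.
set a := f (_ + _ *: w1); set b := f (_ + _ *: w2); set c := f (_ + _ *: (_ + _)).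
lra.
Qed.

(** A convex function lies above the affine map read off its first-order growth:
    a point to the left of [x] on the line through [x + v] is used as lever. *)
Lemma updir_convex f x v l : is_convex f -> updir f x v l -> f x + l <= f (x + v).
Proof.
move=> cf H; apply/ler_addgt0Pl => e e0; have [r r0 {}H] := H e e0.
pose t := r / 2; have t0 : 0 < t by rewrite divr_gt0.
have := H (- t); rewrite normrN gtr0_norm// /t => /(_ ltac:(lra)).
rewrite -/t mulNr => {}H.
have t1 : 0 < 1 + t by rewrite ltr_pwDl// ltW.
have t1' : 1 + t != 0 by rewrite gt_eqF.
have := cf (x + v) (x + (- t) *: v) (t / (1 + t)).
have -> : 1 - t / (1 + t) = 1 / (1 + t) by field.
have -> : (t / (1 + t)) *: (x + v) + (1 / (1 + t)) *: (x + - t *: v) = x.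
  rewrite !scalerDr !scalerA addrACA -[X in X + _]scalerDl -[X in _ + X]scalerDl.
  rewrite (_ : _ / _ + 1 / _ = 1) ?scale1r; last by field.
  by rewrite (_ : _ + _ * - t = 0) ?scale0r ?addr0//; field.
move=> /(_ (divr_ge0 (ltW t0) (ltW t1))) => cvx.
have : f x * (1 + t) <= t * f (x + v) + f (x + - t *: v).
  rewrite -ler_pdivlMr//; apply: le_trans (cvx _) _.
    by rewrite ler_pdivrMr// mul1r lerDr.
  by apply: eq_ler; field.
move: H; set a := f (x + v); set b := f (x + _) => H1 H2.
have : 0 <= t * (e + a - (f x + l)) by lra.
by rewrite pmulr_rge0// subr_ge0.
Qed.

End lines.

Section row_vectors.
Context (R : realType) (n : nat).
Implicit Types (f : 'rV[R]_n -> R) (x v w : 'rV[R]_n).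

Lemma updir_sum f x v (l : 'I_n -> R) : is_convex f ->
  (forall i, is_derive x (delta_mx ord0 i) f (l i)) ->
  updir f x v (\sum_i v ord0 i * l i).
Proof.
move=> cf df; rewrite [X in updir _ _ X _](row_sum_delta v).
elim/big_ind2 : _ => [|w1 l1 w2 l2|i _]; first exact: updir0.
  exact: updirD.
by apply: is_derive_updir; exact: is_derive_scale.
Qed.

Lemma mx_norm_coord v i : `|v ord0 i| <= `|v|.
Proof.
rewrite [leRHS]/Num.norm/= mx_normrE.
exact: (le_bigmax _ (fun ij : 'I_1 * 'I_n => `|v ij.1 ij.2|) (ord0, i)).
Qed.

Lemma mx_norm_le v (c : R) : 0 <= c -> (forall i, `|v ord0 i| <= c) -> `|v| <= c.
Proof.
move=> c0 H; rewrite /Num.norm/= mx_normrE; apply/bigmax_leP; split=> // -[i j] _ /=.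
by rewrite (ord1 i).
Qed.

Lemma mx_norm_delta i : `|delta_mx ord0 i : 'rV[R]_n| <= 1.
Proof.
by apply: mx_norm_le => // j; rewrite mxE eqxx/=; case: eqP; rewrite ?normr1 ?normr0.
Qed.

(** Moving from [x] to [x + w] one coordinate at a time and using the mean value
    theorem on each leg, a function with continuous partial derivatives is
    differentiable. *)
Lemma class_C1_derive f (A : set 'rV[R]_n) x v : open A -> A x -> class_C 1 A f ->
  is_derive x v f (\sum_i v ord0 i * partial i f x).
Proof.
move=> oA Ax [_ cf]; apply/is_deriveP => e e0.
pose s := \sum_i `|v ord0 i|; have s0 : 0 <= s by apply: sumr_ge0.
have s1 : 0 < s + 1 by rewrite ltr_wpDl.
pose e' := e / (s + 1); have e'0 : 0 < e' by rewrite divr_gt0.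
have : \forall y \near x, A y /\ forall i, `|partial i f x - partial i f y| <= e'.
  near=> y; split; first by near: y; exact: open_nbhs_nbhs.
  near: y; apply: filter_forall => i.
  have [_ [/(_ x Ax) cp _]] := cf i.
  by move/cvgrPdist_le : cp; exact.
move=> /nbhs_ballP[r /= r0 Hr].
have {}Hr y : `|y - x| < r ->
    A y /\ forall i, `|partial i f x - partial i f y| <= e'.
  by move=> yr; apply: Hr; rewrite -ball_normE/= distrC.
have key w : `|w| < r ->
    `|f (x + w) - f x - \sum_i w ord0 i * partial i f x| <= e' * \sum_i `|w ord0 i|.
  move=> wr.
  pose W k : 'rV[R]_n := \row_i (if (i < k)%N then w ord0 i else 0).
  have WS (k : 'I_n) : W k.+1 = W k + w ord0 k *: delta_mx ord0 k.
    apply/rowP => j; rewrite !mxE eqxx/= ltnS leq_eqVlt.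
    have [->|jk] := eqVneq j k; first by rewrite eqxx ltnn/= mulr1 add0r.
    by rewrite val_eqE (negbTE jk)/= mulr0n mulr0 addr0.
  have leg (k : 'I_n) : `|f (x + W k.+1) - f (x + W k) - w ord0 k * partial k f x|
      <= e' * `|w ord0 k|.
    pose g (t : R) := f (x + W k + t *: (w ord0 k *: delta_mx ord0 k)).
    have inb (t : R) : 0 <= t <= 1 ->
        `|x + W k + t *: (w ord0 k *: delta_mx ord0 k) - x| < r.
      move=> /andP[t0 t1]; rewrite addrAC [x + W k]addrC addrK.
      apply: le_lt_trans wr; apply: mx_norm_le => // i; rewrite !mxE eqxx/=.
      have [->|ik] := eqVneq i k.
        rewrite ltnn add0r mulr1 normrM ger0_norm//.
        apply: le_trans (mx_norm_coord w k).
        by rewrite ler_piMl.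
      rewrite !mulr0 addr0; case: ifP => _; last by rewrite normr0.
      exact: mx_norm_coord.
    have dg (t : R) : 0 <= t <= 1 -> is_derive t 1 g
        (w ord0 k * partial k f (x + W k + t *: (w ord0 k *: delta_mx ord0 k))).
      move=> /inb tr; have [Az _] := Hr _ tr.
      apply: (proj1 (is_derive_line f (x + W k) (w ord0 k *: delta_mx ord0 k) t _)).
      apply: is_derive_scale; apply: derivableP.
      by have [/(_ _ Az)] := cf k.
    have [||t t01] := @MVT R g (fun t => w ord0 k *
        partial k f (x + W k + t *: (w ord0 k *: delta_mx ord0 k))) 0 1 ltr01.
    - move=> t; rewrite in_itv/= => /andP[t0 t1]; apply: dg.
      by rewrite (ltW t0) ltW.
    - apply: derivable_within_continuous => t; rewrite in_itv/= => t01.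
      by have [] := dg t t01.
    rewrite subr0 mulr1 /g scale1r scale0r addr0 -addrA -WS => ->.
    move: t01; rewrite in_itv/= => /andP[t0 t1].
    have [_ /(_ k) H] : A _ /\ _ := Hr _ (inb t ltac:(by rewrite (ltW t0) ltW)).
    rewrite -mulrBr normrM mulrC ler_wpM2r// distrC; exact: H.
  have tele (k : nat) : (k <= n)%N -> `|f (x + W k) - f x -
      \sum_(i < n | (i < k)%N) w ord0 i * partial i f x| <=
      e' * \sum_(i < n | (i < k)%N) `|w ord0 i|.
    elim: k => [_|k IH kn].
      have -> : W 0 = 0 by apply/rowP => j; rewrite !mxE.
      by rewrite !big_pred0// addr0 subrr subr0 normr0 mulr0.
    have {}IH := IH (ltnW kn).
    have E (F : 'I_n -> R) : \sum_(i < n | (i < k.+1)%N) F i =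
        F (Ordinal kn) + \sum_(i < n | (i < k)%N) F i.
      rewrite (bigD1 (Ordinal kn))//=; congr (_ + _); apply: eq_bigl => i.
      rewrite ltnS leq_eqVlt -val_eqE/=.
      by case: (ltngtP i k).
    rewrite !E; have := leg (Ordinal kn); rewrite /= mulrDr.
    move: IH; set a := \sum_(i < n | _) _ * _; set b := \sum_(i < n | _) _.
    set c := _ * partial _ _ _; rewrite !ler_norml; lra.
  have := tele n (leqnn n); have -> : W n = w.
    by apply/rowP => j; rewrite mxE ltn_ord.
  have E (F : 'I_n -> R) : \sum_(i < n | (i < n)%N) F i = \sum_i F i.
    by apply: eq_bigl => i; rewrite ltn_ord.
  by rewrite !E.
exists (r / (`|v| + 1)); first by rewrite divr_gt0// ltr_wpDl.
move=> h hr; have := key (h *: v); rewrite normrZ.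
have -> : `|h| * `|v| < r.
  have v1 : 0 < `|v| + 1 by rewrite ltr_wpDl.
  apply: le_lt_trans (_ : `|h| * (`|v| + 1) < r).
    by rewrite ler_wpM2l// lerDl.
  by rewrite -ltr_pdivlMr.
move=> /(_ isT).
have -> : \sum_i (h *: v) ord0 i * partial i f x = h * \sum_i v ord0 i * partial i f x.
  by rewrite mulr_sumr; apply: eq_bigr => i _; rewrite mxE mulrA.
have -> : \sum_i `|(h *: v) ord0 i| = `|h| * s.
  by rewrite mulr_sumr; apply: eq_bigr => i _; rewrite mxE normrM.
move=> /le_trans; apply; rewrite mulrCA mulrC ler_wpM2r// /e' mulrAC.
by rewrite ler_pdivrMr// ler_pM2l// lerDl.
Unshelve. all: by end_near. Qed.

End row_vectors.

Section second_derivative.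
Context (R : realType).
Implicit Types f g : R -> R.

Lemma mvt_everywhere f (df : R -> R) (a b : R) : a <= b ->
  (forall x : R, is_derive x 1 f (df x)) ->
  exists2 c, a <= c <= b & f b - f a = df c * (b - a).
Proof.
move=> ab Df.
have [|c cab ->] := @MVT_segment R f df a b ab (fun x _ => Df x).
  apply: derivable_within_continuous => x _.
  by have [] := Df x.
by exists c => //; move: cab; rewrite in_itv.
Qed.

Lemma convex_of_second_derivative g (g1 g2 : R -> R) :
  (forall t : R, is_derive t 1 g (g1 t)) -> (forall t : R, is_derive t 1 g1 (g2 t)) ->
  (forall t, 0 <= g2 t) ->
  forall t, 0 <= t -> t <= 1 -> g t <= t * g 1 + (1 - t) * g 0.
Proof.
move=> d1 d2 g20 t t0 t1.
have [c /andP[_ ct] Ec] := mvt_everywhere t0 d1.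
have [c' /andP[tc' _] Ec'] := mvt_everywhere t1 d1.
have [c'' _ E] := mvt_everywhere (le_trans ct tc') d2.
have H : g1 c <= g1 c'.
  by rewrite -subr_ge0 E mulr_ge0// subr_ge0 (le_trans ct).
have : g1 c * (t * (1 - t)) <= g1 c' * (t * (1 - t)).
  by rewrite ler_wpM2r// mulr_ge0// subr_ge0.
have -> : g1 c * (t * (1 - t)) = (g t - g 0) * (1 - t) by rewrite Ec; ring.
have -> : g1 c' * (t * (1 - t)) = (g 1 - g t) * t by rewrite Ec'; ring.
lra.
Qed.

End second_derivative.

(** * Functions of class C^k *)

Section class_C_closure.
Context (R : realType) (n : nat).
Implicit Types (f g : 'rV[R]_n -> R) (A B : set 'rV[R]_n) (k : nat).

Lemma class_C_continuous k A f x : A x -> class_C k A f -> {for x, continuous f}.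
Proof. by case: k => [|k] Ax [H _]; exact: H. Qed.

Lemma class_CS k A f : class_C k.+1 A f -> class_C k A f.
Proof.
elim: k f => [|k IH] f [H1 H2]; split => //.
move=> i; have [? ?] := H2 i; split => //; exact: IH.
Qed.

Lemma class_C_derive k A f x i : A x -> class_C k.+1 A f ->
  is_derive x (delta_mx ord0 i) f (partial i f x).
Proof.
by move=> Ax [_ /(_ i)[/(_ x Ax) df _]]; apply: derivableP.
Qed.

Lemma class_C_partial k A f i : class_C k.+1 A f -> class_C k A (partial i f).
Proof. by move=> [_ /(_ i)[]]. Qed.

Lemma class_C_build k A f (df : 'I_n -> 'rV[R]_n -> R) :
  (forall x, A x -> {for x, continuous f}) ->
  (forall i x, A x -> is_derive x (delta_mx ord0 i) f (df i x)) ->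
  (forall i, class_C k A (partial i f)) -> class_C k.+1 A f.
Proof.
move=> cf df' dc; split=> // i; split => [x Ax|//].
by have [] := df' i x Ax.
Qed.

Lemma class_C_subset k A B f : A `<=` B -> class_C k B f -> class_C k A f.
Proof.
move=> AB; elim: k f => [|k IH] f [H1 H2]; split => //.
- by move=> x /AB; exact: H1.
- by move=> x /AB; exact: H1.
- move=> i; have [H3 H4] := H2 i; split; last exact: IH.
  by move=> x /AB; exact: H3.
Qed.

Lemma class_CU k A B f : class_C k A f -> class_C k B f -> class_C k (A `|` B) f.
Proof.
elim: k f => [|k IH] f [A1 A2] [B1 B2]; split => //.
- by move=> x [/A1|/B1].
- by move=> x [/A1|/B1].
- move=> i; have [A3 A4] := A2 i; have [B3 B4] := B2 i; split; last exact: IH.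
  by move=> x [/A3|/B3].
Qed.

Lemma near_open_eq A f g x : open A -> (forall x, A x -> f x = g x) -> A x ->
  \forall y \near x, f y = g y.
Proof.
move=> oA fg Ax; apply: (filterS fg); exact: open_nbhs_nbhs.
Qed.

Lemma near_eq_continuous f g x : (\forall y \near x, f y = g y) ->
  {for x, continuous f} -> {for x, continuous g}.
Proof.
move=> fg cf; rewrite /prop_for /continuous_at -(nbhs_singleton fg).
exact: cvg_trans (near_eq_cvg fg) cf.
Qed.

Lemma class_C_ext k A f g : open A -> (forall x, A x -> f x = g x) ->
  class_C k A f -> class_C k A g.
Proof.
move=> oA; elim: k f g => [|k IH] f g fg [H1 H2].
  split=> // x Ax; exact: near_eq_continuous (near_open_eq oA fg Ax) (H1 x Ax).
split.
  move=> x Ax; exact: near_eq_continuous (near_open_eq oA fg Ax) (H1 x Ax).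
move=> i; have [H3 H4] := H2 i; split=> [x Ax|].
  apply: near_eq_derivable (H3 x Ax).
  exact: (near_open_eq oA fg).
apply: IH H4 => x Ax; rewrite /partial; apply: near_eq_derive.
exact: (near_open_eq oA fg).
Qed.

Lemma partial_is_derive f x i (l : R) : is_derive x (delta_mx ord0 i) f l ->
  partial i f x = l.
Proof. by move=> [_ <-]. Qed.

Lemma class_C_cst k A (c : R) : class_C k A (fun=> c).
Proof.
have E i : partial i (fun _ : 'rV[R]_n => c) = fun=> 0.
  by apply/funext => x; apply: partial_is_derive; exact: is_derive_cst.
elim: k c E => [|k IH] c E; first by split=> // x _; exact: cst_continuous.
split=> [x _|i]; first exact: cst_continuous.
split=> [x _|]; first exact: derivable_cst.
rewrite E; apply: IH => j.
by apply/funext => x; apply: partial_is_derive; exact: is_derive_cst.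
Qed.

Lemma class_CD k A f g : open A -> class_C k A f -> class_C k A g ->
  class_C k A (fun x => f x + g x).
Proof.
move=> oA; elim: k f g => [|k IH] f g Hf Hg.
  split=> // x Ax; exact: cvgD (class_C_continuous Ax Hf) (class_C_continuous Ax Hg).
apply: (@class_C_build _ _ _ (fun i x => partial i f x + partial i g x)).
- move=> x Ax; exact: cvgD (class_C_continuous Ax Hf) (class_C_continuous Ax Hg).
- by move=> i x Ax; apply: is_deriveD; [exact: (class_C_derive i Ax Hf)|exact: (class_C_derive i Ax Hg)].
move=> i; apply: (@class_C_ext _ _ (fun x => partial i f x + partial i g x)) => //.
  move=> x Ax; apply/esym/partial_is_derive.
  by apply: is_deriveD; [exact: (class_C_derive i Ax Hf)|exact: (class_C_derive i Ax Hg)].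
by apply: IH; exact: class_C_partial.
Qed.

Lemma class_CM k A f g : open A -> class_C k A f -> class_C k A g ->
  class_C k A (fun x => f x * g x).
Proof.
move=> oA; elim: k f g => [|k IH] f g Hf Hg.
  split=> // x Ax; exact: cvgM (class_C_continuous Ax Hf) (class_C_continuous Ax Hg).
have D (i : 'I_n) x : A x -> is_derive x (delta_mx ord0 i) (fun x => f x * g x)
    (f x * partial i g x + g x * partial i f x).
  by move=> Ax; apply: is_deriveM; [exact: (class_C_derive i Ax Hf)|exact: (class_C_derive i Ax Hg)].
apply: (@class_C_build _ _ _ _ _ D).
- move=> x Ax; exact: cvgM (class_C_continuous Ax Hf) (class_C_continuous Ax Hg).
move=> i; apply: (class_C_ext oA (fun x Ax => esym (partial_is_derive (D i x Ax)))).
by apply: class_CD => //; apply: IH; (exact: class_C_partial || exact: class_CS).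
Qed.

Lemma class_CN k A f : open A -> class_C k A f -> class_C k A (fun x => - f x).
Proof.
move=> oA Hf; apply: (@class_C_ext _ _ (fun x => (-1) * f x)) => //.
  by move=> x _; rewrite mulN1r.
by apply: class_CM => //; exact: class_C_cst.
Qed.

Lemma class_CB k A f g : open A -> class_C k A f -> class_C k A g ->
  class_C k A (fun x => f x - g x).
Proof. by move=> oA Hf Hg; apply: class_CD => //; exact: class_CN. Qed.

Lemma class_C_sum k A (I : Type) (r : seq I) (P : pred I) (F : I -> 'rV[R]_n -> R) :
  open A -> (forall i, class_C k A (F i)) ->
  class_C k A (fun x => \sum_(i <- r | P i) F i x).
Proof.
move=> oA HF; elim: r => [|i r IH].
  by apply: (class_C_ext oA _ (class_C_cst k A 0)) => x _; rewrite big_nil.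
apply: (@class_C_ext _ _ (fun x => (if P i then F i x else 0) +
    \sum_(i <- r | P i) F i x)) => //.
  by move=> x _; rewrite big_cons; case: (P i) => //; rewrite add0r.
apply: class_CD => //; case: (P i) => //; exact: class_C_cst.
Qed.

Lemma is_derive_coord (x : 'rV[R]_n) (i j : 'I_n) :
  is_derive x (delta_mx ord0 i) (fun y : 'rV[R]_n => y ord0 j) (j == i)%:R.
Proof.
apply/is_deriveP => e e0; exists 1 => // h _.
by rewrite !mxE eqxx/= [X in X - _ - _]addrC addrK subrr normr0 mulr_ge0// ltW.
Qed.

Lemma class_C_coord k A (j : 'I_n) : open A -> class_C k A (fun x => x ord0 j).
Proof.
move=> oA; have cc x : {for x, continuous (fun x : 'rV[R]_n => x ord0 j)}.
  exact: coord_continuous.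
case: k => [|k]; first by split.
apply: (@class_C_build _ _ _ (fun i _ => (j == i)%:R)) => //.
  by move=> i x _; exact: is_derive_coord.
move=> i; have -> : partial i (fun x : 'rV[R]_n => x ord0 j) = fun=> (j == i)%:R.
  by apply/funext => x; apply: partial_is_derive; exact: is_derive_coord.
exact: class_C_cst.
Qed.

Lemma is_derive_inv (s : R) : s != 0 -> is_derive s 1 (fun s : R => s^-1) (- s^-1 ^+ 2).
Proof.
move=> s0; have did : derivable (@id R) s 1 by exact: derivable_id.
apply: DeriveDef; first exact: (@derivableV _ _ id).
by rewrite (@deriveV _ _ id)// derive_id [_ *: 1]mulr1 exprVn.
Qed.

Lemma class_CV k A f : open A -> (forall x, A x -> f x != 0) -> class_C k A f ->
  class_C k A (fun x => (f x)^-1).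
Proof.
move=> oA f0; elim: k => [|k IH] Hf.
  by split=> // x Ax; exact: cvgV (f0 x Ax) (class_C_continuous Ax Hf).
have D (i : 'I_n) x : A x -> is_derive x (delta_mx ord0 i) (fun x => (f x)^-1)
    (- (f x)^-1 ^+ 2 * partial i f x).
  move=> Ax; apply: (is_derive_chain (g := fun s : R => s^-1)).
    exact: (class_C_derive i Ax Hf).
  by apply: is_derive_inv; exact: f0.
apply: (@class_C_build _ _ _ _ _ D).
- by move=> x Ax; exact: cvgV (f0 x Ax) (class_C_continuous Ax Hf).
move=> i; apply: (class_C_ext oA (fun x Ax => esym (partial_is_derive (D i x Ax)))).
have Hf' := class_CS Hf.
apply: class_CM => //; last exact: class_C_partial.
by apply: class_CN => //; apply: class_CM => //; exact: IH.
Qed.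

Lemma class_C_expR k A f : open A -> class_C k A f ->
  class_C k A (fun x => expR (f x)).
Proof.
move=> oA; elim: k => [|k IH] Hf.
  split=> // x Ax; apply: (@continuous_comp _ _ _ f expR); last exact: continuous_expR.
  exact: (class_C_continuous Ax Hf).
have D (i : 'I_n) x : A x -> is_derive x (delta_mx ord0 i) (fun x => expR (f x))
    (expR (f x) * partial i f x).
  move=> Ax; apply: (is_derive_chain (g := expR)).
    exact: (class_C_derive i Ax Hf).
apply: (@class_C_build _ _ _ _ _ D).
- move=> x Ax; apply: (@continuous_comp _ _ _ f expR); last exact: continuous_expR.
  exact: (class_C_continuous Ax Hf).
move=> i; apply: (class_C_ext oA (fun x Ax => esym (partial_is_derive (D i x Ax)))).
by apply: class_CM => //; [apply: IH; exact: class_CS|exact: class_C_partial].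
Qed.

Lemma class_C_ln k A f : open A -> (forall x, A x -> 0 < f x) -> class_C k A f ->
  class_C k A (fun x => ln (f x)).
Proof.
move=> oA f0; case: k => [|k] Hf.
  split=> // x Ax; apply: (@continuous_comp _ _ _ f (@ln R)); last by apply: continuous_ln; exact: f0.
  exact: (class_C_continuous Ax Hf).
have D (i : 'I_n) x : A x -> is_derive x (delta_mx ord0 i) (fun x => ln (f x))
    ((f x)^-1 * partial i f x).
  move=> Ax; apply: (is_derive_chain (g := @ln R)).
    exact: (class_C_derive i Ax Hf).
  by apply: is_derive1_ln; exact: f0.
apply: (@class_C_build _ _ _ _ _ D).
- move=> x Ax; apply: (@continuous_comp _ _ _ f (@ln R)); last by apply: continuous_ln; exact: f0.
  exact: (class_C_continuous Ax Hf).
move=> i; apply: (class_C_ext oA (fun x Ax => esym (partial_is_derive (D i x Ax)))).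
apply: class_CM => //; last exact: class_C_partial.
apply: class_CV => //; last exact: class_CS.
by move=> x /f0; rewrite lt0r => /andP[].
Qed.

End class_C_closure.

(** * Bernstein approximation of concave functions *)

Section bernstein1.
Context (R : realType).
Implicit Types (a b : nat -> R) (x y c : R) (N : nat).

(** The Bernstein polynomial of degree [N] with coefficients [a 0], ..., [a N],
    in de Casteljau form, which makes its properties inductions on the degree. *)
Fixpoint bern N a x : R :=
  if N is N'.+1 then (1 - x) * bern N' a x + x * bern N' (fun k => a k.+1) x
  else a 0%N.

Lemma bernD N a b c x :
  bern N (fun k => a k + c * b k) x = bern N a x + c * bern N b x.
Proof. by elim: N a b => [|N IH] a b //=; rewrite !IH; ring. Qed.

Lemma bernB N a b x : bern N (fun k => a k - b k) x = bern N a x - bern N b x.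
Proof. by elim: N a b => [|N IH] a b //=; rewrite !IH; ring. Qed.

Lemma bern_cst N c x : bern N (fun=> c) x = c.
Proof. by elim: N => [|N IH] //=; rewrite !IH; ring. Qed.

Lemma bern_le N a b x : 0 <= x <= 1 -> (forall k, (k <= N)%N -> a k <= b k) ->
  bern N a x <= bern N b x.
Proof.
move=> /[dup] x01 /andP[x0 x1]; elim: N a b => [|N IH] a b H /=; first exact: H.
apply: lerD; apply: ler_wpM2l; rewrite ?subr_ge0//; apply: IH => k kN; apply: H.
  exact: leqW.
by [].
Qed.

Lemma bern_dist N a b (c : nat -> R) x : 0 <= x <= 1 ->
  (forall k, (k <= N)%N -> `|a k - b k| <= c k) ->
  `|bern N a x - bern N b x| <= bern N c x.
Proof.
move=> x01 H; rewrite -bernB ler_norml; apply/andP; split.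
  rewrite -[leLHS]add0r -[X in X - _](bern_cst N 0 x) -bernB; apply: bern_le => // k kN.
  by have := H k kN; rewrite ler_norml sub0r => /andP[].
apply: bern_le => // k kN.
by have := H k kN; rewrite ler_norml => /andP[].
Qed.

Lemma bern_derive N a x :
  is_derive x 1 (bern N a) (N%:R * bern N.-1 (fun k => a k.+1 - a k) x).
Proof.
elim: N a => [|N IH] a; first by rewrite mul0r; exact: is_derive_cst.
have d1 : is_derive x 1 (fun x : R => 1 - x) (-1).
  apply/is_deriveP => e e0; exists 1 => // h _.
  have -> : 1 - (x + h *: 1) - (1 - x) - h * -1 = 0 by rewrite /GRing.scale/=; ring.
  by rewrite normr0 mulr_ge0// ltW.
have d2 : is_derive x 1 (@id R) 1 by exact: is_derive_id.
have D : is_derive x 1 (bern N.+1 a) _ :=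
  is_deriveD (is_deriveM d1 (IH a)) (is_deriveM d2 (IH (fun k => a k.+1))).
apply: (is_derive_eq D); rewrite /GRing.scale/=.
case: N {IH D} => [|N] /=; first by ring.
by rewrite !bernB -[N.+2%:R]natr1; ring.
Qed.

Lemma bern_mean N x : bern N (fun k => k%:R) x = N%:R * x.
Proof.
elim: N => [|N IH] /=; first by rewrite mul0r.
have -> : bern N (fun k => k.+1%:R) x = bern N (fun k => k%:R) x + 1 * bern N (fun=> 1) x.
  rewrite -bernD; congr bern; apply/funext => k.
  by rewrite mul1r -natr1.
by rewrite bern_cst IH -natr1; ring.
Qed.

Lemma bern_sqr N x :
  bern N (fun k => k%:R ^+ 2) x = N%:R * x * (1 - x) + (N%:R * x) ^+ 2.
Proof.
elim: N => [|N IH] /=; first by rewrite !mul0r expr0n/= addr0.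
have -> : bern N (fun k => k.+1%:R ^+ 2) x = bern N (fun k => k%:R ^+ 2) x +
    1 * bern N (fun k => 1 + 2 * k%:R) x.
  rewrite -bernD; congr bern; apply/funext => k.
  by rewrite -natr1; ring.
by rewrite bernD bern_cst bern_mean IH -natr1; ring.
Qed.

Lemma bern_variance N x :
  bern N (fun k => (k%:R - N%:R * x) ^+ 2) x = N%:R * x * (1 - x).
Proof.
have -> : (fun k : nat => (k%:R - N%:R * x) ^+ 2) =
    (fun k => k%:R ^+ 2 + 1 * ((N%:R * x) ^+ 2 + (- 2 * (N%:R * x)) * k%:R)).
  by apply/funext => k; ring.
by rewrite !bernD bern_cst bern_sqr bern_mean; ring.
Qed.

(** The second derivative of a Bernstein polynomial is the Bernstein polynomial of
    the second differences, so concave coefficients give a polynomial that is concave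
    on [0, 1], hence below its tangents. *)
Lemma bern_tangent N a x y :
  (forall k, a k.+2 - a k.+1 <= a k.+1 - a k) -> 0 <= x <= 1 -> 0 <= y <= 1 ->
  bern N a y <= bern N a x + (y - x) * (N%:R * bern N.-1 (fun k => a k.+1 - a k) x).
Proof.
move=> ca x01 y01.
pose b1 (z : R) := N%:R * bern N.-1 (fun k => a k.+1 - a k) z.
pose b2 (z : R) := N%:R * (N.-1%:R *
  bern N.-2 (fun k => a k.+2 - a k.+1 - (a k.+1 - a k)) z).
have d1 (z : R) : is_derive z 1 (bern N a) (b1 z) := bern_derive N a z.
have d2 (z : R) : is_derive z 1 b1 (b2 z).
  exact: (is_deriveZ N%:R (bern_derive N.-1 (fun k => a k.+1 - a k) z)).
have b20 (z : R) : 0 <= z <= 1 -> b2 z <= 0.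
  move=> z01; rewrite mulr_ge0_le0// mulr_ge0_le0//.
  rewrite -[leRHS](bern_cst N.-2 0 z); apply: bern_le => // k _.
  by rewrite subr_le0.
have mono (u v : R) : 0 <= u -> u <= v -> v <= 1 -> b1 v <= b1 u.
  move=> u0 uv v1; have [c /andP[uc cv] E] := mvt_everywhere uv d2.
  rewrite -subr_le0 E mulr_le0_ge0// ?subr_ge0// b20//.
  by rewrite (le_trans u0)//= (le_trans cv).
move: x01 y01 => /andP[x0 x1] /andP[y0 y1].
have [xy|yx] := leP x y.
  have [c /andP[xc cy] E] := mvt_everywhere xy d1.
  rewrite -lerBlDl E mulrC ler_wpM2l ?subr_ge0//.
  by apply: mono => //; exact: le_trans y1.
have [c /andP[yc cx] E] := mvt_everywhere (ltW yx) d1.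
have : b1 x * (x - y) <= b1 c * (x - y).
  by rewrite ler_wpM2r ?subr_ge0 ?(ltW yx)//; apply: mono => //; exact: le_trans yc.
by rewrite -E -/(b1 x); lra.
Qed.

Definition grid (M : R) N (k : nat) : R := - M + 2 * M * (k%:R / N%:R).
Definition ungrid (M : R) (x : R) : R := (x + M) / (2 * M).

Lemma ungrid01 (M x : R) : 0 < M -> `|x| <= M -> 0 <= ungrid M x <= 1.
Proof.
move=> M0; rewrite ler_norml => /andP[x0 x1].
have M2 : 0 < 2 * M by rewrite mulr_gt0.
by rewrite /ungrid ler_pdivrMr// divr_ge0/= ?(ltW M2)//; lra.
Qed.

Lemma grid_bound (M : R) N k : 0 < M -> (k <= N)%N -> `|grid M N k| <= M.
Proof.
move=> M0 kN; have t0 : 0 <= k%:R / N%:R :> R by rewrite divr_ge0.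
have t1 : k%:R / N%:R <= 1 :> R.
  case: N kN {t0} => [|N] kN; first by rewrite invr0 mulr0.
  by rewrite ler_pdivrMr ?ltr0n// mul1r ler_nat.
have : 0 <= M * (k%:R / N%:R) <= M.
  by rewrite mulr_ge0 ?(ltW M0)//= ler_piMr// ltW.
by rewrite /grid ler_norml; lra.
Qed.

(** Chebyshev's bound on the mean distance between a binomial sample and its
    mean, on the grid of mesh [2 M / N] over [-M, M]. *)
Lemma bern_mean_dist (M e : R) : 0 < M -> 0 < e -> exists N0, forall N, (N0 <= N)%N ->
  forall x, `|x| <= M -> bern N (fun k => `|grid M N k - x|) (ungrid M x) <= e.
Proof.
move=> M0 e0; pose N0 := (Num.bound (M ^+ 2 / e ^+ 2)).+1.
exists N0 => N N0N x xM; set s := ungrid M x.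
have s01 := ungrid01 M0 xM; have N1 : (0 < N)%N by exact: leq_trans N0N.
have N0' : 0 < N%:R :> R by rewrite ltr0n.
have xE : x = - M + 2 * M * s by rewrite /s /ungrid; field; rewrite gt_eqF.
pose c : R := (2 * e)^-1 * (2 * M / N%:R) ^+ 2.
have H k : `|grid M N k - x| <= e / 2 + c * (k%:R - N%:R * s) ^+ 2.
  set u := grid M N k - x.
  have uE : u = 2 * M / N%:R * (k%:R - N%:R * s).
    by rewrite /u /grid xE; field; rewrite gt_eqF.
  have -> : c * (k%:R - N%:R * s) ^+ 2 = (2 * e)^-1 * u ^+ 2 by rewrite uE /c; ring.
  have : 0 <= (2 * e)^-1 * (`|u| - e) ^+ 2.
    by rewrite mulr_ge0// ?sqr_ge0// invr_ge0 mulr_ge0// ltW.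
  rewrite sqrrB real_normK ?num_real// => H.
  rewrite -subr_ge0; apply: le_trans H _; apply: eq_ler; field.
  by rewrite gt_eqF.
apply: le_trans (bern_le s01 (fun k _ => H k)) _.
rewrite bernD bern_cst bern_variance.
have ss : s * (1 - s) <= 1 / 4 by rewrite -subr_ge0 (_ : _ - _ = (s - 1 / 2) ^+ 2) ?sqr_ge0//; field.
have MN : M ^+ 2 / N%:R <= e ^+ 2.
  rewrite ler_pdivrMr// mulrC -ler_pdivrMr ?exprn_gt0//.
  apply: le_trans (_ : (Num.bound (M ^+ 2 / e ^+ 2))%:R <= _).
    by rewrite ltW// archi_boundP// divr_ge0 ?sqr_ge0.
  by rewrite ler_nat (leq_trans _ N0N).
have -> : c * (N%:R * s * (1 - s)) = (2 * e)^-1 * 4 * (M ^+ 2 / N%:R) * (s * (1 - s)).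
  by rewrite /c; field; rewrite !gt_eqF.
have : (2 * e)^-1 * 4 * (M ^+ 2 / N%:R) * (s * (1 - s)) <= (2 * e)^-1 * 4 * e ^+ 2 * (1 / 4).
  have e2 : 0 <= (2 * e)^-1 * 4 by rewrite mulr_ge0// invr_ge0 mulr_ge0// ltW.
  move: s01 => /andP[s0 s1].
  apply: ler_pM => //.
  - by rewrite mulr_ge0// divr_ge0// ?sqr_ge0 ?ltW.
  - by rewrite mulr_ge0// subr_ge0.
  - by rewrite ler_wpM2l.
have -> : (2 * e)^-1 * 4 * e ^+ 2 * (1 / 4) = e / 2 by field; rewrite gt_eqF.
lra.
Qed.

End bernstein1.

Section bernsteinV.
Context (R : realType).

Definition tail n (x : 'rV[R]_n.+1) : 'rV[R]_n := (uncons_rV x).2.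

Lemma tailE n (x : 'rV[R]_n.+1) j : tail x ord0 j = x ord0 (lift ord0 j).
Proof. by rewrite mxE. Qed.

Lemma cons_head n a (y : 'rV[R]_n) : cons_rV (a, y) ord0 ord0 = a.
Proof. by rewrite mxE unlift_none. Qed.

Lemma cons_lift n a (y : 'rV[R]_n) j : cons_rV (a, y) ord0 (lift ord0 j) = y ord0 j.
Proof. by rewrite mxE liftK. Qed.

Lemma cons_rV_affine n a b (y z : 'rV[R]_n) (s t : R) :
  cons_rV (s * a + t * b, s *: y + t *: z) = s *: cons_rV (a, y) + t *: cons_rV (b, z).
Proof.
apply/rowP => i; case: (unliftP ord0 i) => [j ->|->].
  by rewrite !mxE liftK !mxE.
by rewrite !mxE unlift_none.
Qed.

Lemma tail_move0 n (x : 'rV[R]_n.+1) (h : R) : tail (x + h *: delta_mx ord0 ord0) = tail x.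
Proof. by apply/rowP => j; rewrite !tailE !mxE eqxx/= mulr0 addr0. Qed.

Lemma head_move0 n (x : 'rV[R]_n.+1) (h : R) :
  (x + h *: delta_mx ord0 ord0) ord0 ord0 = x ord0 ord0 + h.
Proof. by rewrite !mxE eqxx/= mulr1. Qed.

Lemma tail_moveS n (x : 'rV[R]_n.+1) (h : R) j :
  tail (x + h *: delta_mx ord0 (lift ord0 j)) = tail x + h *: delta_mx ord0 j.
Proof.
by apply/rowP => i; rewrite !tailE !mxE eqxx/= (inj_eq lift_inj).
Qed.

Lemma head_moveS n (x : 'rV[R]_n.+1) (h : R) j :
  (x + h *: delta_mx ord0 (lift ord0 j)) ord0 ord0 = x ord0 ord0.
Proof. by rewrite !mxE eqxx/= mulr0 addr0. Qed.

Lemma continuous_tail n : continuous (@tail n).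
Proof.
apply: nonexpansive_continuous => x y.
apply: mx_norm_le => // j; rewrite !mxE.
by have := mx_norm_coord (x - y) (lift ord0 j); rewrite !mxE.
Qed.

Lemma class_C_tail n k (g : 'rV[R]_n -> R) : class_C k setT g ->
  class_C k setT (g \o @tail n).
Proof.
elim: k g => [|k IH] g Hg.
  split=> // x _; apply: continuous_comp; first exact: continuous_tail.
  exact: class_C_continuous Hg.
have D0 (x : 'rV[R]_n.+1) : is_derive x (delta_mx ord0 ord0) (g \o @tail n) 0.
  apply/is_derive_line0.
  rewrite (_ : (fun _ => _) = cst (g (tail x))); first exact: is_derive_cst.
  by apply/funext => s /=; rewrite tail_move0.
have DS j (x : 'rV[R]_n.+1) : is_derive x (delta_mx ord0 (lift ord0 j)) (g \o @tail n)
    (partial j g (tail x)).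
  apply/is_derive_line0.
  rewrite (_ : (fun _ => _) = (fun s : R => g (tail x + s *: delta_mx ord0 j))).
    apply: (proj1 (is_derive_line0 g (tail x) (delta_mx ord0 j) _)).
    exact: (class_C_derive j (I : setT (tail x)) Hg).
  by apply/funext => s /=; rewrite tail_moveS.
split.
  move=> x _; apply: continuous_comp; first exact: continuous_tail.
  exact: class_C_continuous Hg.
move=> i; case: (unliftP ord0 i) => [j ->|->]; split.
- by move=> x _; have [] := DS j x.
- rewrite (_ : partial _ _ = partial j g \o @tail n).
    by apply: IH; exact: class_C_partial.
  by apply/funext => x /=; exact: partial_is_derive.
- by move=> x _; have [] := D0 x.
- rewrite (_ : partial _ _ = fun=> 0); first exact: class_C_cst.
  by apply/funext => x /=; exact: partial_is_derive.
Qed.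

Lemma class_C_bern n k N (h : nat -> 'rV[R]_n -> R) (s : 'rV[R]_n -> R) :
  (forall j, class_C k setT (h j)) -> class_C k setT s ->
  class_C k setT (fun x => bern N (fun j => h j x) (s x)).
Proof.
move=> + Hs; elim: N h => [|N IH] h Hh /=; first exact: Hh.
apply: class_CD => //; first exact: openT.
  apply: class_CM; first exact: openT.
    by apply: class_CB => //; [exact: openT|exact: class_C_cst].
  exact: IH.
apply: class_CM => //; first exact: openT.
by apply: (IH (fun j => h j.+1)).
Qed.

(** The tensor product of the Bernstein operators on the cube of half-side [M],
    one coordinate at a time. *)
Fixpoint bernV (N : nat) (M : R) (n : nat) : ('rV[R]_n -> R) -> 'rV[R]_n -> R :=
  match n with
  | 0%N => fun f x => f x
  | n'.+1 => fun f x =>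
      bern N (fun k => bernV N M (fun y => f (cons_rV (grid M N k, y))) (tail x))
        (ungrid M (x ord0 ord0))
  end.

Definition cube (M : R) n : set 'rV[R]_n := [set x | forall i, `|x ord0 i| <= M].

Lemma cube_tail M n (x : 'rV[R]_n.+1) : cube M x -> cube M (tail x).
Proof. by move=> Hx i; rewrite tailE. Qed.

Lemma cube_cons M n a (y : 'rV[R]_n) : `|a| <= M -> cube M y -> cube M (cons_rV (a, y)).
Proof.
move=> Ha Hy i; case: (unliftP ord0 i) => [j ->|->].
  by rewrite cons_lift.
by rewrite cons_head.
Qed.

Lemma class_C_bernV N M n k (f : 'rV[R]_n -> R) : class_C k setT (bernV N M f).
Proof.
elim: n f => [|n IH] f /=.
  rewrite (_ : (fun x => f x) = fun=> f 0); first exact: class_C_cst.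
  by apply/funext => x; congr f; apply/rowP => -[].
apply: (@class_C_bern _ _ _ (fun k x => _)).
  by move=> j; apply: class_C_tail.
apply: class_CM; [exact: openT| |exact: class_C_cst].
apply: class_CD; [exact: openT| |exact: class_C_cst].
by apply: class_C_coord; exact: openT.
Qed.

Lemma bernVD N M n (f g : 'rV[R]_n -> R) (c : R) x :
  bernV N M (fun y => f y + c * g y) x = bernV N M f x + c * bernV N M g x.
Proof.
elim: n f g x => [|n IH] f g x //=.
rewrite -bernD; congr bern; apply/funext => k.
exact: (IH (fun y => f (cons_rV (grid M N k, y)))).
Qed.

Lemma bernV_le N M n (f g : 'rV[R]_n -> R) x : 0 < M -> (forall y, f y <= g y) ->
  cube M x -> bernV N M f x <= bernV N M g x.
Proof.
move=> M0; elim: n f g x => [|n IH] f g x fg Hx /=; first exact: fg.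
apply: bern_le; first exact: ungrid01.
by move=> k _; apply: IH => //; exact: cube_tail.
Qed.

(** The coordinates are replaced by grid points one after the other, each at a cost
    of [L c], where [c] bounds the mean distance in one variable. *)
Lemma bernV_dist N M n (f : 'rV[R]_n -> R) (L c : R) x : 0 < M -> 0 <= L ->
  (forall t, `|t| <= M -> bern N (fun k => `|grid M N k - t|) (ungrid M t) <= c) ->
  (forall y z, cube M y -> cube M z ->
     `|f y - f z| <= L * \sum_i `|y ord0 i - z ord0 i|) ->
  cube M x -> `|bernV N M f x - f x| <= n%:R * (L * c).
Proof.
move=> M0 L0 Hc; elim: n f x => [|n IH] f x Hf Hx.
  by rewrite /= subrr normr0 mul0r.
have s01 : 0 <= ungrid M (x ord0 ord0) <= 1 by exact: ungrid01.
have H1 k : (k <= N)%N ->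
    `|bernV N M (fun y => f (cons_rV (grid M N k, y))) (tail x) - f x| <=
    n%:R * (L * c) + L * `|grid M N k - x ord0 ord0|.
  move=> kN; have gk := grid_bound M0 kN.
  have H := fun h => IH (fun y => f (cons_rV (grid M N k, y))) (tail x) h (cube_tail Hx).
  apply: le_trans (ler_distD (f (cons_rV (grid M N k, tail x))) _ _) _.
  apply: lerD.
    apply: H => y z My Mz.
    apply: le_trans (Hf _ _ (cube_cons gk My) (cube_cons gk Mz)) _.
    rewrite big_ord_recl !cons_head subrr normr0 add0r.
    by apply: ler_wpM2l => //; apply: ler_sum => i _; rewrite !cons_lift.
  apply: le_trans (Hf _ _ (cube_cons gk (cube_tail Hx)) Hx) _.
  apply: ler_wpM2l => //; rewrite big_ord_recl cons_head big1 ?addr0// => i _.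
  by rewrite cons_lift tailE subrr normr0.
have := bern_dist (b := fun=> f x) s01 H1; rewrite bern_cst => /le_trans; apply.
rewrite bernD bern_cst -[n.+1%:R]natr1 mulrDl mul1r lerD2l.
by apply: ler_wpM2l => //; exact: Hc.
Qed.

Lemma is_derive_bern N (V : normedModType R) (h : nat -> V -> R) (l : nat -> R) x v (s : R) :
  (forall k, is_derive x v (h k) (l k)) ->
  is_derive x v (fun x => bern N (fun k => h k x) s) (bern N l s).
Proof.
elim: N h l => [|N IH] h l H /=; first exact: H.
exact: (is_deriveD (is_deriveZ (1 - s) (IH h l H))
  (is_deriveZ s (IH (fun k => h k.+1) (fun k => l k.+1) (fun k => H k.+1)))).
Qed.

(** Along one axis the tensor operator is a Bernstein operator of one variable acting
    on concave values, averaged over the other variables. *)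
Lemma bernV_tangent N M n (f : 'rV[R]_n -> R) i x : 0 < M ->
  is_convex (fun y => - f y) -> cube M x ->
  exists2 l : R, is_derive x (delta_mx ord0 i) (bernV N M f) l &
    forall h : R, cube M (x + h *: delta_mx ord0 i) ->
      bernV N M f (x + h *: delta_mx ord0 i) <= bernV N M f x + h * l.
Proof.
move=> M0; elim: n f i x => [|n IH] f i x cf Hx; first by case: i.
have M2 : 2 * M != 0 by rewrite mulf_neq0// gt_eqF.
have s01 : 0 <= ungrid M (x ord0 ord0) <= 1 by exact: ungrid01.
case: (unliftP ord0 i) => [j ->|->].
  have cfk k : is_convex (fun y => - f (cons_rV (grid M N k, y))).
    move=> y z t t0 t1 /=; have := cf (cons_rV (grid M N k, y)) (cons_rV (grid M N k, z)) t t0 t1.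
    by rewrite -cons_rV_affine -mulrDl addrCA subrr addr0 mul1r.
  have /choice[l Hl] : forall k, exists l : R,
      is_derive (tail x) (delta_mx ord0 j) (bernV N M (fun y => f (cons_rV (grid M N k, y)))) l /\
      forall h : R, cube M (tail x + h *: delta_mx ord0 j) ->
        bernV N M (fun y => f (cons_rV (grid M N k, y))) (tail x + h *: delta_mx ord0 j) <=
        bernV N M (fun y => f (cons_rV (grid M N k, y))) (tail x) + h * l.
    by move=> k; have [l ? ?] := IH _ j _ (cfk k) (cube_tail Hx); exists l.
  exists (bern N l (ungrid M (x ord0 ord0))).
    apply/is_derive_line0.
    have H k : is_derive (0 : R) 1 (fun s : R => bernV N M
        (fun y => f (cons_rV (grid M N k, y))) (tail x + s *: delta_mx ord0 j)) (l k).
      exact: (proj1 (is_derive_line0 _ _ _ _) (proj1 (Hl k))).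
    have := is_derive_bern N (ungrid M (x ord0 ord0)) H.
    congr (is_derive _ _ _ _); apply/funext => s /=.
    by rewrite head_moveS tail_moveS.
  move=> h Hh; rewrite /= head_moveS tail_moveS -bernD; apply: bern_le => // k _.
  by have [_] := Hl k; apply; have := cube_tail Hh; rewrite tail_moveS.
pose a k := bernV N M (fun y => f (cons_rV (grid M N k, y))) (tail x).
have ca k : a k.+2 - a k.+1 <= a k.+1 - a k.
  suff : a k + 1 * a k.+2 <= a k.+1 + 1 * a k.+1 by rewrite !mul1r; lra.
  rewrite /a -!bernVD; apply: bernV_le => //; last exact: cube_tail.
  move=> y; rewrite !mul1r.
  have := cf (cons_rV (grid M N k, y)) (cons_rV (grid M N k.+2, y)) (1 / 2)
    ltac:(lra) ltac:(lra).
  have -> : 1 - 1 / 2 = 1 / 2 :> R by field.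
  rewrite -cons_rV_affine -scalerDl.
  have -> : 1 / 2 + 1 / 2 = 1 :> R by field.
  have -> : 1 / 2 * grid M N k + 1 / 2 * grid M N k.+2 = grid M N k.+1.
    rewrite /grid -[k.+2%:R]natr1 -[k.+1%:R]natr1.
    by move: (N%:R^-1) => v; field.
  by rewrite scale1r; lra.
pose l := N%:R * bern N.-1 (fun k => a k.+1 - a k) (ungrid M (x ord0 ord0)).
exists (l / (2 * M)).
  apply/is_derive_line0.
  have H1 : is_derive (0 : R) 1 (fun h : R => ungrid M (x ord0 ord0 + h)) (2 * M)^-1.
    apply/is_deriveP => e e0; exists 1 => // h _.
    rewrite /ungrid addr0 add0r [h *: 1]mulr1 -mulrBl opprD addrACA subrr addr0.
    by rewrite addrAC subrr add0r subrr normr0 mulr_ge0// ltW.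
  have H2 : is_derive ((fun h : R => ungrid M (x ord0 ord0 + h)) 0) 1 (bern N a) l.
    by rewrite /= addr0; exact: bern_derive.
  have := is_derive1_comp (f := bern N a) (g := fun h : R => ungrid M (x ord0 ord0 + h)) H2 H1.
  congr (is_derive _ _ _ _); apply/funext => s /=.
  by rewrite head_move0 tail_move0.
move=> h Hh; rewrite /= head_move0 tail_move0.
have := Hh ord0; rewrite head_move0 => /(ungrid01 M0) t01.
have := bern_tangent N ca s01 t01.
have -> : ungrid M (x ord0 ord0 + h) - ungrid M (x ord0 ord0) = h / (2 * M).
  by rewrite /ungrid; field; rewrite gt_eqF.
by rewrite -/l mulrAC mulrA.
Qed.

End bernsteinV.

Section concave_approximation.
Context (R : realType) (n : nat).

(** A tensor Bernstein operator need not preserve joint concavity, only concavity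
    along each axis; the tangent inequality along the axes is what the convergence
    of partial derivatives is extracted from. *)
Lemma smooth_concave_approx (f : 'rV[R]_n -> R) (M L e : R) : 0 < M -> 0 <= L ->
  0 < e -> is_convex (fun y => - f y) ->
  (forall y z, cube M y -> cube M z ->
     `|f y - f z| <= L * \sum_i `|y ord0 i - z ord0 i|) ->
  exists g : 'rV[R]_n -> R, [/\ forall k, class_C k setT g,
    forall x, cube M x -> `|g x - f x| <= e &
    forall i x, cube M x -> forall h : R, cube M (x + h *: delta_mx ord0 i) ->
      g (x + h *: delta_mx ord0 i) <= g x + h * partial i g x].
Proof.
move=> M0 L0 e0 cf Hf.
have nL : 0 < n%:R * L + 1 by rewrite ltr_wpDl// mulr_ge0.
have [N0 HN] := bern_mean_dist M0 (divr_gt0 e0 nL).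
exists (bernV N0 M f); split.
- by move=> k; exact: class_C_bernV.
- move=> x Hx; have := bernV_dist M0 L0 (HN N0 (leqnn _)) Hf Hx.
  move=> /le_trans; apply; rewrite mulrA mulrA ler_pdivrMr//.
  by rewrite [leRHS]mulrC ler_wpM2r ?(ltW e0)// lerDl.
- move=> i x Hx h Hh; have [l dl Hl] := bernV_tangent N0 i M0 cf Hx.
  by rewrite (partial_is_derive dl); exact: Hl.
Qed.

End concave_approximation.

(** * Kinks of concave functions *)

Section kinks.
Context (R : realType).

Definition second_diff (V : normedModType R) (f : V -> R) (e : V) (k : nat) (x : V) : R :=
  k.+1%:R * (2 * f x - f (x + k.+1%:R^-1 *: e) - f (x - k.+1%:R^-1 *: e)).

(** For concave [f], the points where the left and right slopes along [e] differ: the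
    gap between the slopes at scale [1 / (k + 1)] stays above some [1 / (m + 1)]. A
    countable combination of closed conditions, hence a Borel set. *)
Definition kinks (V : normedModType R) (f : V -> R) (e : V) : set V :=
  \bigcup_m \bigcap_k [set x | m.+1%:R^-1 <= second_diff f e k x].

Lemma kinks_line (V : normedModType R) (f : V -> R) (e x : V) (t : R) :
  kinks f e (x + t *: e) <-> kinks (fun s : R => f (x + s *: e)) 1 t.
Proof.
have E k : second_diff f e k (x + t *: e) =
    second_diff (fun s : R => f (x + s *: e)) 1 k t.
  rewrite /second_diff; congr (_ * (_ - f _ - f _)).
    by rewrite -addrA -scalerDl; congr (_ + (_ + _) *: _); exact/esym/mulr1.
  rewrite -addrA -scalerBl; congr (_ + (_ - _) *: _); exact/esym/mulr1.
by split=> -[m _ H]; exists m => // k _; [rewrite /= -E|rewrite /= E]; exact: H.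
Qed.

Lemma archi_inv (e : R) : 0 < e -> exists k : nat, k.+1%:R^-1 < e.
Proof.
move=> e0; exists (Num.bound e^-1).
rewrite invf_plt ?posrE ?ltr0n//.
apply: lt_trans (archi_boundP _) _; first by rewrite invr_ge0 ltW.
by rewrite ltr_nat.
Qed.

Variable g : R -> R.
Hypothesis cg : is_convex (fun t => - g t).

Lemma concave_slopes s t u : s < t -> t < u ->
  (g u - g t) * (t - s) <= (g t - g s) * (u - t).
Proof.
move=> st tu; have us : 0 < u - s by rewrite subr_gt0 (lt_trans st).
have a0 : 0 <= (u - t) / (u - s) by apply: divr_ge0; lra.
have a1 : (u - t) / (u - s) <= 1 by rewrite ler_pdivrMr// mul1r; lra.
have := cg s u a0 a1.
have -> : 1 - (u - t) / (u - s) = (t - s) / (u - s) by field; rewrite gt_eqF.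
have -> : (u - t) / (u - s) *: s + (t - s) / (u - s) *: u = t.
  by rewrite /GRing.scale/=; field; rewrite gt_eqF.
rewrite -(ler_pM2r us).
have -> : ((u - t) / (u - s) * - g s + (t - s) / (u - s) * - g u) * (u - s) =
  - (u - t) * g s - (t - s) * g u by field; rewrite gt_eqF.
lra.
Qed.

Definition rslope t h := (g (t + h) - g t) / h.
Definition lslope t h := (g t - g (t - h)) / h.

Lemma rslope_le_lslope t h h' : 0 < h -> 0 < h' -> rslope t h <= lslope t h'.
Proof.
move=> h0 h'0; rewrite /rslope /lslope ler_pdivrMr// mulrAC ler_pdivlMr//.
have := @concave_slopes (t - h') t (t + h) ltac:(lra) ltac:(lra).
by rewrite (_ : t - (t - h') = h') 1?(_ : t + h - t = h)//; ring.
Qed.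

Lemma rslope_mono t h h' : 0 < h -> h <= h' -> rslope t h' <= rslope t h.
Proof.
move=> h0; rewrite le_eqVlt => /predU1P[->//|hh'].
have h'0 : 0 < h' by exact: lt_trans hh'.
rewrite /rslope ler_pdivrMr// mulrAC ler_pdivlMr//.
have := @concave_slopes t (t + h) (t + h') ltac:(lra) ltac:(lra).
rewrite (_ : t + h - t = h); last by ring.
rewrite (_ : t + h' - (t + h) = h' - h); last by ring.
by lra.
Qed.

Lemma lslope_mono t h h' : 0 < h -> h <= h' -> lslope t h <= lslope t h'.
Proof.
move=> h0; rewrite le_eqVlt => /predU1P[->//|hh'].
have h'0 : 0 < h' by exact: lt_trans hh'.
rewrite /lslope ler_pdivrMr// mulrAC ler_pdivlMr//.
have := @concave_slopes (t - h') (t - h) t ltac:(lra) ltac:(lra).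
rewrite (_ : t - (t - h) = h); last by ring.
rewrite (_ : t - h - (t - h') = h' - h); last by ring.
by lra.
Qed.

Lemma second_diff_slopes k t :
  second_diff g 1 k t = lslope t k.+1%:R^-1 - rslope t k.+1%:R^-1.
Proof. by rewrite /second_diff /lslope /rslope invrK /GRing.scale/= mulr1; ring. Qed.

Lemma has_ub_rslope t : has_sup [set rslope t h | h in [set h | 0 < h]].
Proof.
split; first by exists (rslope t 1), 1 => //=.
by exists (lslope t 1) => _ [h h0 <-]; exact: rslope_le_lslope.
Qed.

Lemma concave_derive t : ~ kinks g 1 t -> exists l : R, is_derive t 1 g l.
Proof.
move=> nk; pose l := sup [set rslope t h | h in [set h | 0 < h]].
have rl h : 0 < h -> rslope t h <= l.
  move=> h0; apply: sup_upper_bound; first exact: has_ub_rslope.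
  by exists h.
have ll h : 0 < h -> l <= lslope t h.
  move=> h0; apply: ge_sup; first by exists (rslope t 1), 1 => //=.
  by move=> _ [h' h'0 <-]; exact: rslope_le_lslope.
exists l; apply/is_deriveP => e e0.
have [m me] := archi_inv e0.
have [k kl] : exists k, second_diff g 1 k t < m.+1%:R^-1.
  apply: contrapT => /forallNP H; apply: nk; exists m => // k _ /=.
  by rewrite leNgt; apply/negP; exact: H.
move: kl; rewrite second_diff_slopes; set r := k.+1%:R^-1 => kl.
have r0 : 0 < r by rewrite invr_gt0 ltr0n.
have gap : lslope t r - rslope t r <= e by apply: ltW; exact: lt_trans me.
exists r => // h; rewrite /GRing.scale/= mulr1 => hr.
have [->|h0] := eqVneq h 0.
  by rewrite addr0 subrr mul0r subr0 normr0 mulr0.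
have [hp|hn|/eqP] := ltgtP 0 h; last by rewrite eq_sym (negbTE h0).
  rewrite (gtr0_norm hp) in hr *.
  have -> : g (t + h) - g t - h * l = (rslope t h - l) * h.
    by rewrite /rslope mulrBl divfK// mulrC.
  rewrite normrM (gtr0_norm hp) ler_wpM2r ?(ltW hp)//.
  have := rl h hp; have := ll r r0; have := rslope_mono t hp (ltW hr).
  by rewrite ler_norml; lra.
have hp : 0 < - h by rewrite oppr_gt0.
rewrite (ltr0_norm hn) in hr *.
have -> : g (t + h) - g t - h * l = (lslope t (- h) - l) * h.
  by rewrite /lslope opprK invrN mulrN mulrBl mulNr divfK// opprB mulrC.
rewrite normrM (ltr0_norm hn) ler_wpM2r ?(ltW hp)//.
have := ll _ hp; have := rl r r0; have := lslope_mono t hp (ltW hr).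
by rewrite ler_norml; lra.
Qed.

(** Each kink is labelled by a rational strictly between its two slopes; slopes
    decrease, so distinct kinks get distinct labels. *)
Lemma countable_kinks : countable (kinks g 1).
Proof.
have H t : kinks g 1 t -> exists q : rat,
    forall h, 0 < h -> rslope t h < ratr q /\ ratr q < lslope t h.
  move=> [m _ Hm]; pose l := sup [set rslope t h | h in [set h | 0 < h]].
  have rl h : 0 < h -> rslope t h <= l.
    move=> h0; apply: sup_upper_bound; first exact: has_ub_rslope.
    by exists h.
  have ll h : 0 < h -> l + m.+1%:R^-1 <= lslope t h.
    move=> h0; rewrite -lerBrDr.
    apply: ge_sup; first by exists (rslope t 1), 1 => //=.
    move=> _ [h' h'0 <-]; rewrite lerBrDr.
    have hh : 0 < Num.min h h' by rewrite lt_min h0 h'0.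
    have [k] := archi_inv hh; rewrite lt_min => /andP[kh kh'].
    have k0 : 0 < k.+1%:R^-1 :> R by rewrite invr_gt0 ltr0n.
    rewrite -lerBrDl; have := Hm k I; rewrite /= second_diff_slopes => /le_trans; apply; apply: lerB.
      exact: lslope_mono (ltW kh).
    exact: rslope_mono (ltW kh').
  have m0 : 0 < m.+1%:R^-1 :> R by rewrite invr_gt0 ltr0n.
  have [q] := @rat_in_itvoo R l (l + m.+1%:R^-1) ltac:(by rewrite ltrDl).
  rewrite in_itv/= => /andP[lq ql]; exists q => h h0; split.
    by apply: le_lt_trans lq; exact: rl.
  by apply: lt_le_trans ql _; exact: ll.
have /choice[q Hq] : forall t, exists q : rat, kinks g 1 t ->
    forall h, 0 < h -> rslope t h < ratr q /\ ratr q < lslope t h.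
  move=> t; have [kt|nkt] := pselect (kinks g 1 t).
    by have [q ?] := H t kt; exists q.
  by exists 0.
have key s t : kinks g 1 s -> kinks g 1 t -> q s = q t -> s < t -> False.
  move=> ks kt qst st; have ts : 0 < t - s by rewrite subr_gt0.
  have [+ _] := Hq s ks _ ts; have [_ +] := Hq t kt _ ts.
  rewrite qst /rslope /lslope.
  rewrite (_ : s + (t - s) = t) 1?(_ : t - (t - s) = s) => [a b||]; [|ring|ring].
  by have := lt_trans a b; rewrite ltxx.
apply/countable_injP; exists (pickle \o q) => s t; rewrite !inE => ks kt /=.
move=> /(pcan_inj pickleK) qst.
have [st|ts|//] := ltgtP s t.
  by case: (key s t).
by case: (key t s).
Qed.

End kinks.

Section borel_rV.
Context (R : realType) (n : nat).

(** An open set is the countable union of the rational boxes that it contains. *)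
Lemma open_measurable_rV (U : set 'rV[R]_n) : open U -> measurable U.
Proof.
move=> oU.
pose box (p : 'rV[rat]_n * rat) : set 'rV[R]_n :=
  [set x | forall i, x ord0 i \in `](ratr (p.1 ord0 i) - ratr p.2)%R, (ratr (p.1 ord0 i) + ratr p.2)[ ].
pose B p : set 'rV[R]_n := [set x | box p x /\ box p `<=` U].
have -> : U = \bigcup_p B p.
  apply/seteqP; split=> [x Ux|x [p _]]; last first.
    by move=> [/[swap]]; apply.
  have /nbhs_ballP[r /= r0 Hr] : nbhs x U by exact: open_nbhs_nbhs.
  have r4 : 0 < r / 4 by rewrite divr_gt0.
  have [s] := @rat_in_itvoo R (r / 4) (r / 2) ltac:(lra).
  rewrite in_itv/= => /andP[s1 s2].
  have /choice[q Hq] : forall i, exists q : rat,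
      x ord0 i - r / 4 < ratr q < x ord0 i + r / 4.
    move=> i; have [q] := @rat_in_itvoo R (x ord0 i - r / 4) (x ord0 i + r / 4) ltac:(lra).
    by rewrite in_itv/=; exists q.
  have bx : box (\row_i q i, s) x.
    by move=> i /=; rewrite in_itv/= mxE; have := Hq i; lra.
  exists (\row_i q i, s) => //; split => // y Hy.
  apply: Hr; rewrite -ball_normE/=; apply: (@le_lt_trans _ _ (r * (3 / 4))); last by lra.
  apply: mx_norm_le => [|i]; first by lra.
  rewrite !mxE; have := Hy i; rewrite in_itv/= mxE; have := Hq i.
  by rewrite ler_norml; lra.
apply: countable_bigcupT_measurable; first exact: countableP.
move=> p; have [pU|npU] := pselect (box p `<=` U); last first.
  by rewrite (_ : B p = set0)//; apply/seteqP; split=> x // [].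
rewrite (_ : B p = box p); last by apply/seteqP; split=> x // [].
apply: (@measurable_box R n (fun i => [set` `](ratr (p.1 ord0 i) - ratr p.2)%R, (ratr (p.1 ord0 i) + ratr p.2)[ ])).
by move=> i; exact: measurable_itv.
Qed.

Lemma closed_measurable_rV (U : set 'rV[R]_n) : closed U -> measurable U.
Proof.
move=> cU; rewrite -[U]setCK; apply: measurableC; apply: open_measurable_rV.
exact: closed_openC.
Qed.

Lemma open_continuous_measurable_fun_rV (D : set 'rV[R]_n) (f : 'rV[R]_n -> R) :
  open D -> (forall x, D x -> {for x, continuous f}) -> measurable_fun D f.
Proof.
move=> oD cf; apply: (measurability _ (RGenOpens.measurableE R)).
move=> _ [_ [a [b ->] <-]]; apply: open_measurable_rV.
rewrite openE => x [Dx /= fx]; apply: filterI; first exact: open_nbhs_nbhs.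
by apply: cf => //; exact: open_nbhs_nbhs.
Qed.

Lemma continuous_measurable_fun_rV (f : 'rV[R]_n -> R) :
  continuous f -> measurable_fun setT f.
Proof.
by move=> cf; apply: open_continuous_measurable_fun_rV => [|x _]; [exact: openT|exact: cf].
Qed.

Lemma measurable_kinks (f : 'rV[R]_n -> R) e : continuous f -> measurable (kinks f e).
Proof.
move=> cf; apply: bigcupT_measurable => m; apply: bigcapT_measurable => k.
rewrite -[X in measurable X]setTI; apply: measurable_fun_le => //.
apply: continuous_measurable_fun_rV => x.
have ct (c : 'rV[R]_n) : {for x, continuous (fun x : 'rV[R]_n => f (x + c))}.
  apply: (@continuous_comp _ _ _ (fun x : 'rV[R]_n => x + c) f); last exact: cf.
  by apply: nonexpansive_continuous => y z; rewrite opprD addrACA subrr addr0.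
have cst (a : R) : {for x, continuous (fun _ : 'rV[R]_n => a)} by exact: cst_continuous.
have c2 : {for x, continuous (fun x : 'rV[R]_n => 2 * f x)}.
  exact: (cvgM (cst 2) (cf x)).
exact: (cvgM (cst _) (cvgB (cvgB c2 (ct (k.+1%:R^-1 *: e)))
  (ct (- (k.+1%:R^-1 *: e))))).
Qed.

End borel_rV.

Section kinks_null.
Context (R : realType).

Lemma continuous_cons_rV n (a : R) : continuous (fun y : 'rV[R]_n => cons_rV (a, y)).
Proof.
apply: nonexpansive_continuous => x y; apply: mx_norm_le => // i.
case: (unliftP ord0 i) => [j ->|->]; rewrite !mxE ?liftK ?unlift_none/= ?subrr ?normr0//.
by have := mx_norm_coord (x - y) j; rewrite !mxE.
Qed.

(** Fubini, peeling off the first coordinate: if [i] is that coordinate, the slices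
    along it are countable by [countable_kinks]; otherwise the slices on which it is
    fixed are handled by induction. *)
Lemma kinks_null n (f : 'rV[R]_n -> R) i : continuous f -> is_convex (fun x => - f x) ->
  leb R n (kinks f (delta_mx ord0 i)) = 0%E.
Proof.
elim: n f i => [|n IH] f i cf cvf; first by case: i.
have mK := measurable_kinks (delta_mx ord0 i) cf.
rewrite /= /cons_measure /pushforward.
set K := _ @^-1` _.
have mK' : measurable K.
  by rewrite /K -[X in measurable X]setTI; exact: measurable_cons_rV.
case: (unliftP ord0 i) mK @K mK' => [j ->|->] mK K mK'.
  rewrite /product_measure1 integral0_eq// => a _ /=.
  rewrite (_ : xsection K a = kinks (fun y => f (cons_rV (a, y))) (delta_mx ord0 j)).
    apply: IH.
      move=> y; apply: (@continuous_comp _ _ _ (fun y => cons_rV (a, y)) f); last exact: cf.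
      exact: continuous_cons_rV.
    move=> y z t t0 t1 /=; have := cvf (cons_rV (a, y)) (cons_rV (a, z)) t t0 t1.
    by rewrite -cons_rV_affine -mulrDl addrCA subrr addr0 mul1r.
  have E y (h : R) : cons_rV (a, y) + h *: delta_mx ord0 (lift ord0 j) =
      cons_rV (a, y + h *: delta_mx ord0 j).
    apply/rowP => k; case: (unliftP ord0 k) => [l ->|->].
      by rewrite !mxE liftK !mxE (inj_eq lift_inj).
    by rewrite !mxE unlift_none /= mulr0 addr0.
  have E2 k y : second_diff f (delta_mx ord0 (lift ord0 j)) k (cons_rV (a, y)) =
      second_diff (fun y => f (cons_rV (a, y))) (delta_mx ord0 j) k y.
    by rewrite /second_diff E -scaleNr E scaleNr.
  by apply/seteqP; split=> y; rewrite /xsection/= inE => -[m _ H]; exists m => // k _;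
    [rewrite /= -E2|rewrite /= E2]; exact: H.
have -> : (lebesgue_measure \x leb R n)%E K = (lebesgue_measure \x^ leb R n)%E K.
  apply: product_measure_unique => //= A B mA mB.
  by rewrite product_measure2E.
rewrite /product_measure2 integral0_eq// => y _ /=.
apply: countable_lebesgue_measure0.
rewrite (_ : ysection K y = kinks (fun a => f (cons_rV (a, y))) 1).
  apply: countable_kinks => a b t t0 t1 /=.
  have := cvf (cons_rV (a, y)) (cons_rV (b, y)) t t0 t1.
  by rewrite -cons_rV_affine -scalerDl addrCA subrr addr0 scale1r.
have E a (h : R) : cons_rV (a, y) + h *: delta_mx ord0 ord0 = cons_rV (a + h, y).
  apply/rowP => k; case: (unliftP ord0 k) => [l ->|->].
    by rewrite !mxE liftK /= mulr0 addr0.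
  by rewrite !mxE unlift_none /= mulr1.
have E2 k a : second_diff f (delta_mx ord0 ord0) k (cons_rV (a, y)) =
    second_diff (fun a => f (cons_rV (a, y))) 1 k a.
  by rewrite /second_diff E -scaleNr E /GRing.scale/= mulr1.
by apply/seteqP; split=> a; rewrite /ysection/= inE => -[m _ H]; exists m => // k _;
  [rewrite /= -E2|rewrite /= E2]; exact: H.
Qed.

Lemma leb_bounded n (A : set 'rV[R]_n) : measurable A -> bounded_set A ->
  (leb R n A < +oo)%E.
Proof.
move=> mA /ex_strict_bound_gt0[M M0 AM].
pose B := [set x : 'rV[R]_n | forall i, [set` `[- M, M]] (x ord0 i)].
have mB : measurable B by apply: (@measurable_box R n (fun=> [set` `[- M, M]])) => i; exact: measurable_itv.
apply: (@le_lt_trans _ _ (leb R n B)).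
  apply: le_measure; rewrite ?inE// => x /AM xM i.
  by rewrite /= in_itv/= -ler_norml ltW// (le_lt_trans (mx_norm_coord x i)).
rewrite [leb _ _ _](@leb_box R n (fun=> [set` `[- M, M]])); last by move=> i; exact: measurable_itv.
rewrite ltey_eq; apply/orP; left; elim/big_ind : _ => // [x y|i _]; first exact: fin_numM.
by rewrite lebesgue_measure_itv/= lte_fin; case: ifP.
Qed.

End kinks_null.

(** * The norm and its square *)

Section dot_product.
Context (R : realType) (n : nat).
Implicit Types (x y z : 'rV[R]_n) (c : R).

Lemma dotrC x y : dotr x y = dotr y x.
Proof. by apply: eq_bigr => i _; rewrite mulrC. Qed.

Lemma dotrDl x y z : dotr (x + y) z = dotr x z + dotr y z.
Proof. by rewrite /dotr -big_split; apply: eq_bigr => i _; rewrite mxE mulrDl. Qed.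

Lemma dotrZl c x y : dotr (c *: x) y = c * dotr x y.
Proof. by rewrite /dotr mulr_sumr; apply: eq_bigr => i _; rewrite mxE mulrA. Qed.

Lemma dotrDr x y z : dotr x (y + z) = dotr x y + dotr x z.
Proof. by rewrite dotrC dotrDl !(dotrC x). Qed.

Lemma dotrZr c x y : dotr x (c *: y) = c * dotr x y.
Proof. by rewrite dotrC dotrZl (dotrC x). Qed.

Lemma dotrNl x y : dotr (- x) y = - dotr x y.
Proof. by rewrite -scaleN1r dotrZl mulN1r. Qed.

Lemma dotrNr x y : dotr x (- y) = - dotr x y.
Proof. by rewrite -scaleN1r dotrZr mulN1r. Qed.

Lemma dotr0l x : dotr 0 x = 0.
Proof. by apply: big1 => i _; rewrite mxE mul0r. Qed.

Lemma dotr_ge0 x : 0 <= dotr x x.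
Proof. by apply: sumr_ge0 => i _; rewrite -expr2 sqr_ge0. Qed.

Lemma dotr_gt0 x : x != 0 -> 0 < dotr x x.
Proof.
move=> x0; rewrite lt_neqAle dotr_ge0 andbT eq_sym; apply: contra x0.
rewrite psumr_eq0; last by move=> i _; rewrite -expr2 sqr_ge0.
move=> /allP H; apply/eqP/rowP => i; rewrite mxE.
by have := H i (mem_index_enum _); rewrite mulf_eq0 orbb => /eqP.
Qed.

Lemma enorm_sqr x : enorm x ^+ 2 = dotr x x.
Proof. by rewrite sqr_sqrtr// dotr_ge0. Qed.

Lemma enorm_ge0 x : 0 <= enorm x. Proof. exact: sqrtr_ge0. Qed.

Lemma enorm_coord x i : `|x ord0 i| <= enorm x.
Proof.
rewrite -(@ler_pXn2r _ 2)// ?nnegrE ?enorm_ge0// enorm_sqr real_normK ?num_real//.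
rewrite /dotr (bigD1 i)//= -expr2 lerDl.
by apply: sumr_ge0 => j _; rewrite -expr2 sqr_ge0.
Qed.

Lemma dotr_delta x i : dotr (delta_mx ord0 i) x = x ord0 i.
Proof.
rewrite /dotr (bigD1 i)//= big1 ?addr0 => [|j ji]; first by rewrite mxE !eqxx mul1r.
by rewrite mxE eqxx (negbTE ji) mul0r.
Qed.

Lemma dotr_convex_gap (t : R) x y :
  t * dotr x x + (1 - t) * dotr y y =
  dotr (t *: x + (1 - t) *: y) (t *: x + (1 - t) *: y) +
  t * (1 - t) * dotr (x - y) (x - y).
Proof.
rewrite !(dotrDl, dotrDr, dotrZl, dotrZr, dotrNl, dotrNr) (dotrC y x); ring.
Qed.

Lemma young x y c : 0 < c ->
  2 * dotr x y - c / 2 * dotr x x <= 2 / c * dotr y y.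
Proof.
move=> c0; rewrite -subr_ge0.
have -> : 2 / c * dotr y y - (2 * dotr x y - c / 2 * dotr x x) =
    (2 * c)^-1 * dotr (c *: x - 2 *: y) (c *: x - 2 *: y).
  rewrite !(dotrDl, dotrDr, dotrZl, dotrZr, dotrNl, dotrNr) (dotrC y x).
  by field; rewrite gt_eqF.
by rewrite mulr_ge0 ?dotr_ge0// invr_ge0 mulr_ge0// ltW.
Qed.

Lemma is_derive_dotr x i : is_derive x (delta_mx ord0 i) (fun x => dotr x x) (2 * x ord0 i).
Proof.
apply/is_deriveP => e e0; exists e => // h he.
rewrite !(dotrDl, dotrDr, dotrZl, dotrZr) (dotrC x) !dotr_delta mxE !eqxx/= mulr1.
rewrite (_ : _ - _ - _ = h * h); last by ring.
by rewrite normrM ler_wpM2r// ltW.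
Qed.

Lemma is_derive_lipschitz (V : normedModType R) (f : V -> R) (K l : R) (x v : V) :
  (forall h : R, `|f (x + h *: v) - f x| <= K * `|h|) -> is_derive x v f l -> `|l| <= K.
Proof.
move=> Hf /is_deriveP df; apply/ler_addgt0Pr => e e0; have [r r0 Hr] := df e e0.
have r2 : 0 < r / 2 by rewrite divr_gt0.
have := Hr (r / 2); rewrite gtr0_norm// => /(_ ltac:(lra)) H.
have H' := Hf (r / 2); rewrite [`|r / 2|]gtr0_norm// in H'.
have : `|l| * (r / 2) <= (K + e) * (r / 2).
  rewrite -[r / 2 in leLHS]gtr0_norm// -normrM.
  rewrite (_ : l * _ = (f (x + (r / 2) *: v) - f x) -
      (f (x + (r / 2) *: v) - f x - r / 2 * l)); last by ring.
  by apply: le_trans (ler_normB _ _) _; rewrite mulrDl lerD.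
by rewrite ler_pM2r.
Qed.

Lemma is_derive_square (k s : R) : is_derive s 1 (fun s : R => k * s ^+ 2) (k * (2 * s)).
Proof.
have k1 : 0 < `|k| + 1 by rewrite ltr_wpDl.
apply/is_deriveP => e e0; exists (e / (`|k| + 1)); first exact: divr_gt0.
move=> h; rewrite ltr_pdivlMr// => hr.
rewrite /GRing.scale/= mulr1 (_ : _ - _ - _ = k * h * h); last by ring.
rewrite normrM ler_wpM2r// normrM mulrC; apply: ltW; apply: le_lt_trans hr.
by rewrite ler_wpM2l// lerDl.
Qed.

End dot_product.

Section convex_norm.
Context (R : realType) (n : nat) (F : 'rV[R]_n -> R).
Hypothesis hF : strongly_convex_norm F.
Implicit Types (x y xi eta : 'rV[R]_n).

Lemma strongly_convex_norm_convex : is_convex F.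
Proof.
move=> x y t t0 t1.
have := norm_convex hF (Itv01 t0 t1) (x := x) (y := y).
by rewrite !inE => /(_ I I).
Qed.

Lemma norm0 : F 0 = 0.
Proof. by have := norm_homogeneous hF 0 0; rewrite scale0r normr0 mul0r. Qed.

Lemma normN x : F (- x) = F x.
Proof. by rewrite -scaleN1r (norm_homogeneous hF) normrN1 mul1r. Qed.

Lemma norm_triangle x y : F (x + y) <= F x + F y.
Proof.
have := strongly_convex_norm_convex (2 *: x) (2 *: y) (_ : 0 <= 1 / 2) _.
have -> : 1 - 1 / 2 = 1 / 2 :> R by field.
rewrite !scalerA (_ : 1 / 2 * 2 = 1); last by field.
rewrite !scale1r !(norm_homogeneous hF) normr_nat => /(_ ltac:(lra) ltac:(lra)).
lra.
Qed.

Lemma norm_gt0 x : x != 0 -> 0 < F x.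
Proof.
move=> x0; have [a a0 /(_ x)] := norm_coercive hF; apply: lt_le_trans.
by rewrite mulr_gt0// sqrtr_gt0 dotr_gt0.
Qed.

Definition norm_basis : R := \sum_i F (delta_mx ord0 i).

Lemma norm_basis_ge0 : 0 <= norm_basis.
Proof. by apply: sumr_ge0 => i _; exact: norm_ge0. Qed.

Lemma norm_le_basis x (c : R) : (forall i, `|x ord0 i| <= c) -> F x <= norm_basis * c.
Proof.
move=> Hc; rewrite [X in F X](row_sum_delta x) /norm_basis mulr_suml.
apply: (@le_trans _ _ (\sum_i F (x ord0 i *: delta_mx ord0 i))).
  elim/big_ind2 : _ => [|a b c' d ? ?|//]; first by rewrite norm0.
  by apply: le_trans (norm_triangle _ _) _; rewrite lerD.
apply: ler_sum => i _; rewrite (norm_homogeneous hF) mulrC ler_wpM2l//.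
exact: norm_ge0.
Qed.

Lemma norm_le_mx x : F x <= norm_basis * `|x|.
Proof. by apply: norm_le_basis => i; exact: mx_norm_coord. Qed.

Lemma norm_le_enorm x : F x <= norm_basis * enorm x.
Proof. by apply: norm_le_basis => i; exact: enorm_coord. Qed.

Lemma norm_continuous_rV : continuous F.
Proof.
apply: (lipschitz_continuous (K := norm_basis)) => x y; apply: le_trans (norm_le_mx (x - y)).
have H u v : F u - F v <= F (u - v).
  by rewrite lerBlDr; have := norm_triangle (u - v) v; rewrite subrK.
rewrite ler_norml H andbT lerNl opprB.
by have := H y x; rewrite -[F (y - x)]normN opprB.
Qed.

Lemma open_neq0 : open [set xi : 'rV[R]_n | xi != 0].
Proof.
rewrite (_ : mkset _ = ~` [set 0]); last first.
  by apply/seteqP; split=> x /= /eqP.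
apply: closed_openC; apply: accessible_closed_set1; apply: hausdorff_accessible.
exact: norm_hausdorff.
Qed.

(** The tangent plane of [F] at [eta] lies below [F]; subadditivity and homogeneity
    turn this into the statement that [grad F(eta)] is in the polar unit ball. *)
Lemma gradient_norm_dotr eta xi : eta != 0 -> dotr (gradient F eta) xi <= F xi.
Proof.
move=> eta0.
have d i : is_derive eta (delta_mx ord0 i) F (partial i F eta).
  exact: (class_C_derive i eta0 (norm_C2 hF)).
have := updir_convex strongly_convex_norm_convex
  (updir_sum xi strongly_convex_norm_convex d).
have -> : \sum_i xi ord0 i * partial i F eta = dotr (gradient F eta) xi.
  by apply: eq_bigr => i _; rewrite mxE mulrC.
move=> /le_trans/(_ (norm_triangle _ _)).
by rewrite lerD2l.
Qed.

Lemma gradient_norm_euler eta : eta != 0 -> dotr (gradient F eta) eta = F eta.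
Proof.
move=> eta0; apply/eqP; rewrite eq_le gradient_norm_dotr//=.
have d i : is_derive eta (delta_mx ord0 i) F (partial i F eta).
  exact: (class_C_derive i eta0 (norm_C2 hF)).
have := updir_convex strongly_convex_norm_convex
  (updir_sum (- eta) strongly_convex_norm_convex d).
have -> : \sum_i (- eta) ord0 i * partial i F eta = dotr (gradient F eta) (- eta).
  by apply: eq_bigr => i _; rewrite [gradient _ _ _ _]mxE mulrC.
by rewrite subrr norm0 dotrNr; lra.
Qed.

Lemma gradient_norm_dotr_abs eta xi : eta != 0 -> `|dotr (gradient F eta) xi| <= F xi.
Proof.
move=> eta0; rewrite ler_norml gradient_norm_dotr// andbT lerNl -dotrNr -(normN xi).
exact: gradient_norm_dotr.
Qed.

Lemma gradient_norm_coord_abs eta i : eta != 0 ->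
  `|gradient F eta ord0 i| <= F (delta_mx ord0 i).
Proof.
by move=> eta0; rewrite -dotr_delta dotrC; exact: gradient_norm_dotr_abs.
Qed.

(** The pointwise inequality behind the supersolution argument: complete the
    square in [F xi ^ 2 >= (grad F(eta) . xi) ^ 2]. *)
Lemma norm_square_completion eta xi (s : R) :
  2 * s * (F eta * dotr (gradient F eta) xi) - s ^+ 2 * F eta ^+ 2 <= F xi ^+ 2.
Proof.
have [->|eta0] := eqVneq eta 0.
  by rewrite norm0 mul0r expr0n/= !mulr0 subr0 sqr_ge0.
have : (dotr (gradient F eta) xi) ^+ 2 <= F xi ^+ 2.
  rewrite -real_normK ?num_real// lerXn2r// ?nnegrE ?(norm_ge0 hF)//.
  exact: gradient_norm_dotr_abs.
have := sqr_ge0 (dotr (gradient F eta) xi - s * F eta).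
rewrite sqrrB exprMn; lra.
Qed.

Let H x := F x ^+ 2.

Lemma class_C2_sqr : class_C 2 [set xi : 'rV[R]_n | xi != 0] H.
Proof.
have := class_CM open_neq0 (norm_C2 hF) (norm_C2 hF).
by apply: class_C_ext; [exact: open_neq0|move=> x _; rewrite /H expr2].
Qed.

Lemma is_derive_dilation (f : 'rV[R]_n -> R) (c l : R) x v :
  is_derive (c *: x) v f l -> is_derive x v (fun y => f (c *: y)) (c * l).
Proof.
move=> /(is_derive_scale c) /(proj1 (is_derive_line0 _ _ _ _)) D.
apply: (proj2 (is_derive_line0 _ _ _ _)).
rewrite (_ : (fun s : R => _) = (fun s : R => f (c *: x + s *: (c *: v))))//.
by apply/funext => s; rewrite scalerDr !scalerA mulrC.
Qed.

Lemma partial_sqr_dilation (c : R) x i : 0 < c -> x != 0 ->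
  partial i H (c *: x) = c * partial i H x.
Proof.
move=> c0 x0; have cx0 : c *: x != 0 by rewrite scaler_eq0 negb_or gt_eqF.
have D1 := is_derive_dilation (class_C_derive i cx0 class_C2_sqr).
have D2 := is_deriveZ (c ^+ 2) (class_C_derive i x0 class_C2_sqr).
have E : (fun y => H (c *: y)) = c ^+ 2 \*: H.
  by apply/funext => y; rewrite /H (norm_homogeneous hF) exprMn real_normK ?num_real.
rewrite E in D1; have := is_derive_val D1 D2.
rewrite /GRing.scale/= expr2 -mulrA => /(mulfI _); apply.
by rewrite gt_eqF.
Qed.

Lemma partial2_sqr_dilation (c : R) x i j : 0 < c -> x != 0 ->
  partial j (partial i H) (c *: x) = partial j (partial i H) x.
Proof.
move=> c0 x0; have cx0 : c *: x != 0 by rewrite scaler_eq0 negb_or gt_eqF.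
have C1 := class_C_partial i class_C2_sqr.
have D1 := is_derive_dilation (class_C_derive j cx0 C1).
have D2 := is_deriveZ c (class_C_derive j x0 C1).
have D3 : is_derive x (delta_mx ord0 j) (fun y => partial i H (c *: y))
    (c * partial j (partial i H) x).
  apply: near_eq_is_derive D2; apply: (near_open_eq open_neq0) => // y y0.
  by rewrite partial_sqr_dilation.
have := is_derive_val D1 D3.
by move=> /(mulfI _); apply; rewrite gt_eqF.
Qed.

Definition hess_form x (v : 'rV[R]_n) :=
  \sum_i \sum_j v ord0 i * v ord0 j * partial j (partial i H) x.

Lemma hess_formE x v : (v *m hessian H x *m v^T) ord0 ord0 = hess_form x v.
Proof.
rewrite /hess_form exchange_big/= mxE; apply: eq_bigr => j _; rewrite !mxE mulr_suml.
by apply: eq_bigr => i _; rewrite !mxE mulrAC.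
Qed.

Lemma hess_form_gt0 x v : x != 0 -> v != 0 -> 0 < hess_form x v.
Proof. by move=> x0 v0; rewrite -hess_formE; exact: (norm_hessian hF). Qed.

Lemma hess_form_scale x v (c : R) : hess_form x (c *: v) = c ^+ 2 * hess_form x v.
Proof.
rewrite /hess_form mulr_sumr; apply: eq_bigr => i _; rewrite mulr_sumr.
by apply: eq_bigr => j _; rewrite !mxE; ring.
Qed.

(** The Hessian of [F ^ 2] is homogeneous of degree 0, so compactness of the unit
    sphere makes its positivity uniform. *)
Lemma hess_form_lower_bound : exists2 c, 0 < c &
  forall x v, x != 0 -> c * dotr v v <= hess_form x v.
Proof.
pose S := [set x : 'rV[R]_n | `|x| = 1].
have cS : compact S.
  apply: bounded_closed_compact.
    by exists 1; split=> // M M1 x /= ->; exact: ltW.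
  have /(_ _ (fun x : 'rV[R]_n => `|x|)) := preimage_closed _ (@closed_eq R 1).
  by apply => x _; exact: norm_continuous.
have S0 x : S x -> x != 0 by move=> Sx; rewrite -normr_eq0 Sx oner_neq0.
have [SS0|/set0P/negP/negPn/eqP SS0] := pselect ((S `*` S) !=set0); last first.
  (* In dimension 0 the unit sphere is empty, and so is the set of nonzero [x]. *)
  exists 1 => // x v x0; exfalso.
  have nx : S (`|x|^-1 *: x).
    by rewrite /S/= normrZ normfV normr_id mulVf// normr_eq0.
  have : (S `*` S) (`|x|^-1 *: x, `|x|^-1 *: x) by [].
  by rewrite SS0.
have cQ : {within S `*` S, continuous (fun p => hess_form p.1 p.2)}.
  apply: continuous_in_subspaceT => -[x v]; rewrite inE => -[/= Sx Sv].
  have cs (G : 'I_n -> 'rV[R]_n * 'rV[R]_n -> R) :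
      (forall i, {for (x, v), continuous (G i)}) ->
      {for (x, v), continuous (fun p => \sum_i G i p)}.
    move=> HG; rewrite (_ : (fun p => _) = \sum_i G i); last first.
      by apply/funext => p; rewrite fct_sumE.
    apply: (big_ind (fun f => {for (x, v), continuous f})) => [|f g Hf Hg|//].
      exact: cst_continuous.
    exact: cvgD Hf Hg.
  apply: (cs) => i; apply: (cs) => j.
  have c2 k : {for (x, v), continuous (fun p : 'rV[R]_n * 'rV[R]_n => p.2 ord0 k)}.
    apply: (@continuous_comp _ _ _ snd (fun y : 'rV[R]_n => y ord0 k)).
      exact: cvg_snd.
    exact: coord_continuous.
  have c1 : {for (x, v), continuous (fun p : 'rV[R]_n * 'rV[R]_n =>
      partial j (partial i H) p.1)}.
    apply: (@continuous_comp _ _ _ fst (partial j (partial i H))).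
      exact: cvg_fst.
    exact: (class_C_continuous (S0 x Sx) (class_C_partial j (class_C_partial i class_C2_sqr))).
  exact: cvgM (cvgM (c2 i) (c2 j)) c1.
have [[x0 v0] /set_mem[/= Sx0 Sv0] Hmin] := compact_EVT_min SS0 (compact_setX cS cS) cQ.
have {Hmin x0 v0 Sx0 Sv0} [m m0 Hmin] : exists2 m, 0 < m &
    forall x v, S x -> S v -> m <= hess_form x v.
  exists (hess_form x0 v0); first by apply: hess_form_gt0; exact: S0.
  by move=> x v Sx Sv; apply: (Hmin (x, v)); rewrite inE.
exists (m / (n%:R + 1)); first by rewrite divr_gt0// ltr_wpDl.
move=> x v x0'; have [->|v0'] := eqVneq v 0.
  rewrite dotr0l mulr0 sumr_ge0// => i _; rewrite sumr_ge0// => j _.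
  by rewrite !mxE !mul0r.
have nx0 : 0 < `|x| by rewrite normr_gt0.
have nv0 : 0 < `|v| by rewrite normr_gt0.
have key : m * `|v| ^+ 2 <= hess_form x v.
  have E : hess_form x v = hess_form (`|x|^-1 *: x) (`|v|^-1 *: v) * `|v| ^+ 2.
    rewrite hess_form_scale mulrAC -exprMn mulVf ?gt_eqF// expr1n mul1r.
    apply: eq_bigr => i _; apply: eq_bigr => j _; congr (_ * _).
    by rewrite partial2_sqr_dilation// invr_gt0.
  rewrite E; apply: ler_wpM2r; first exact: sqr_ge0.
  apply: Hmin; rewrite /S/=.
    by rewrite normrZ normfV normr_id mulVf// gt_eqF.
  by rewrite normrZ normfV normr_id mulVf// gt_eqF.
apply: le_trans key; rewrite mulrAC ler_pdivrMr ?ltr_wpDl// -mulrA ler_pM2l//.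
apply: (@le_trans _ _ (\sum_(i < n) `|v| ^+ 2)).
  apply: ler_sum => i _; rewrite -expr2 -real_normK ?num_real// lerXn2r ?nnegrE//.
  exact: mx_norm_coord.
by rewrite sumr_const card_ord -[leLHS]mulr_natr ler_wpM2l ?sqr_ge0// lerDl.
Qed.

(** The Hessian of [F ^ 2] lives off the origin only, which is a removable obstacle:
    a line through the origin carries [F ^ 2] as an exact parabola, with curvature
    bounded below by coercivity, and on the other lines [F ^ 2] is twice
    differentiable. *)
Lemma norm_sqr_strongly_convex : exists2 c, 0 < c & forall xi eta (t : R),
  0 <= t -> t <= 1 ->
  F (t *: xi + (1 - t) *: eta) ^+ 2 + c / 2 * (t * (1 - t) * dotr (xi - eta) (xi - eta))
  <= t * F xi ^+ 2 + (1 - t) * F eta ^+ 2.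
Proof.
have [c1 c10 Hc1] := hess_form_lower_bound.
have [a a0 Ha] := norm_coercive hF.
pose c := Num.min c1 (2 * a ^+ 2).
have c0 : 0 < c by rewrite lt_min c10 mulr_gt0// exprn_gt0.
exists c => // xi eta t t0 t1.
pose v := xi - eta; have tt : 0 <= t * (1 - t) by rewrite mulr_ge0// subr_ge0.
have lineE (s : R) : s *: xi + (1 - s) *: eta = eta + s *: v.
  by rewrite /v scalerBl scale1r scalerBr addrCA addrA.
have [[s Es]|ns] := pselect (exists s : R, eta + s *: v = 0).
  have Hs (r : R) : F (eta + r *: v) ^+ 2 = (r - s) ^+ 2 * F v ^+ 2.
    rewrite (_ : eta + r *: v = (r - s) *: v).
      by rewrite (norm_homogeneous hF) exprMn real_normK ?num_real.
    have eE : eta = - (s *: v) by apply/eqP; rewrite -subr_eq0 opprK Es.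
    by rewrite {1}eE addrC scalerBl.
  have Hx : F xi ^+ 2 = (1 - s) ^+ 2 * F v ^+ 2.
    by rewrite -Hs scale1r /v addrC subrK.
  have He : F eta ^+ 2 = (0 - s) ^+ 2 * F v ^+ 2 by rewrite -Hs scale0r addr0.
  rewrite lineE Hs Hx He -/v.
  have H1 : c / 2 * dotr v v <= F v ^+ 2.
    apply: (@le_trans _ _ (a ^+ 2 * dotr v v)).
      rewrite ler_wpM2r ?dotr_ge0// ler_pdivrMr// mulrC /c ge_min.
      by rewrite lexx orbT.
    rewrite -enorm_sqr -exprMn lerXn2r ?nnegrE ?(norm_ge0 hF)//.
    by rewrite mulr_ge0 ?enorm_ge0 ?ltW.
  have : t * (1 - t) * (c / 2 * dotr v v) <= t * (1 - t) * F v ^+ 2.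
    by rewrite ler_wpM2l.
  by move: (F v ^+ 2) (dotr v v) => A B; nra.
have nz (s : R) : eta + s *: v != 0.
  by apply/eqP => E; apply: ns; exists s.
pose k := c / 2 * dotr v v.
pose g (s : R) := H (eta + s *: v) - k * s ^+ 2.
pose g1 (s : R) := (\sum_i v ord0 i * partial i H (eta + s *: v)) - k * (2 * s).
pose g2 (s : R) := hess_form (eta + s *: v) v - k * 2.
have d1 (s : R) : is_derive s 1 g (g1 s).
  apply: is_deriveB; last exact: is_derive_square.
  apply: (proj1 (is_derive_line H eta v s _)).
  exact: (class_C1_derive v open_neq0 (nz s) (class_CS class_C2_sqr)).
have d2 (s : R) : is_derive s 1 g1 (g2 s).
  apply: is_deriveB; last first.
    apply/is_deriveP => e e0; exists 1 => // h _.
    have -> : k * (2 * (s + h *: 1)) - k * (2 * s) - h * (k * 2) = 0.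
      by rewrite /GRing.scale/=; ring.
    by rewrite normr0 mulr_ge0// ltW.
  rewrite (_ : (fun s : R => _) = \sum_i (fun s : R => v ord0 i * partial i H (eta + s *: v))).
    apply: is_derive_eq.
      apply: is_derive_sum => i.
      apply: (is_deriveZ (v ord0 i)).
      apply: (proj1 (is_derive_line (partial i H) eta v s _)).
      exact: (class_C1_derive v open_neq0 (nz s) (class_C_partial i class_C2_sqr)).
    apply: eq_bigr => i _; rewrite /GRing.scale/= mulr_sumr.
    by apply: eq_bigr => j _; rewrite mulrA.
  by apply/funext => r; rewrite fct_sumE.
have g20 (s : R) : 0 <= g2 s.
  rewrite subr_ge0; apply: le_trans (Hc1 _ v (nz s)).
  rewrite (_ : k * 2 = c * dotr v v); last by rewrite /k; field.
  rewrite ler_wpM2r ?dotr_ge0//.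
  by rewrite /c ge_min lexx.
have := convex_of_second_derivative d1 d2 g20 t0 t1.
rewrite /g scale1r scale0r addr0 -lineE {1}/v [eta + _]addrC subrK /k /H; lra.
Qed.

End convex_norm.

(** * The polar norm and the distance to the boundary *)

Section polar.
Context (R : realType) (n : nat) (F : 'rV[R]_n -> R).
Hypothesis hF : strongly_convex_norm F.
Implicit Types (x y z xi : 'rV[R]_n).

Let S x := [set dotr xi x / F xi | xi in [set xi | xi != 0]].

Lemma polar_has_sup x xi : xi != 0 -> has_sup (S x).
Proof.
move=> xi0; split; first by exists (dotr xi x / F xi), xi.
have [a a0 Ha] := norm_coercive hF.
exists ((\sum_i `|x ord0 i|) / a) => _ [eta eta0 <-].
have Fe := norm_gt0 hF eta0.
rewrite ler_pdivrMr// mulrAC ler_pdivlMr//.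
apply: (@le_trans _ _ (enorm eta * (\sum_i `|x ord0 i|) * a)).
  rewrite ler_pM2r//; apply: le_trans (ler_norm _) _.
  apply: le_trans (ler_norm_sum _ _ _) _; rewrite mulr_sumr; apply: ler_sum => i _.
  by rewrite normrM ler_wpM2r//; exact: enorm_coord.
rewrite mulrC mulrA [leRHS]mulrC; apply: ler_wpM2r; first exact: sumr_ge0.
exact: Ha.
Qed.

Lemma polar_dotr x xi : dotr xi x <= F xi * polar F x.
Proof.
have [->|xi0] := eqVneq xi 0.
  by rewrite (norm0 hF) mul0r dotr0l.
rewrite mulrC -ler_pdivrMr ?(norm_gt0 hF)//.
by apply: sup_upper_bound; [exact: polar_has_sup xi0|exists xi].
Qed.

Lemma polar_le x (b : R) : 0 <= b -> (forall xi, dotr xi x <= F xi * b) -> polar F x <= b.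
Proof.
move=> b0 Hb; have [S0|/set0P/negP/negPn/eqP S0] := pselect (S x !=set0); last first.
  by rewrite /polar -/(S x) S0 sup0.
apply: ge_sup => // _ [xi xi0 <-].
by rewrite ler_pdivrMr ?(norm_gt0 hF)// mulrC.
Qed.

Lemma polar_ge0 x : 0 <= polar F x.
Proof.
have [[_ [xi xi0 _]]|/set0P/negP/negPn/eqP S0] := pselect (S x !=set0); last first.
  by rewrite /polar -/(S x) S0 sup0.
have F0 := norm_gt0 hF xi0.
have := polar_dotr x xi; have := polar_dotr x (- xi).
rewrite (normN hF) dotrNl => h1 h2.
by rewrite -(pmulr_rge0 _ F0); lra.
Qed.

Lemma polar_triangle x y : polar F (x + y) <= polar F x + polar F y.
Proof.
apply: polar_le => [|xi]; first by rewrite addr_ge0 ?polar_ge0.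
by rewrite dotrDr mulrDr lerD ?polar_dotr.
Qed.

Lemma polar_scale (t : R) x : 0 <= t -> polar F (t *: x) <= t * polar F x.
Proof.
move=> t0; apply: polar_le => [|xi]; first by rewrite mulr_ge0 ?polar_ge0.
by rewrite dotrZr mulrCA ler_wpM2l ?polar_dotr.
Qed.

Lemma polarN x : polar F (- x) = polar F x.
Proof.
have H y : polar F (- y) <= polar F y.
  apply: polar_le => [|xi]; first exact: polar_ge0.
  by rewrite dotrNr -dotrNl -(normN hF); exact: polar_dotr.
by apply/eqP; rewrite eq_le H/=; have := H (- x); rewrite opprK.
Qed.

Lemma polar_gt0 x : x != 0 -> 0 < polar F x.
Proof.
move=> x0; have := polar_dotr x x; have := dotr_gt0 x0 => h1 h2.
by rewrite -(pmulr_rgt0 _ (norm_gt0 hF x0)); exact: lt_le_trans h2.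
Qed.

Lemma polar_lower x : `|x| <= norm_basis F * polar F x.
Proof.
apply: mx_norm_le => [|i]; first by rewrite mulr_ge0 ?norm_basis_ge0 ?polar_ge0.
have Fe : F (delta_mx ord0 i) <= norm_basis F.
  by rewrite /norm_basis (bigD1 i)//= lerDl sumr_ge0// => j _; exact: norm_ge0.
apply: (@le_trans _ _ (F (delta_mx ord0 i) * polar F x)); last first.
  by rewrite ler_wpM2r ?polar_ge0.
rewrite ler_norml; have := polar_dotr x (delta_mx ord0 i).
have := polar_dotr x (- delta_mx ord0 i).
by rewrite (normN hF) dotrNl dotr_delta; lra.
Qed.

Lemma polar_upper : exists2 K, 0 <= K & forall x, polar F x <= K * `|x|.
Proof.
have [a a0 Ha] := norm_coercive hF.
exists (n%:R / a); first by rewrite divr_ge0// ltW.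
move=> x; apply: polar_le => [|xi].
  by rewrite mulr_ge0// divr_ge0// ltW.
apply: (@le_trans _ _ (\sum_(i < n) enorm xi * `|x|)).
  apply: ler_sum => i _; apply: le_trans (ler_norm _) _; rewrite normrM.
  by apply: ler_pM => //; [exact: enorm_coord|exact: mx_norm_coord].
rewrite sumr_const card_ord -[leLHS]mulr_natr.
have -> : F xi * (n%:R / a * `|x|) = F xi / a * (`|x| * n%:R) by ring.
by rewrite -mulrA ler_wpM2r ?mulr_ge0// ler_pdivlMr// mulrC.
Qed.

Lemma polar_sqr_ge xi z : 2 * dotr xi z - F xi ^+ 2 <= polar F z ^+ 2.
Proof.
have := polar_dotr z xi; have := sqr_ge0 (F xi - polar F z).
rewrite sqrrB; lra.
Qed.

(** Rescale an almost maximising [xi] so that [F xi] equals [polar F z]. *)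
Lemma polar_sqr_attained z (e : R) : 0 < e ->
  exists xi, polar F z ^+ 2 - e <= 2 * dotr xi z - F xi ^+ 2.
Proof.
move=> e0; have := polar_ge0 z; rewrite le_eqVlt => /predU1P[z0|z0].
  exists 0; rewrite -z0 (norm0 hF) dotr0l.
  by rewrite expr0n/= mulr0; lra.
set s := polar F z in z0 *.
have [[_ [xi0 xi00 _]]|/set0P/negP/negPn/eqP S0] := pselect (S z !=set0); last first.
  by move: z0; rewrite /s /polar -/(S z) S0 sup0 ltxx.
have d0 : 0 < e / (2 * s) by rewrite divr_gt0// mulr_gt0.
have [_ [xi xin0 <-] Hxi] := sup_adherent d0 (polar_has_sup z xi00).
have Fx := norm_gt0 hF xin0.
exists ((s / F xi) *: xi).
have sF : 0 <= s / F xi by apply: divr_ge0; exact: ltW.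
rewrite (norm_homogeneous hF) dotrZl ger0_norm// divfK ?gt_eqF//.
have {}Hxi : s - e / (2 * s) < dotr xi z / F xi by [].
have : s * (s - e / (2 * s)) <= s * (dotr xi z / F xi) by rewrite ler_pM2l// ltW.
have -> : s * (s - e / (2 * s)) = s ^+ 2 - e / 2 by field; rewrite gt_eqF.
have -> : s / F xi * dotr xi z = s * (dotr xi z / F xi) by ring.
lra.
Qed.

(** Legendre duality: [polar F ^ 2 / 2] is the conjugate of [F ^ 2 / 2], and the
    conjugate of a strongly convex function is semiconcave: test the conjugate at
    [t x + (1 - t) y] with the same combination of the optimal slopes at [x] and
    [y], and absorb the cross term by Young's inequality. *)
Lemma polar_sqr_semiconcave : exists2 C, 0 <= C & forall x y (t : R), 0 <= t -> t <= 1 ->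
  t * polar F x ^+ 2 + (1 - t) * polar F y ^+ 2 <=
  polar F (t *: x + (1 - t) *: y) ^+ 2 + C * (t * (1 - t) * dotr (x - y) (x - y)).
Proof.
have [c c0 Hc] := norm_sqr_strongly_convex hF.
exists (2 / c); first by rewrite divr_ge0// ltW.
move=> x y t t0 t1; apply/ler_addgt0Pr => e e0.
have [xi Hxi] := polar_sqr_attained x e0.
have [eta Heta] := polar_sqr_attained y e0.
have tt : 0 <= t * (1 - t) by rewrite mulr_ge0// subr_ge0.
have := Hc xi eta t t0 t1.
have := polar_sqr_ge (t *: xi + (1 - t) *: eta) (t *: x + (1 - t) *: y).
have -> : dotr (t *: xi + (1 - t) *: eta) (t *: x + (1 - t) *: y) =
  t * dotr xi x + (1 - t) * dotr eta y - t * (1 - t) * dotr (xi - eta) (x - y).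
  rewrite !(dotrDl, dotrDr, dotrZl, dotrZr, dotrNl, dotrNr); ring.
have := ler_wpM2l tt (young (xi - eta) (x - y) c0).
have s1 : 0 <= 1 - t by rewrite subr_ge0.
have := ler_wpM2l t0 Hxi; have := ler_wpM2l s1 Heta.
rewrite !mulrBr; lra.
Qed.

End polar.

Section distance.
Context (R : realType) (n : nat) (F : 'rV[R]_n -> R) (Omega : set 'rV[R]_n).
Hypothesis hF : strongly_convex_norm F.
Hypothesis B0 : boundary Omega !=set0.
Implicit Types (x y z : 'rV[R]_n).

Let B := boundary Omega.
Let d := dist_F F Omega.

Lemma dist_le x y : B y -> d x <= polar F (x - y).
Proof.
move=> By; apply: ge_inf; last by exists y.
by exists 0 => _ [z _ <-]; exact: polar_ge0.
Qed.

(** The infimum is a minimum over a compact part of the boundary, because [polar F]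
    controls the norm. *)
Lemma dist_attained x : exists2 y, B y & d x = polar F (x - y).
Proof.
have [y0 By0] := B0; have [K K0 HK] := polar_upper hF.
pose r := norm_basis F * polar F (x - y0).
pose A := B `&` closed_ball_ Num.norm x r.
have cB : closed B.
  rewrite /B /boundary setDE; apply: closedI; first exact: closed_closure.
  by apply: open_closedC; exact: open_interior.
have cA : compact A.
  apply: bounded_closed_compact; last by apply: closedI => //; exact: closed_closed_ball_.
  exists (`|x| + r); split; first exact: num_real.
  move=> M M1 y [_]; rewrite /closed_ball_/= => xy; apply: le_trans (ltW M1).
  have -> : y = x - (x - y) by rewrite opprB addrC subrK.
  by apply: le_trans (ler_normB _ _) _; rewrite lerD2l.
have A0 : A !=set0.
  by exists y0; split => //; rewrite /closed_ball_/=; exact: polar_lower.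
have cp : {within A, continuous (fun y => polar F (x - y))}.
  apply: continuous_subspaceT; apply: (lipschitz_continuous (K := K)) => y z.
  have H u v : polar F (x - u) - polar F (x - v) <= K * `|u - v|.
    rewrite lerBlDr; apply: le_trans (_ : polar F (- (u - v)) + polar F (x - v) <= _).
      apply: le_trans (polar_triangle hF _ _); apply: eq_ler; congr polar.
      by rewrite opprB [RHS]addrC addrA subrK.
    by rewrite lerD2r polarN.
  by rewrite ler_norml H andbT lerNl opprB distrC H.
have [c /set_mem[Bc _] Hc] := EVT_min_rV A0 cA cp.
exists c => //; apply/eqP; rewrite eq_le dist_le//=.
apply: lb_le_inf; first by exists (polar F (x - y0)), y0.
move=> _ [y By <-]; have [yr|yr] := pselect (A y); first by apply: Hc; rewrite inE.
have Ay0 : A y0 by split => //; rewrite /closed_ball_/=; exact: polar_lower.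
apply: le_trans (Hc y0 _) _; first by rewrite inE.
have nb : 0 < norm_basis F.
  rewrite lt_neqAle norm_basis_ge0// andbT; apply/eqP => E; apply: yr; split=> //.
  rewrite /closed_ball_/= /r -E mul0r.
  by apply: le_trans (polar_lower hF _) _; rewrite -E mul0r.
rewrite leNgt; apply/negP => lt; apply: yr; split => //; rewrite /closed_ball_/=.
apply: le_trans (polar_lower hF _) _.
by rewrite /r ler_pM2l// ltW.
Qed.

Lemma dist_ge0 x : 0 <= d x.
Proof. by have [y _ ->] := dist_attained x; exact: polar_ge0. Qed.

Lemma dist_gt0 x : open Omega -> Omega x -> 0 < d x.
Proof.
move=> oO Ox; have [y [_ nOy] ->] := dist_attained x.
apply: polar_gt0 => //; rewrite subr_eq0; apply/eqP => xy; apply: nOy.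
by rewrite -xy; exact: open_nbhs_nbhs.
Qed.

Lemma dist_triangle x y : d x <= d y + polar F (x - y).
Proof.
have [z Bz ->] := dist_attained y; apply: le_trans (dist_le x Bz) _.
apply: le_trans (polar_triangle hF _ _); apply: eq_ler; congr polar.
by rewrite [RHS]addrC addrA subrK.
Qed.

Lemma dist_lipschitz : exists2 K, 0 <= K & forall x y, `|d x - d y| <= K * `|x - y|.
Proof.
have [K K0 HK] := polar_upper hF; exists K => // x y.
have H u v : d u - d v <= K * `|u - v|.
  by rewrite lerBlDl; apply: le_trans (dist_triangle u v) _; rewrite lerD2l.
by rewrite ler_norml H andbT lerNl opprB distrC H.
Qed.

Lemma dist_continuous : continuous d.
Proof. by have [K _ HK] := dist_lipschitz; exact: lipschitz_continuous HK. Qed.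

(** The boundary point nearest to [x] competes along the whole segment from [x] to it,
    where the homogeneity of [polar F] gives the distance to it. *)
Lemma dist_towards x y (t : R) : B y -> d x = polar F (x - y) -> t <= 1 ->
  d (x + t *: (y - x)) <= (1 - t) * d x.
Proof.
move=> By -> t1; apply: le_trans (dist_le _ By) _.
apply: le_trans (polar_scale hF (x - y) (_ : 0 <= 1 - t)); last by rewrite subr_ge0.
apply: eq_ler; congr polar; rewrite scalerBl scale1r addrAC; congr (_ + _).
by rewrite -scalerN opprB.
Qed.

(** An infimum of functions semiconcave with a common constant is semiconcave with
    that constant. *)
Lemma dist_sqr_semiconcave : exists2 C, 0 <= C & is_convex (fun x => - (d x ^+ 2 - C * dotr x x)).
Proof.
have [C C0 HC] := polar_sqr_semiconcave hF; exists C => // x y t t0 t1.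
have [z Bz Ez] := dist_attained (t *: x + (1 - t) *: y).
have := HC (x - z) (y - z) t t0 t1.
have -> : t *: (x - z) + (1 - t) *: (y - z) = t *: x + (1 - t) *: y - z.
  by rewrite !scalerBr addrACA -opprD -scalerDl addrCA subrr addr0 scale1r.
rewrite -Ez opprB addrA subrK.
have sq w : d w ^+ 2 <= polar F (w - z) ^+ 2.
  by rewrite lerXn2r ?nnegrE ?dist_ge0 ?polar_ge0// dist_le.
have s1 : 0 <= 1 - t by rewrite subr_ge0.
have := ler_wpM2l t0 (sq x); have := ler_wpM2l s1 (sq y).
have := congr1 (fun a => C * a) (dotr_convex_gap t x y).
rewrite !mulrDr; lra.
Qed.

End distance.

(** * The eikonal inequality and the gradient of the distance *)

Section eikonal.
Context (R : realType) (n : nat) (F : 'rV[R]_n -> R) (Omega : set 'rV[R]_n).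
Hypothesis hF : strongly_convex_norm F.
Hypothesis B0 : boundary Omega !=set0.
Hypothesis oO : open Omega.
Implicit Types (x y z : 'rV[R]_n).

Let d := dist_F F Omega.

(** Along the segment to the nearest boundary point [y] the distance drops at
    unit speed, and semiconcavity bounds the first-order decrease by
    [grad d . (y - x)], although [d] is only known to have partial derivatives. *)
Lemma dist_eikonal x : Omega x -> (forall i, derivable d x (delta_mx ord0 i)) ->
  1 <= F (gradient d x).
Proof.
move=> Ox dd; have [C C0 cq] := dist_sqr_semiconcave hF B0; rewrite -/d in cq.
have d0 : 0 < d x by exact: dist_gt0.
have [y By Ey] := dist_attained hF B0 x.
have [v vE] : exists v, v = y - x by exists (y - x).
pose g := gradient d x.
have dq i : is_derive x (delta_mx ord0 i) (fun x => - (d x ^+ 2 - C * dotr x x))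
    (- (2 * d x * g ord0 i - C * (2 * x ord0 i))).
  have D1 : is_derive x (delta_mx ord0 i) d (g ord0 i).
    by rewrite mxE; exact: derivableP.
  have D2 := is_deriveM D1 D1.
  have D3 := is_deriveN (is_deriveB D2 (is_deriveZ C (is_derive_dotr x i))).
  rewrite (_ : (fun x => _) = - (d * d - C \*: (fun x : 'rV[R]_n => dotr x x))).
    by apply: (is_derive_eq D3); rewrite /GRing.scale/=; ring.
  by apply/funext => z; rewrite expr2.
have up := updir_sum v cq dq.
have Sg : \sum_i v ord0 i * - (2 * d x * g ord0 i - C * (2 * x ord0 i)) =
    - (2 * d x * dotr g v) + 2 * C * dotr x v.
  rewrite /dotr !mulr_sumr -sumrN -big_split; apply: eq_bigr => i _ /=; ring.
rewrite Sg in up.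
have key : d x ^+ 2 <= - (d x * dotr g v).
  apply/ler_addgt0Pr => e e0.
  have [r r0 Hr] := up e e0.
  have p1 : 0 < d x ^+ 2 + 1 by rewrite ltr_wpDl ?sqr_ge0.
  pose t := Num.min (Num.min (r / 2) 1) (e / (d x ^+ 2 + 1)).
  have t0 : 0 < t by rewrite !lt_min divr_gt0// ltr01 divr_gt0.
  have tr : t < r.
    apply: (@le_lt_trans _ _ (r / 2)); last by lra.
    by rewrite /t !ge_min lexx.
  have t1 : t <= 1 by rewrite /t !ge_min lexx orbT.
  have te : t * d x ^+ 2 <= e.
    apply: (@le_trans _ _ (t * (d x ^+ 2 + 1))); first by rewrite ler_pM2l// lerDl.
    by rewrite -ler_pdivlMr// /t !ge_min lexx orbT.
  have := Hr t; rewrite gtr0_norm// => /(_ tr).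
  have P1 : d (x + t *: v) ^+ 2 <= ((1 - t) * d x) ^+ 2.
    have a0 : 0 <= (1 - t) * d x by rewrite mulr_ge0 ?subr_ge0// (dist_ge0 hF B0).
    rewrite lerXn2r ?nnegrE ?a0 ?(dist_ge0 hF B0)//; rewrite vE; exact: dist_towards.
  rewrite !(dotrDl, dotrDr, dotrZl, dotrZr) (dotrC v x).
  have vv : 0 <= t * (C * (t * dotr v v)) by rewrite !mulr_ge0 ?dotr_ge0// ltW.
  move=> H.
  have : t * (d x ^+ 2 * (2 - t)) <= t * (- (2 * d x * dotr g v) + e).
    by move: P1 H vv; rewrite exprMn; lra.
  by rewrite ler_pM2l//; lra.
have := polar_dotr hF (x - y) g.
rewrite -Ey -/g (_ : x - y = - v); last by rewrite vE opprB.
rewrite dotrNr => H1.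
have : d x <= F g * d x.
  apply: le_trans H1; move: key; rewrite -mulrN expr2 ler_pM2l//.
by rewrite -{1}[d x]mul1r ler_pM2r.
Qed.

End eikonal.

Section kinks_derivability.
Context (R : realType).

Lemma derive_not_kinks (V : normedModType R) (f : V -> R) (e x : V) (l : R) :
  is_derive x e f l -> ~ kinks f e x.
Proof.
move=> /is_deriveP df [m _ Hm].
have m0 : 0 < m.+1%:R^-1 :> R by rewrite invr_gt0 ltr0n.
have [r r0 Hr] := df _ (divr_gt0 m0 (ltr0n R 3)).
have [k kr] := archi_inv r0.
have k0 : 0 < k.+1%:R^-1 :> R by rewrite invr_gt0 ltr0n.
have := Hr k.+1%:R^-1; rewrite (gtr0_norm k0) => /(_ kr) H1.
have := Hr (- k.+1%:R^-1); rewrite normrN (gtr0_norm k0) => /(_ kr).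
rewrite scaleNr => H2.
have := Hm k I; rewrite /= /second_diff.
rewrite leNgt => /negP; apply.
rewrite -ltr_pdivlMl ?ltr0n//.
move: H1 H2; set h := k.+1%:R^-1 in k0 *; set a := m.+1%:R^-1 in m0 *.
have ha : 0 < h * a by rewrite mulr_gt0.
by rewrite !ler_norml; lra.
Qed.

Lemma concave_derivable (V : normedModType R) (f : V -> R) (e x : V) :
  is_convex (fun y => - f y) -> ~ kinks f e x -> exists l : R, is_derive x e f l.
Proof.
move=> cf nk.
have cg : is_convex (fun s : R => - f (x + s *: e)).
  move=> s r t t0 t1 /=.
  have := cf (x + s *: e) (x + r *: e) t t0 t1.
  have -> : t *: (x + s *: e) + (1 - t) *: (x + r *: e) = x + (t * s + (1 - t) * r) *: e.
    by rewrite !scalerDr addrACA -scalerDl [t + (1 - t)]addrC subrK scale1r !scalerA -scalerDl.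
  by [].
have [|l dl] := @concave_derive R _ cg 0.
  by move=> K; apply: nk; have := (kinks_line f e x 0).2 K; rewrite scale0r addr0.
by exists l; apply/is_derive_line0.
Qed.

End kinks_derivability.

Section gradient_of_distance.
Context (R : realType) (n : nat) (F : 'rV[R]_n -> R) (Omega : set 'rV[R]_n).
Hypothesis hF : strongly_convex_norm F.
Hypothesis B0 : boundary Omega !=set0.
Hypothesis oO : open Omega.
Implicit Types (x y z : 'rV[R]_n).

Let d := dist_F F Omega.

(** In [Omega] the distance is a smooth function of its square, which differs from a
    concave function by a paraboloid; its partial derivative therefore exists exactly
    off the kinks of that concave function. *)
Lemma dist_exceptional_set : exists2 N : 'I_n -> set 'rV[R]_n,
  forall i, measurable (N i) /\ leb R n (N i) = 0%E &
  forall i x, Omega x -> derivable d x (delta_mx ord0 i) <-> ~ N i x.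
Proof.
have [C C0 cq] := dist_sqr_semiconcave hF B0.
pose q x := d x ^+ 2 - C * dotr x x.
have cd := dist_continuous hF B0.
have cdot : continuous (fun x : 'rV[R]_n => dotr x x).
  have H : class_C 0 setT (fun x : 'rV[R]_n => dotr x x).
    apply: class_C_sum; first exact: openT.
    by move=> i; apply: class_CM; [exact: openT| |]; apply: class_C_coord; exact: openT.
  by move=> x; exact: (class_C_continuous (I : setT x) H).
have cQ : continuous q.
  move=> x; apply: (@cvgB _ _ _ (nbhs x) _ (fun x => d x ^+ 2) (fun x => C * dotr x x)).
    rewrite (_ : (fun x => d x ^+ 2) = d \* d); last first.
      by apply/funext => z /=; rewrite expr2.
    exact: cvgM (cd x) (cd x).
  exact: (cvgM (@cst_continuous _ _ C x) (cdot x)).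
exists (fun i => kinks q (delta_mx ord0 i)) => [i|i x Ox].
  by split; [exact: measurable_kinks|exact: kinks_null].
have d0 : 0 < d x by exact: dist_gt0.
split=> [/derivableP D1|nk].
  have D3 := is_deriveB (is_deriveM D1 D1) (is_deriveZ C (is_derive_dotr x i)).
  exact: (derive_not_kinks (f := q) D3).
have [l dl] := concave_derivable cq nk.
have D2 := is_deriveD dl (is_deriveZ C (is_derive_dotr x i)).
have D3 : is_derive x (delta_mx ord0 i) (fun x => d x ^+ 2) (l + C * (2 * x ord0 i)).
  rewrite (_ : (fun x => d x ^+ 2) = q + C \*: (fun x : 'rV[R]_n => dotr x x)).
    exact: D2.
  by apply/funext => z; rewrite /q /= -[RHS]/(q z + C * dotr z z) subrK.
have p0 : 0 < d x ^+ 2 by rewrite exprn_gt0.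
have [D4 _] := is_derive_chain D3 (is_derive1_sqrt p0).
rewrite (_ : d = Num.sqrt \o (fun x => d x ^+ 2)); first exact: D4.
apply/funext => z /=; rewrite sqrtr_sqr ger0_norm//; exact: dist_ge0.
Qed.

Lemma measurable_partial_dist i : measurable_fun Omega (partial i d).
Proof.
have [N HN dN] := dist_exceptional_set.
have [mN _] := HN i; have mO := open_measurable_rV oO.
have cd := dist_continuous hF B0.
have -> : Omega = (Omega `\` N i) `|` (Omega `&` N i).
  by rewrite setUC setUIDK.
apply/measurable_funU; [exact: measurableD|exact: measurableI|split].
  apply: (@measurable_fun_cvg _ _ _ _ (fun k x =>
    k.+1%:R * (d (x + k.+1%:R^-1 *: delta_mx ord0 i) - d x))).
    move=> k; apply: (@measurable_funS _ _ _ _ setT) => //.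
    apply: measurable_funM; first exact: measurable_cst.
    apply: measurable_funB; apply: continuous_measurable_fun_rV => //.
    move=> x; apply: (@continuous_comp _ _ _ (fun x : 'rV[R]_n => x + _) d); last exact: cd.
    by apply: nonexpansive_continuous => y z; rewrite opprD addrACA subrr addr0.
  move=> x [Ox nNx]; have /derivableP/is_deriveP D := (dN i x Ox).2 nNx.
  apply/cvgrPdist_le => e e0; have [r r0 Hr] := D e e0.
  have [k kr] := archi_inv r0.
  near=> m.
  have m0 : 0 < m.+1%:R^-1 :> R by rewrite invr_gt0 ltr0n.
  have mr : m.+1%:R^-1 < r.
    apply: le_lt_trans kr; rewrite lef_pV2 ?posrE ?ltr0n// ler_nat ltnS.
    by near: m; exists k.
  have := Hr m.+1%:R^-1; rewrite (gtr0_norm m0) => /(_ mr).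
  rewrite distrC -[e * _]mulrC -ler_pdivrMl// invrK => H.
  apply: le_trans H; rewrite -[X in _ <= X * _]gtr0_norm ?ltr0n// -normrM.
  have mn : m.+1%:R != 0 :> R by rewrite pnatr_eq0.
  by apply: eq_ler; congr (`|_|); rewrite [RHS]mulrBr mulrA divff// mul1r.
(* On the exceptional set [partial] is the default value of a divergent limit. *)
apply: (eq_measurable_fun (cst point)); last exact: measurable_cst.
move=> x; rewrite inE => -[Ox Nx]; rewrite /partial /derive dvgP//.
by move=> dx; case: ((dN i x Ox).1 dx).
Unshelve. all: by end_near. Qed.

Lemma partial_dist_bound : exists2 K, 0 <= K & forall i x,
  derivable d x (delta_mx ord0 i) -> `|partial i d x| <= K.
Proof.
have [K K0 HK] := dist_lipschitz hF B0; exists K => // i x /derivableP D.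
apply: (is_derive_lipschitz _ D) => h.
apply: le_trans (HK _ _) _; rewrite addrAC subrr add0r normrZ.
rewrite ler_wpM2l// -[leRHS]mulr1 ler_wpM2l//; exact: mx_norm_delta.
Qed.

End gradient_of_distance.

(** * The Hardy multiplier *)

Section weight.
Context (R : realType) (D : R).
Hypothesis D0 : 0 < D.

(** In terms of [s = d ^ 2]: [invd s = 1 / d], [logd s = log (D / d)] and
    [mult s = f'(d) / f(d)] for the positive solution [f = sqrt (d log (D / d))] of
    [- f'' = (1 / 4 d ^ 2) (1 + (log (D / d)) ^ -2) f]. The square is the
    right variable because it is the square of the distance that has good smooth
    approximations. *)
Definition invd (s : R) : R := expR (- (ln s / 2)).
Definition logd (s : R) : R := ln D - ln s / 2.
Definition mult (s : R) : R := 2^-1 * invd s * (1 - (logd s)^-1).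
Definition dmult (s : R) : R :=
  - (invd s ^+ 3 / 4) * (1 - (logd s)^-1 + (logd s)^-1 ^+ 2).

Lemma half_ln_sqr (t : R) : 0 < t -> ln (t ^+ 2) / 2 = ln t.
Proof. by move=> t0; rewrite lnXn// -[_ *+ 2]mulr_natr mulfK// pnatr_eq0. Qed.

Lemma invd_sqr (t : R) : 0 < t -> invd (t ^+ 2) = t^-1.
Proof.
move=> t0; rewrite /invd half_ln_sqr//.
by rewrite expRN lnK// posrE.
Qed.

Lemma logd_sqr (t : R) : 0 < t -> logd (t ^+ 2) = ln (D / t).
Proof.
move=> t0; rewrite /logd half_ln_sqr//.
by rewrite ln_div ?posrE.
Qed.

Lemma sqr_invd (s : R) : 0 < s -> invd s ^+ 2 = s^-1.
Proof.
move=> s0; rewrite -expRM_natl -mulr_natl mulrN mulrC divfK ?pnatr_eq0//.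
by rewrite expRN lnK// posrE.
Qed.

Lemma is_derive_half_ln (s : R) : 0 < s ->
  is_derive s 1 (fun s : R => ln s / 2) (s^-1 / 2).
Proof.
move=> s0; rewrite (_ : (fun s : R => _) = 2^-1 \*: @ln R); last first.
  by apply/funext => r /=; rewrite mulrC.
have H := is_deriveZ (2^-1) (is_derive1_ln s0).
by apply: (is_derive_eq H); rewrite /GRing.scale/= mulrC.
Qed.

Lemma is_derive_invd (s : R) : 0 < s -> is_derive s 1 invd (- (invd s ^+ 3 / 2)).
Proof.
move=> s0; have dl := is_derive_half_ln s0.
have H := is_derive_chain (is_deriveN dl) (is_derive_expR (- (ln s / 2))).
apply: (is_derive_eq H); rewrite -(sqr_invd s0) -/(invd s).
by move: (invd s) => a; ring.
Qed.

Lemma is_derive_logd (s : R) : 0 < s -> is_derive s 1 logd (- (invd s ^+ 2 / 2)).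
Proof.
move=> s0; have H := is_deriveB (is_derive_cst (ln D) s 1) (is_derive_half_ln s0).
by apply: (is_derive_eq H); rewrite sub0r (sqr_invd s0).
Qed.

Lemma is_derive_mult (s : R) : 0 < s -> logd s != 0 ->
  is_derive s 1 mult (dmult s).
Proof.
move=> s0 L0; have di := is_derive_invd s0; have dL := is_derive_logd s0.
have dV := is_derive_chain dL (is_derive_inv L0).
have H := is_deriveM (is_deriveZ (2^-1) di) (is_deriveB (is_derive_cst (1 : R) s 1) dV).
have {}H : is_derive s 1 mult _ := H.
apply: (is_derive_eq H); rewrite -[(2^-1 \*: invd) s]/(2^-1 * invd s).
rewrite -[(cst 1 - _) s]/(1 - (logd s)^-1) /GRing.scale/= /dmult.
by move: (invd s) (logd s)^-1 => a b; field.
Qed.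

Lemma logd_ge1 (s S : R) : 0 < s -> 0 < S -> D = expR 1 * S -> s <= S ^+ 2 -> 1 <= logd s.
Proof.
move=> s0 S0 DE sS; rewrite /logd DE lnM ?posrE ?expR_gt0// expRK.
have : ln s <= ln (S ^+ 2) by rewrite ler_ln ?posrE// exprn_gt0.
by rewrite lnXn// -[_ *+ 2]mulr_natr; lra.
Qed.

(** Bounds depending only on a lower bound for the argument: they dominate the
    integrands when [s] runs through the approximations of [d ^ 2]. *)
Lemma mult_bounds (s e : R) : 0 < e -> e <= s -> 1 <= logd s ->
  0 <= mult s <= invd e /\ `|dmult s| <= invd e ^+ 3.
Proof.
move=> e0 es L1; have s0 : 0 < s := lt_le_trans e0 es.
have ise : invd s <= invd e.
  by rewrite /invd ler_expR lerN2 ler_pM2r ?invr_gt0// ler_ln ?posrE.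
have i0 : 0 < invd s := expR_gt0 _.
have p0 r : 0 <= invd r := expR_ge0 _.
have l0 : 0 <= (logd s)^-1 by rewrite invr_ge0; lra.
have l1 : (logd s)^-1 <= 1 by rewrite invf_le1//; lra.
split.
  have m1 : 0 <= 1 - (logd s)^-1 <= 1 by apply/andP; split; lra.
  have /andP[m2 m3] : 0 <= invd s * (1 - (logd s)^-1) <= invd s.
    by move: m1 => /andP[? ?]; rewrite mulr_ge0 ?p0//= ler_piMr ?p0.
  by rewrite /mult -mulrA; apply/andP; split; lra.
apply: (@le_trans _ _ (invd s ^+ 3)); last by rewrite lerXn2r ?nnegrE ?p0.
have i3 : 0 <= invd s ^+ 3 by rewrite exprn_ge0.
have i4 : 0 <= invd s ^+ 3 / 4 by rewrite divr_ge0.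
have /andP[l2 l3] : 0 <= (logd s)^-1 ^+ 2 <= 1 by rewrite exprn_ge0//= exprn_ile1.
rewrite /dmult normrM normrN (ger0_norm i4).
apply: (@le_trans _ _ (invd s ^+ 3 / 4 * 4)); last by rewrite divfK ?pnatr_eq0.
by apply: ler_wpM2l => //; rewrite ler_norml; lra.
Qed.

Lemma class_C_mult n (A : set 'rV[R]_n) (p : 'rV[R]_n -> R) k : open A ->
  (forall x, A x -> 0 < p x /\ logd (p x) != 0) -> class_C k A p ->
  class_C k A (fun x => mult (p x)).
Proof.
move=> oA Ap Cp.
have Cl : class_C k A (fun x => ln (p x) / 2).
  apply: class_CM => //; last exact: class_C_cst.
  by apply: class_C_ln => // x /Ap[].
apply: class_CM => //.
  apply: class_CM => //; first exact: class_C_cst.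
  by apply: class_C_expR => //; exact: class_CN.
apply: class_CB => //; first exact: class_C_cst.
apply: class_CV => //; first by move=> x /Ap[].
by apply: class_CB => //; exact: class_C_cst.
Qed.

Lemma is_derive_cvg (f : R -> R) (s l : R) (u : R^nat) :
  is_derive s 1 f l -> u @ \oo --> s -> (fun m => f (u m)) @ \oo --> f s.
Proof.
move=> [/derivable1_diffP/differentiable_continuous cf _] us.
by apply: continuous_cvg.
Qed.

Lemma mult_cvg (s : R) (u : R^nat) : 0 < s -> logd s != 0 -> u @ \oo --> s ->
  (fun m => mult (u m)) @ \oo --> mult s /\ (fun m => dmult (u m)) @ \oo --> dmult s.
Proof.
move=> s0 L0 us; split; first exact: is_derive_cvg (is_derive_mult s0 L0) us.
have ci := is_derive_cvg (is_derive_invd s0) us.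
have cL : (fun m => (logd (u m))^-1) @ \oo --> (logd s)^-1.
  by apply: cvgV => //; exact: is_derive_cvg (is_derive_logd s0) us.
have c1 : (fun m => invd (u m) ^+ 3 / 4) @ \oo --> invd s ^+ 3 / 4.
  rewrite (_ : (fun m => _) = (fun m => invd (u m) * (invd (u m) * invd (u m)) / 4)).
    by apply: cvgMl; apply: cvgM => //; exact: cvgM.
  by apply/funext => m; rewrite !exprS expr0 mulr1.
apply: cvgM; first exact: cvgN.
apply: cvgD; first by apply: cvgB; [exact: cvg_cst|exact: cL].
rewrite (_ : (fun m => _) = (fun m => (logd (u m))^-1 * (logd (u m))^-1)).
  exact: cvgM.
by apply/funext => m; rewrite expr2.
Qed.

End weight.

Section smooth_approximation.
Context (R : realType) (n : nat).
Implicit Types (q : 'rV[R]_n -> R).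

(** Difference quotients of smooth functions concave along an axis squeeze their
    partial derivatives, so uniform convergence alone forces these to converge
    wherever the limit has a partial derivative. *)
Lemma concave_partial_cvg (g : nat -> 'rV[R]_n -> R) q (e : nat -> R) (M l : R) (i : 'I_n) (x : 'rV[R]_n) :
  e @ \oo --> 0 -> (forall m y, cube M y -> `|g m y - q y| <= e m) ->
  (forall m y, cube M y -> forall h : R, cube M (y + h *: delta_mx ord0 i) ->
    g m (y + h *: delta_mx ord0 i) <= g m y + h * partial i (g m) y) ->
  (forall j, `|x ord0 j| + 1 <= M) -> is_derive x (delta_mx ord0 i) q l ->
  (fun m => partial i (g m) x) @ \oo --> l.
Proof.
move=> e0 gq gt xM /is_deriveP dq; apply/cvgrPdist_le => a a0.
have a2 : 0 < a / 2 by rewrite divr_gt0.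
have [r r0 Hr] := dq _ a2.
pose h := Num.min (r / 2) 1.
have h0 : 0 < h by rewrite lt_min divr_gt0//=.
have hr : h < r by apply: (@le_lt_trans _ _ (r / 2)); [rewrite /h ge_min lexx|lra].
have h1 : h <= 1 by rewrite /h ge_min lexx orbT.
have inc (t : R) : `|t| <= 1 -> cube M (x + t *: delta_mx ord0 i).
  move=> t1 j; rewrite !mxE eqxx/=; apply: le_trans (xM j).
  apply: le_trans (ler_normD _ _) _; rewrite lerD2l.
  by case: eqP; rewrite ?mulr1// mulr0 normr0.
have cx : cube M x by have := inc 0; rewrite normr0 scale0r addr0; apply.
have hn : `|h| <= 1 by rewrite gtr0_norm.
have hn' : `|- h| <= 1 by rewrite normrN gtr0_norm.
have := Hr h; rewrite gtr0_norm// => /(_ hr) Q1.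
have := Hr (- h); rewrite normrN gtr0_norm// => /(_ hr) Q2.
have ah : 0 < a * h / 4 by rewrite divr_gt0// mulr_gt0.
near=> m.
have em : e m <= a * h / 4.
  have : `|0 - e m| <= a * h / 4 by near: m; move/cvgrPdist_le : e0; exact.
  by rewrite sub0r normrN; apply: le_trans; exact: ler_norm.
have T1 := gt m x cx h (inc _ hn); have T2 := gt m x cx (- h) (inc _ hn').
have G0 := gq m x cx; have G1 := gq m _ (inc _ hn); have G2 := gq m _ (inc _ hn').
move: Q1 Q2 T1 T2 G0 G1 G2.
set p := partial i (g m) x; set q1 := q (x + h *: _); set q2 := q (x + - h *: _).
set g1 := g m (x + h *: _); set g2 := g m (x + - h *: _).
rewrite !ler_norml => /andP[A1 A2] /andP[B1 B2] T1 T2 /andP[G0 G0'] /andP[G1 G1'] /andP[G2 G2'].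
rewrite -lerBlDl -(ler_pM2r h0) -[X in _ && X](ler_pM2r h0) mulNr.
by apply/andP; split; rewrite mulrBl; lra.
Unshelve. all: by end_near. Qed.

End smooth_approximation.

(** * Smooth approximation of the squared distance *)

Section measurability_rV.
Context (R : realType).

Lemma measurable_fun_rV_on d (T : measurableType d) n (A : set T) (f : T -> 'rV[R]_n) :
  (forall i, measurable_fun A (fun t => f t ord0 i)) -> measurable_fun A f.
Proof.
move=> mf mA; suff : @measurable _ 'rV[R]_n `<=` [set Y | measurable (A `&` f @^-1` Y)].
  by move=> H Y /H.
apply: smallest_sub => /=.
  split=> [|Y mY|G mG] /=.
  - by rewrite preimage_set0 setI0.
  - rewrite setTD preimage_setC -setDE (_ : _ `\` _ = A `\` (A `&` f @^-1` Y)).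
      exact: measurableD.
    by rewrite setDIr setDv set0U.
  - by rewrite preimage_bigcup setI_bigcupr; exact: bigcupT_measurable.
rewrite -bigcup_seq => Y [i _ [Z mZ <-]] /=.
by rewrite setTI; exact: mf.
Qed.

Lemma integral_null_support d (T : measurableType d) (mu : {measure set T -> \bar R})
    (A E N : set T) (f : T -> \bar R) :
  measurable A -> measurable E -> measurable N -> mu N = 0%E -> E `<=` A ->
  measurable_fun A f -> (forall x, A x -> ~ E x -> ~ N x -> f x = 0%E) ->
  (\int[mu]_(x in A) f x = \int[mu]_(x in E) f x)%E.
Proof.
move=> mA mE mN N0 EA mf f0.
rewrite -[in RHS](setIidr EA) integral_mkcondr; apply: ae_eq_integral => //.
  apply/measurable_restrict => //; rewrite setIidr//.
  exact: measurable_funS mf.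
exists N; split => // x /= /not_implyP[Ax H]; apply: contrapT => nNx; apply: H.
rewrite /patch; case: ifPn => //; rewrite notin_setE => nEx.
exact: f0.
Qed.

End measurability_rV.

Section flux.
Context (R : realType) (n : nat) (F : 'rV[R]_n -> R).
Hypothesis hF : strongly_convex_norm F.

(** Components of the vector field whose divergence is the Finsler Laplacian. *)
Definition flux (i : 'I_n) (eta : 'rV[R]_n) := F eta * gradient F eta ord0 i.

Lemma measurable_flux i : measurable_fun setT (flux i).
Proof.
have E : [set: 'rV[R]_n] = [set eta | eta != 0] `|` [set 0].
  apply/seteqP; split=> x //= _.
  by have [->|x0] := eqVneq x 0; [right|left].
(* [gradient F] is continuous off the origin only, but there [F] kills it. *)
rewrite E; apply/measurable_funU.
- by apply: open_measurable_rV; exact: open_neq0.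
- apply: closed_measurable_rV; apply: accessible_closed_set1.
  by apply: hausdorff_accessible; exact: norm_hausdorff.
split; last first.
  apply: (@eq_measurable_fun _ _ _ _ _ (fun _ : 'rV[R]_n => 0 : R)); last exact: measurable_cst.
  by move=> x; rewrite inE => /= ->; rewrite /flux (norm0 hF) mul0r.
apply: measurable_funM; apply: open_continuous_measurable_fun_rV; try exact: open_neq0.
  by move=> x _; exact: norm_continuous_rV.
move=> x x0; rewrite (_ : (fun x => _) = partial i F); last first.
  by apply/funext => y; rewrite mxE.
exact: (class_C_continuous x0 (class_C_partial i (norm_C2 hF))).
Qed.

Lemma flux_bound i (eta : 'rV[R]_n) (K : R) : (forall j, `|eta ord0 j| <= K) ->
  `|flux i eta| <= norm_basis F * K * norm_basis F.
Proof.
move=> HK; have nb := norm_basis_ge0 hF.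
have K0 : 0 <= K by apply: le_trans (HK i).
have [->|eta0] := eqVneq eta 0.
  by rewrite /flux (norm0 hF) mul0r normr0 !mulr_ge0.
rewrite normrM (ger0_norm (norm_ge0 hF _)); apply: ler_pM => //.
- exact: norm_ge0.
- exact: norm_le_basis.
- apply: le_trans (gradient_norm_coord_abs hF i eta0) _.
  by rewrite /norm_basis (bigD1 i)//= lerDl sumr_ge0// => j _; exact: norm_ge0.
Qed.

End flux.

Section compact_bounds.
Context (R : realType) (n : nat).

Lemma compact_fun_bound (K : set 'rV[R]_n) (f : 'rV[R]_n -> R) : compact K ->
  continuous f -> exists2 M, 0 <= M & forall x, K x -> `|f x| <= M.
Proof.
move=> cK cf.
have : compact (f @` K) by apply: continuous_compact => //; exact: continuous_subspaceT.
move=> /compact_bounded/ex_strict_bound_gt0[M M0 HM]; exists M; first exact: ltW.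
by move=> x Kx; apply: ltW; apply: HM; exists x.
Qed.

Lemma compact_cube (K : set 'rV[R]_n) : compact K ->
  exists2 M, 0 < M & forall x, K x -> forall i, `|x ord0 i| + 1 <= M.
Proof.
move=> /compact_bounded/ex_strict_bound_gt0[M M0 HM]; exists (M + 1).
  by rewrite ltr_wpDl// ltW.
move=> x Kx i; rewrite lerD2r; apply: le_trans (mx_norm_coord x i) _.
exact: ltW (HM x Kx).
Qed.

End compact_bounds.

Section approximants.
Context (R : realType) (n : nat) (F : 'rV[R]_n -> R) (Omega : set 'rV[R]_n).
Hypothesis hF : strongly_convex_norm F.
Hypothesis B0 : boundary Omega !=set0.
Hypothesis oO : open Omega.
Implicit Types (x y z : 'rV[R]_n).

Let d := dist_F F Omega.

Lemma semiconcave_lipschitz_cube (C M : R) : 0 <= M -> 0 <= C ->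
  exists2 L, 0 <= L & forall y z, cube M y -> cube M z ->
    `|(d y ^+ 2 - C * dotr y y) - (d z ^+ 2 - C * dotr z z)| <=
    L * \sum_i `|y ord0 i - z ord0 i|.
Proof.
move=> M0 C0; have [K K0 HK] := dist_lipschitz hF B0.
have cubeM x : cube M x -> d x <= d 0 + K * M.
  move=> Hx; have := HK x 0; rewrite subr0 ler_norml => /andP[_].
  rewrite lerBlDl => /le_trans; apply; rewrite lerD2l ler_wpM2l//.
  exact: mx_norm_le.
have dge x : 0 <= d x by exact: dist_ge0.
pose A := d 0 + K * M; have A0 : 0 <= A by rewrite addr_ge0// mulr_ge0.
exists (K * (2 * A) + C * (2 * M)); first by rewrite addr_ge0// !mulr_ge0.
move=> y z Hy Hz; set s := \sum_i _.
have ys : `|y - z| <= s.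
  apply: mx_norm_le => [|i]; first exact: sumr_ge0.
  by rewrite !mxE /s (bigD1 i)//= lerDl sumr_ge0.
have s0 : 0 <= s by apply: sumr_ge0.
have H1 : `|d y ^+ 2 - d z ^+ 2| <= K * (2 * A) * s.
  rewrite subr_sqr normrM mulrAC; apply: ler_pM => //.
    by apply: le_trans (HK _ _) _; rewrite ler_wpM2l.
  rewrite ger0_norm ?addr_ge0//.
  by have := cubeM y Hy; have := cubeM z Hz; rewrite -/A; lra.
have H2 : `|dotr y y - dotr z z| <= 2 * M * s.
  rewrite /dotr -sumrB; apply: le_trans (ler_norm_sum _ _ _) _.
  rewrite mulr_sumr; apply: ler_sum => i _.
  rewrite -!expr2 subr_sqr normrM mulrC ler_wpM2r//.
  by apply: le_trans (ler_normD _ _) _; have := Hy i; have := Hz i; lra.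
rewrite (_ : _ - _ = (d y ^+ 2 - d z ^+ 2) - C * (dotr y y - dotr z z)); last by ring.
apply: le_trans (ler_normB _ _) _; rewrite mulrDl lerD//.
by rewrite normrM (ger0_norm C0) -mulrA ler_wpM2l.
Qed.

(** On a compact set the squared distance is approximated from below by smooth
    functions together with its partial derivatives: subtract a paraboloid to get
    a concave function, take Bernstein polynomials, add the paraboloid back. *)
Lemma dist_sqr_approximants (K : set 'rV[R]_n) : compact K -> K `<=` Omega ->
  exists delta B : R, exists p : nat -> 'rV[R]_n -> R,
  [/\ 0 < delta, forall m k, class_C k setT (p m),
    forall m x, K x -> delta <= p m x <= d x ^+ 2,
    forall x, K x -> (fun m => p m x) @ \oo --> d x ^+ 2 &
    forall x i, K x -> (forall m, `|partial i (p m) x| <= B) /\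
      (derivable d x (delta_mx ord0 i) ->
       (fun m => partial i (p m) x) @ \oo --> 2 * d x * partial i d x)].
Proof.
move=> cK KO; have [C C0 cq] := dist_sqr_semiconcave hF B0; rewrite -/d in cq.
have cd := dist_continuous hF B0.
have [M M0 HM] := compact_cube cK.
have [L L0 HL] := semiconcave_lipschitz_cube (ltW M0) C0.
pose q x := d x ^+ 2 - C * dotr x x.
have [delta delta0 Hdelta] : exists2 a, 0 < a & forall x, K x -> 2 * a <= d x ^+ 2.
  have [K0|/set0P/negP/negPn/eqP ->] := pselect (K !=set0); last by exists 1.
  have [c /set_mem Kc Hc] := EVT_min_rV K0 cK (continuous_subspaceT cd).
  have dc : 0 < d c by apply: dist_gt0 => //; exact: KO.
  exists (d c ^+ 2 / 2); first by rewrite divr_gt0// exprn_gt0.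
  move=> x Kx; rewrite mulrC divfK ?pnatr_eq0//.
  by rewrite lerXn2r ?nnegrE ?(dist_ge0 hF B0)//; apply: Hc; rewrite inE.
pose e m : R := delta / 2 * m.+1%:R^-1.
have e0 m : 0 < e m by rewrite mulr_gt0 ?divr_gt0// invr_gt0 ltr0n.
have ed m : e m <= delta / 2.
  rewrite ler_piMr//; first by rewrite divr_ge0// ltW.
  by rewrite invf_le1 ?ltr0n// ler1n.
have ecvg : e @ \oo --> 0.
  rewrite -(mulr0 (delta / 2)); apply: cvgMr; exact: cvg_harmonic.
have /choice[g Hg] : forall m, exists g : 'rV[R]_n -> R, [/\ forall k, class_C k setT g,
    forall x, cube M x -> `|g x - q x| <= e m &
    forall i x, cube M x -> forall h : R, cube M (x + h *: delta_mx ord0 i) ->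
      g (x + h *: delta_mx ord0 i) <= g x + h * partial i g x].
  by move=> m; exact: (smooth_concave_approx M0 L0 (e0 m) cq HL).
have KM x : K x -> cube M x.
  by move=> Kx i; apply: le_trans (HM x Kx i); rewrite lerDl.
have Cdot k : class_C k setT (fun x : 'rV[R]_n => dotr x x).
  apply: class_C_sum; first exact: openT.
  by move=> i; apply: class_CM; [exact: openT| |]; apply: class_C_coord; exact: openT.
pose p m x := g m x + C * dotr x x - e m.
have Cp m k : class_C k setT (p m).
  have [Cg _ _] := Hg m.
  apply: class_CB; [exact: openT| |exact: class_C_cst].
  apply: class_CD; [exact: openT|exact: Cg|].
  by apply: class_CM; [exact: openT|exact: class_C_cst|exact: Cdot].
have dp m i x : partial i (p m) x = partial i (g m) x + C * (2 * x ord0 i).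
  apply: partial_is_derive; have [Cg _ _] := Hg m.
  have D := is_deriveB (is_deriveD (class_C_derive i (I : setT x) (Cg 1%N))
    (is_deriveZ C (is_derive_dotr x i))) (is_derive_cst (e m) x (delta_mx ord0 i)).
  by apply: (is_derive_eq D); rewrite subr0.
have pP m x : cube M x -> d x ^+ 2 - 2 * e m <= p m x <= d x ^+ 2.
  move=> Hx; have [_ /(_ x Hx) + _] := Hg m.
  rewrite ler_norml /p /q => /andP[H1 H2]; apply/andP; split; lra.
exists delta, (L + delta + C * (2 * M)), p; split => //.
- move=> m x Kx; have /andP[p1 ->] := pP m x (KM x Kx); rewrite andbT.
  by apply: le_trans p1; have := Hdelta x Kx; have := ed m; lra.
- move=> x Kx; apply/cvgrPdist_le => a a0.
  near=> m.
  have em : 2 * e m <= a.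
    have : `|0 - e m| <= a / 2.
      by near: m; move/cvgrPdist_le : ecvg; apply; rewrite divr_gt0.
    by rewrite sub0r normrN gtr0_norm//; lra.
  have /andP[p1 p2] := pP m x (KM x Kx).
  by rewrite ler_norml; apply/andP; split; lra.
- move=> x i Kx; split=> [m|/derivableP D1].
    have [_ gq gt] := Hg m; rewrite dp.
    have Hc := KM x Kx.
    have H (h : R) : `|h| = 1 -> cube M (x + h *: delta_mx ord0 i) /\
        `|q (x + h *: delta_mx ord0 i) - q x| <= L.
      move=> h1; have Hh : cube M (x + h *: delta_mx ord0 i).
        move=> j; rewrite !mxE eqxx/=; apply: le_trans (HM x Kx j).
        apply: le_trans (ler_normD _ _) _; rewrite lerD2l.
        by case: eqP; rewrite ?mulr1 ?h1// mulr0 normr0.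
      split=> //; apply: le_trans (HL _ _ Hh Hc) _.
      rewrite -[leRHS]mulr1 ler_wpM2l// (bigD1 i)//= big1 => [|j ji].
        by rewrite addr0 !mxE !eqxx/= mulr1 addrAC subrr add0r h1.
      by rewrite !mxE eqxx (negbTE ji)/= mulr0 addr0 subrr normr0.
    have [c1 q1] := H 1 (normr1 _); have [c2 q2] := H (-1) (normrN1 _).
    have t1 := gt i x Hc _ c1; have t2 := gt i x Hc _ c2.
    have g0 := gq x Hc; have g1 := gq _ c1; have g2 := gq _ c2.
    have xi : `|C * (2 * x ord0 i)| <= C * (2 * M).
      by rewrite normrM (ger0_norm C0) ler_wpM2l// normrM normr_nat ler_wpM2l.
    have := ed m; move: q1 q2 t1 t2 g0 g1 g2 xi.
    rewrite !ler_norml; set a := partial _ _ _.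
    set b := g m (x + 1 *: _); set c := g m (x + -1 *: _).
    set b' := q (x + 1 *: _); set c' := q (x + -1 *: _).
    move=> /andP[? ?] /andP[? ?] ? ? /andP[? ?] /andP[? ?] /andP[? ?] /andP[? ?] ?.
    by apply/andP; split; lra.
  have D2 := is_deriveB (is_deriveM D1 D1) (is_deriveZ C (is_derive_dotr x i)).
  have D3 : is_derive x (delta_mx ord0 i) q (2 * d x * partial i d x - C * (2 * x ord0 i)).
    have D4 : is_derive x (delta_mx ord0 i) q _ := D2.
    by apply: (is_derive_eq D4); rewrite /GRing.scale/= /partial; ring.
  have H := concave_partial_cvg ecvg (fun m => let: And3 _ gq _ := Hg m in gq)
    (fun m => let: And3 _ _ gt := Hg m in gt i) (HM x Kx) D3.
  rewrite (_ : (fun m => _) = (fun m => partial i (g m) x + C * (2 * x ord0 i))).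
    rewrite -[2 * d x * _](subrK (C * (2 * x ord0 i))).
    by apply: cvgD => //; exact: cvg_cst.
  by apply/funext => m; rewrite dp.
Unshelve. all: by end_near. Qed.

End approximants.

(** * The inequality for test functions *)

Section hardy_test.
Context (R : realType) (n : nat) (F : 'rV[R]_n -> R) (Omega : set 'rV[R]_n).
Hypothesis hF : strongly_convex_norm F.
Hypothesis B0 : boundary Omega !=set0.
Hypothesis oO : open Omega.
Hypothesis hb : has_ubound [set dist_F F Omega x | x in Omega].
Implicit Types (x y z : 'rV[R]_n) (phi : 'rV[R]_n -> R).

Let d := dist_F F Omega.
Let S := sup [set d x | x in Omega].
Let D := expR 1 * S.

(** [f'' = - hardy_weight f] for [f(t) = sqrt (t log (a / t))]; against [u ^ 2] it is
    the sum of the two zero-order terms of the inequality. *)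
Definition hardy_weight (a t : R) : R := (4 * t ^+ 2)^-1 * (1 + (ln (a / t)) ^- 2).

Lemma dist_le_sup x : Omega x -> d x <= S.
Proof.
move=> Ox; apply: sup_upper_bound; last by exists x.
by split=> //; exists (d x), x.
Qed.

Lemma sup_dist_gt0 : 0 < S.
Proof.
have [y [cy _]] := B0; have [x [Ox _]] := cy _ filterT.
by apply: lt_le_trans (dist_le_sup Ox); exact: dist_gt0.
Qed.

Lemma D_gt0 : 0 < D.
Proof. by rewrite mulr_gt0 ?expR_gt0 ?sup_dist_gt0. Qed.

(** The factor [expR 1] in [D] is what makes the logarithm at least 1, hence the
    multiplier nonnegative. *)
Lemma logd_dist x (s : R) : Omega x -> 0 < s -> s <= d x ^+ 2 -> 1 <= logd D s.
Proof.
move=> Ox s0 sd; apply: (logd_ge1 s0 sup_dist_gt0) => //.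
apply: le_trans sd _; rewrite lerXn2r ?nnegrE ?(dist_ge0 hF B0) ?(ltW sup_dist_gt0)//.
exact: dist_le_sup.
Qed.

Lemma logd_gt0 (s : R) : 0 < s -> s < D ^+ 2 -> 0 < logd D s.
Proof.
move=> s0 sD; rewrite /logd; have : ln s < ln (D ^+ 2).
  by rewrite ltr_ln ?posrE// exprn_gt0// D_gt0.
by rewrite lnXn ?D_gt0// -[_ *+ 2]mulr_natr; lra.
Qed.

Lemma dist_sqr_ltD x : Omega x -> d x ^+ 2 < D ^+ 2.
Proof.
move=> Ox; rewrite ltrXn2r ?nnegrE ?(dist_ge0 hF B0) ?(ltW D_gt0)//.
apply: le_lt_trans (dist_le_sup Ox) _.
by rewrite -[ltLHS]mul1r ltr_pM2r ?sup_dist_gt0// expR_gt1.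
Qed.

Section cutoff.
Variables (phi p : 'rV[R]_n -> R).
Hypothesis tphi : test_function Omega phi.
Hypothesis Cp : forall k, class_C k setT p.
Let K := closure [set x | phi x != 0].
Hypothesis pK : forall x, K x -> 0 < p x < D ^+ 2.

Let U := [set x | 0 < p x < D ^+ 2].

(** Smooth on the whole space: on a neighbourhood of the support of [phi] the
    multiplier is evaluated inside its domain, and elsewhere [phi] vanishes. *)
Definition cutoff x := phi x ^+ 2 * mult D (p x).

Lemma open_U : open U.
Proof.
rewrite openE => x Ux.
have cp := class_C_continuous (I : setT x) (Cp 0%N).
have : nbhs (p x) [set` `]0, D ^+ 2[].
  by apply: open_nbhs_nbhs; split; [exact: interval_open|rewrite /= in_itv].
move=> /cp H; apply: (@filterS _ (nbhs x) _ (p @^-1` [set` `]0, D ^+ 2[])) => //.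
Qed.

Lemma phi_supp x : ~ K x -> phi x = 0.
Proof.
move=> nK; apply/eqP; apply/negP => /negP p0; apply: nK.
exact: subset_closure.
Qed.

Lemma open_suppC : open (~` K).
Proof. by apply: closed_openC; exact: closed_closure. Qed.

Lemma class_C_cutoff k : class_C k setT cutoff.
Proof.
have [Cphi _ _] := tphi.
apply: (@class_C_subset _ _ _ _ (U `|` ~` K)).
  by move=> x _; have [/pK|] := pselect (K x); [left|right].
apply: class_CU.
  apply: class_CM; first exact: open_U.
    apply: (class_C_ext open_U (f := fun x => phi x * phi x)).
      by move=> x _; rewrite expr2.
    by apply: class_CM; [exact: open_U| |];
      apply: (class_C_subset (@subsetT _ _)); exact: Cphi.
  apply: class_C_mult; first exact: open_U.
    by move=> x /andP[p0 p1]; split=> //; rewrite gt_eqF// logd_gt0.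
  by apply: (class_C_subset (@subsetT _ _)); exact: Cp.
apply: (class_C_ext open_suppC (f := fun=> 0)); last exact: class_C_cst.
by move=> x /phi_supp p0; rewrite /cutoff p0 expr0n/= mul0r.
Qed.

Lemma test_cutoff : test_function Omega cutoff.
Proof.
have [_ cK KO] := tphi.
have sub : closure [set x | cutoff x != 0] `<=` K.
  apply: closure_subset => x /=; apply: contra => /eqP p0.
  by rewrite /cutoff p0 expr0n/= mul0r.
split; first exact: class_C_cutoff.
  by apply: subclosed_compact cK sub; exact: closed_closure.
exact: subset_trans KO.
Qed.

Lemma partial_cutoff i x : K x -> partial i cutoff x =
  2 * phi x * partial i phi x * mult D (p x) +
  phi x ^+ 2 * (dmult D (p x) * partial i p x).
Proof.
move=> Kx; have [Cphi _ _] := tphi.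
have /andP[p0 p1] := pK Kx.
apply: partial_is_derive.
have D1 := class_C_derive i (I : setT x) (Cphi 1%N).
have D2 := is_derive_mult p0 (lt0r_neq0 (logd_gt0 p0 p1)).
have D3 := is_derive_chain (class_C_derive i (I : setT x) (Cp 1%N)) D2.
have D4 : is_derive x (delta_mx ord0 i) cutoff _ := is_deriveM (is_deriveM D1 D1) D3.
apply: (is_derive_eq D4); rewrite /GRing.scale/=.
rewrite -[(phi * phi) x]/(phi x * phi x); ring.
Qed.

Lemma partial_cutoff0 i x : ~ K x -> partial i cutoff x = 0.
Proof.
move=> nKx; apply: partial_is_derive.
apply: (near_eq_is_derive (f := fun=> 0)).
  apply: (near_open_eq open_suppC) nKx => y nKy.
  by rewrite /cutoff (phi_supp nKy) expr0n/= mul0r.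
Qed.

End cutoff.

Hypothesis hsuper : superharmonic F Omega d.

Lemma measurable_dist_weight : measurable_fun Omega (fun x => hardy_weight D (d x)).
Proof.
apply: open_continuous_measurable_fun_rV => // x Ox.
have d0 : 0 < d x by exact: dist_gt0.
have cd : {for x, continuous d} by exact: dist_continuous.
have cst (a : R) : {for x, continuous (fun _ : 'rV[R]_n => a)} by exact: cst_continuous.
have cdi : {for x, continuous (fun x => (d x)^-1)}.
  exact: cvgV (lt0r_neq0 d0) cd.
have c2 : {for x, continuous (fun x => d x ^+ 2)}.
  rewrite (_ : (fun x => _) = d \* d); first exact: (cvgM cd cd).
  by apply/funext => y; rewrite expr2.
have L1 : 1 <= ln (D / d x).
  by rewrite -logd_sqr ?D_gt0//; apply: logd_dist Ox _ _ => //; rewrite exprn_gt0.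
have cl : {for x, continuous (fun x => ln (D / d x))}.
  apply: (@continuous_comp _ _ _ (fun x => D / d x) (@ln R)); first exact: (cvgM (cst D) cdi).
  by apply: continuous_ln; rewrite divr_gt0// D_gt0.
have cl2 : {for x, continuous (fun x => ln (D / d x) ^+ 2)}.
  rewrite (_ : (fun x => _) = (fun x => ln (D / d x)) \* (fun x => ln (D / d x))).
    exact: (cvgM cl cl).
  by apply/funext => y; rewrite expr2.
have n2 : ln (D / d x) ^+ 2 != 0 by rewrite expf_neq0// gt_eqF//; lra.
have n3 : 4 * d x ^+ 2 != 0 by rewrite mulf_neq0 ?pnatr_eq0// expf_neq0// gt_eqF.
exact: (cvgM (cvgV n3 (cvgM (cst 4) c2)) (cvgD (cst 1) (cvgV n2 cl2))).
Qed.

Lemma hardy_weight_ge0 x : 0 <= hardy_weight D (d x).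
Proof.
rewrite /hardy_weight mulr_ge0//; first by rewrite invr_ge0 mulr_ge0// sqr_ge0.
by rewrite addr_ge0// invr_ge0 sqr_ge0.
Qed.

(** The equation [- f'' = hardy_weight f] rewritten for the logarithmic derivative of
    [f]. The factor [2 t] comes from writing the latter as a function of [t ^ 2]. *)
Lemma riccati (t : R) : 0 < t -> ln (D / t) != 0 ->
  - 2 * t * dmult D (t ^+ 2) - mult D (t ^+ 2) ^+ 2 = hardy_weight D t.
Proof.
move=> t0 L0; rewrite /dmult /mult /hardy_weight invd_sqr// logd_sqr ?D_gt0//.
by field; rewrite L0 gt_eqF.
Qed.


Lemma cvg_sum_ord (f : 'I_n -> R^nat) (l : 'I_n -> R) :
  (forall i, f i @ \oo --> l i) -> (fun m => \sum_i f i m) @ \oo --> \sum_i l i.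
Proof.
move=> Hf; rewrite (_ : (fun m => _) = \sum_i f i); last first.
  by apply/funext => m; rewrite fct_sumE.
by apply: (big_ind2 (fun F (a : R) => F @ \oo --> a)) => [|F1 a1 F2 a2 ? ?|i _];
  [exact: cvg_cst|exact: cvgD|exact: Hf].
Qed.

(** Hardy's inequality for a test function [phi]. Superharmonicity is tested on
    [phi ^ 2 G (p m)] for smooth [p m] approximating [d ^ 2]; in the limit the
    integrand becomes [Wl], whose integral is thus nonnegative, and completing the
    square bounds [F (grad phi) ^ 2] below by [Wl + phi ^ 2 w], with [w] the weight,
    wherever the eikonal inequality [1 <= F (grad d)] holds. *)
Lemma hardy_test phi : test_function Omega phi ->
  (\int[leb R n]_(x in Omega) (phi x ^+ 2 * hardy_weight D (d x))%:E <=
   \int[leb R n]_(x in Omega) (F (gradient phi x) ^+ 2)%:E)%E.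
Proof.
move=> tphi; have [Cphi cK KO] := tphi.
set K := closure [set x | phi x != 0] in cK KO.
have [delta [B [p [delta0 Cp pd pcv dp]]]] := dist_sqr_approximants hF B0 oO cK KO.
have [N HN dN] := dist_exceptional_set hF B0 oO.
pose NN := \big[setU/set0]_i N i.
have [mNN NN0] : measurable NN /\ leb R n NN = 0%E.
  apply: (big_ind (fun A => measurable A /\ leb R n A = 0%E)).
  - by split=> //; exact: measure0.
  - move=> A A' [mA A0] [mA' A'0]; split; first exact: measurableU.
    exact: null_set_setU.
  - by move=> i _; exact: HN.
have NNi i x : ~ NN x -> ~ N i x.
  by move=> nN Ni; apply: nN; rewrite /NN (bigD1 i)//=; left.
(* Integrands with a factor [phi] live on [E] up to a null set, and every partial
   derivative of [d] exists there. *)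
pose E := K `\` NN.
have mK : measurable K by apply: closed_measurable_rV; exact: closed_closure.
have mO := open_measurable_rV oO.
have mE : measurable E by exact: measurableD.
have EO : E `<=` Omega by move=> x [/KO].
have EK x : E x -> K x by case.
have finE : (leb R n E < +oo)%E.
  apply: le_lt_trans (leb_bounded mK (compact_bounded cK)).
  by apply: le_measure; rewrite ?inE.
have dE x i : E x -> derivable d x (delta_mx ord0 i).
  by move=> Ex; apply/(dN i x (EO x Ex)); apply: NNi; case: Ex.
have d0 x : Omega x -> 0 < d x by move=> Ox; exact: dist_gt0.
pose om x := gradient d x.
have mom : measurable_fun Omega om.
  apply: measurable_fun_rV_on => i; apply: (eq_measurable_fun (partial i d)).
    by move=> x _; rewrite mxE.
  exact: measurable_partial_dist.
pose Vf i x := flux F i (om x).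
have mV i : measurable_fun Omega (Vf i) by exact: measurableT_comp (measurable_flux hF i) mom.
have omE x : E x -> 1 <= F (om x).
  by move=> Ex; apply: dist_eikonal => // [|i]; [exact: EO|exact: dE].
have pK m x : K x -> 0 < p m x < D ^+ 2.
  move=> Kx; have /andP[p1 p2] := pd m x Kx.
  rewrite (lt_le_trans delta0 p1)/=; apply: le_lt_trans p2 _.
  by apply: dist_sqr_ltD; exact: KO.
have mb m x : K x -> 0 <= mult D (p m x) <= invd delta /\ `|dmult D (p m x)| <= invd delta ^+ 3.
  move=> Kx; have /andP[p1 p2] := pd m x Kx.
  apply: mult_bounds => //; apply: logd_dist p2; first exact: KO.
  exact: lt_le_trans p1.
pose psi m := cutoff phi (p m).
have tpsi m : test_function Omega (psi m) by exact: (test_cutoff tphi (Cp m) (pK m)).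
have psi0 m x : 0 <= psi m x.
  rewrite /psi /cutoff; have [Kx|nKx] := pselect (K x).
    by have [/andP[? _] _] := mb m x Kx; rewrite mulr_ge0// sqr_ge0.
  by rewrite (phi_supp nKx) expr0n/= mul0r.
pose W m x := \sum_i Vf i x * partial i (psi m) x.
have mpart (f : 'rV[R]_n -> R) i : (forall k, class_C k setT f) -> continuous (partial i f).
  by move=> Cf x; exact: (class_C_continuous (I : setT x) (class_C_partial i (Cf 1%N))).
have mcont (A : set 'rV[R]_n) (f : 'rV[R]_n -> R) : continuous f -> measurable_fun A f.
  move=> cf; apply: (@measurable_funS _ _ _ _ setT) => //.
  exact: continuous_measurable_fun_rV.
have cphi : continuous phi.
  by move=> x; exact: (class_C_continuous (I : setT x) (Cphi 0%N)).
have mW m : measurable_fun Omega (W m).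
  apply: measurable_sum => i; apply: measurable_funM => //.
  by apply: mcont; apply: mpart; case: (tpsi m).
have W_ge0 m : (0 <= \int[leb R n]_(x in E) (W m x)%:E)%E.
  have := hsuper (tpsi m) (psi0 m).
  rewrite (_ : (fun x => _) = (fun x => (W m x)%:E)); last first.
    apply/funext => x; congr EFin; rewrite /W /dotr mulr_sumr.
    by apply: eq_bigr => i _; rewrite /Vf /flux mulrA [gradient (psi m) x _ _]mxE.
  rewrite (@integral_null_support R _ _ (leb R n) Omega E NN)//.
    exact/measurable_EFinP.
  move=> x Ox nEx nNx; congr EFin; rewrite /W big1// => i _.
  by rewrite partial_cutoff0 ?mulr0// => Kx; apply: nEx.
pose Wl x := 2 * phi x * mult D (d x ^+ 2) *
    (F (om x) * dotr (gradient F (om x)) (gradient phi x)) +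
  phi x ^+ 2 * dmult D (d x ^+ 2) * (2 * d x) * F (om x) ^+ 2.
have Wcv x : E x -> W ^~ x @ \oo --> Wl x.
  move=> Ex; have Kx := EK x Ex; have Ox := EO x Ex.
  have dx2 : 0 < d x ^+ 2 by rewrite exprn_gt0// d0.
  have L0 : logd D (d x ^+ 2) != 0.
    by rewrite gt_eqF// (lt_le_trans ltr01)//; exact: logd_dist Ox dx2 _.
  have [cm cdm] := mult_cvg dx2 L0 (pcv x Kx).
  have om0 : om x != 0.
    by apply/eqP => om0; have := omE x Ex; rewrite om0 (norm0 hF) ler10.
  rewrite (_ : W ^~ x = (fun m => \sum_i Vf i x * (2 * phi x * partial i phi x * mult D (p m x) +
      phi x ^+ 2 * (dmult D (p m x) * partial i (p m) x)))); last first.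
    by apply/funext => m; apply: eq_bigr => i _; rewrite (partial_cutoff tphi (Cp m) (pK m)).
  rewrite (_ : Wl x = \sum_i Vf i x * (2 * phi x * partial i phi x * mult D (d x ^+ 2) +
      phi x ^+ 2 * (dmult D (d x ^+ 2) * (2 * d x * partial i d x)))).
    apply: cvg_sum_ord => i; apply: cvgMr; apply: cvgD; first exact: cvgMr.
    by apply: cvgMr; apply: cvgM => //; apply: (dp x i Kx).2; exact: dE.
  rewrite /Wl -[F (om x) ^+ 2]/(F (om x) * F (om x)) -{3}(gradient_norm_euler hF om0).
  rewrite /dotr !mulr_sumr -big_split; apply: eq_bigr => i _ /=.
  by rewrite [gradient phi x _ _]mxE [om x _ _]mxE /Vf /flux; ring.
(* The partial derivatives of [p m] are bounded uniformly in [m] on [K]. *)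
have [c Wc] : exists c, forall m x, E x -> `|W m x| <= c.
  have [Kd Kd0 HKd] := partial_dist_bound hF B0.
  have [M0 M00 HM0] := compact_fun_bound cK cphi.
  have /choice[M1 HM1] : forall i, exists M, 0 <= M /\ forall x, K x -> `|partial i phi x| <= M.
    by move=> i; have [M ? ?] := compact_fun_bound cK (mpart phi i Cphi); exists M.
  pose cV := norm_basis F * Kd * norm_basis F.
  exists (\sum_i cV * (2 * M0 * M1 i * invd delta + M0 ^+ 2 * (invd delta ^+ 3 * `|B|))).
  move=> m x Ex; have Kx := EK x Ex.
  apply: le_trans (ler_norm_sum _ _ _) _; apply: ler_sum => i _.
  rewrite normrM; apply: ler_pM => //.
    by apply: flux_bound => // j; rewrite mxE; apply: HKd; exact: dE.
  have [/andP[m0 m1] dm1] := mb m x Kx; have [M10 HM1i] := HM1 i.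
  rewrite (partial_cutoff tphi (Cp m) (pK m))//; apply: le_trans (ler_normD _ _) _.
  have hp := HM0 x Kx; have hpi := HM1i x Kx.
  have hB : `|partial i (p m) x| <= `|B|.
    by apply: le_trans (ler_norm _); apply: (dp x i Kx).1.
  move: (mult _ _) (dmult _ _) (invd _) (partial i (p m) x) m0 m1 dm1 hB => G G' r q m0 m1 dm1 hB.
  have r0 : 0 <= r by exact: le_trans m1.
  apply: lerD.
    rewrite !normrM normr_nat (ger0_norm m0).
    by repeat apply: ler_pM; rewrite ?mulr_ge0.
  rewrite !normrM -expr2; apply: ler_pM; rewrite ?mulr_ge0 ?sqr_ge0//.
    by rewrite lerXn2r ?nnegrE.
  by apply: ler_pM.
have mWE m : measurable_fun E (W m) by exact: measurable_funS mO EO (mW m).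
have mWl : measurable_fun E Wl by apply: measurable_fun_cvg mWE Wcv.
have bint (f : 'rV[R]_n -> R) a : measurable_fun E f -> (forall x, E x -> `|f x| <= a) ->
    (leb R n).-integrable E (EFin \o f).
  move=> mf fa; apply: measurable_bounded_integrable => //.
  exists `|a|; split=> [|M aM x Ex]; first exact: num_real.
  by apply: le_trans (fa x Ex) _; apply: le_trans (ler_norm a) (ltW aM).
have ic : (leb R n).-integrable E (EFin \o (fun _ : 'rV[R]_n => c)).
  by apply: (bint _ `|c|) => //; exact: measurable_cst.
have aecv : {ae leb R n, forall x, E x -> (W m x)%:E @[m --> \oo] --> (Wl x)%:E}.
  apply: aeW => x Ex; apply: cvg_EFin; last exact: Wcv.
  exact: nearW.
have aebd : {ae leb R n, forall x m, E x -> (`|(W m x)%:E| <= (EFin \o fun _ : 'rV[R]_n => c) x)%E}.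
  by apply: aeW => x m Ex; rewrite /= lee_fin; exact: Wc.
have [iWl _ cvW] := dominated_convergence mE
  (fun m => (measurable_EFinP _ _).2 (mWE m)) ((measurable_EFinP _ _).2 mWl) aecv ic aebd.
have Wl_ge0 : (0 <= \int[leb R n]_(x in E) (Wl x)%:E)%E.
  rewrite -(cvg_lim _ cvW)//; apply: lime_ge; first by apply/cvg_ex; eexists; exact: cvW.
  by apply: nearW => m; exact: W_ge0.
have mG : measurable_fun setT (fun x => F (gradient phi x) ^+ 2).
  apply: measurable_funX.
  apply: (measurableT_comp (continuous_measurable_fun_rV (norm_continuous_rV hF))).
  apply: measurable_fun_rV_on => i; apply: (eq_measurable_fun (partial i phi)).
    by move=> x _; rewrite mxE.
  by apply: mcont; exact: mpart.
have mGE A : measurable A -> measurable_fun A (fun x => F (gradient phi x) ^+ 2).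
  by move=> mA; exact: measurable_funS mG.
have [M1 M10 HM1] : exists2 M, 0 <= M & forall x, K x -> F (gradient phi x) <= M.
  have /choice[M1 HM1] : forall i, exists M, 0 <= M /\ forall x, K x -> `|partial i phi x| <= M.
    by move=> i; have [M ? ?] := compact_fun_bound cK (mpart phi i Cphi); exists M.
  have s0 i : 0 <= M1 i by case: (HM1 i).
  exists (norm_basis F * \sum_i M1 i).
    by rewrite mulr_ge0 ?norm_basis_ge0// sumr_ge0.
  move=> x Kx; apply: norm_le_basis => // i; rewrite mxE.
  have [_ H] := HM1 i; apply: le_trans (H x Kx) _.
  by rewrite (bigD1 i)//= lerDl sumr_ge0.
have iG : (leb R n).-integrable E (EFin \o (fun x => F (gradient phi x) ^+ 2)).
  apply: (bint _ (M1 ^+ 2)); first exact: mGE.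
  move=> x Ex; rewrite ger0_norm ?sqr_ge0// lerXn2r ?nnegrE ?(norm_ge0 hF)//.
  by apply: HM1; exact: EK.
have mw : measurable_fun Omega (fun x => phi x ^+ 2 * hardy_weight D (d x)).
  apply: measurable_funM; last exact: measurable_dist_weight.
  by apply: measurable_funX; exact: mcont.
rewrite (@integral_null_support R _ _ (leb R n) Omega E NN)//; last 2 first.
- exact/measurable_EFinP.
- move=> x Ox nEx nNx; congr EFin.
  by rewrite (phi_supp (x := x)) ?expr0n/= ?mul0r// => Kx; apply: nEx.
apply: (@le_trans _ _ (\int[leb R n]_(x in E) (F (gradient phi x) ^+ 2 - Wl x)%:E)%E).
  apply: ge0_le_integral => //.
  - by move=> x Ex; rewrite lee_fin mulr_ge0 ?sqr_ge0 ?hardy_weight_ge0.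
  - by apply/measurable_EFinP; exact: measurable_funS mO EO mw.
  - by apply/measurable_EFinP; apply: measurable_funB => //; exact: mGE.
  move=> x Ex; rewrite lee_fin lerBrDr; have Ox := EO x Ex.
  have dx0 := d0 x Ox; have dx2 : 0 < d x ^+ 2 by rewrite exprn_gt0.
  have L0 : ln (D / d x) != 0.
    by rewrite -logd_sqr ?D_gt0// gt_eqF// (lt_le_trans ltr01)//; exact: logd_dist Ox dx2 _.
  have := norm_square_completion hF (om x) (gradient phi x) (phi x * mult D (d x ^+ 2)).
  apply: le_trans; rewrite -(riccati dx0 L0) /Wl.
  have w0 := hardy_weight_ge0 x; rewrite -(riccati dx0 L0) in w0.
  have F1 : 1 <= F (om x) ^+ 2 by rewrite exprn_ege1// omE.
  have : phi x ^+ 2 * (- 2 * d x * dmult D (d x ^+ 2) - mult D (d x ^+ 2) ^+ 2) * 1 <=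
      phi x ^+ 2 * (- 2 * d x * dmult D (d x ^+ 2) - mult D (d x ^+ 2) ^+ 2) * F (om x) ^+ 2.
    by apply: ler_wpM2l => //; rewrite mulr_ge0// sqr_ge0.
  move: (F (om x)) (dotr _ _) (mult _ _) (dmult _ _) => a b G G' H.
  by rewrite -subr_ge0; rewrite -subr_ge0 in H; apply: le_trans H _; apply: eq_ler; ring.
under eq_integral do rewrite EFinB.
rewrite integralB_EFin//; apply: (@le_trans _ _ (\int[leb R n]_(x in E) (F (gradient phi x) ^+ 2)%:E)%E).
  by rewrite leeBlDr ?leeDl//; exact: (integrable_fin_num mE iWl).
apply: ge0_subset_integral => //.
  by apply/measurable_EFinP; exact: mGE.
by move=> x _; rewrite lee_fin sqr_ge0.
Qed.

End hardy_test.

(** * Passage to H_0^1 *)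

Section integral_comparison.
Context d (T : measurableType d) (R : realType) (mu : {measure set T -> \bar R}).
Variables (A : set T) (mA : measurable A).
Implicit Types (f g h : T -> R).

Lemma sqrD_le (x y e : R) : 0 < e ->
  (x + y) ^+ 2 <= (1 + e) * x ^+ 2 + (1 + e^-1) * y ^+ 2.
Proof.
move=> e0; rewrite -subr_ge0.
rewrite (_ : _ - _ = e^-1 * (e * x - y) ^+ 2); last by field; rewrite gt_eqF.
by rewrite mulr_ge0 ?sqr_ge0// invr_ge0 ltW.
Qed.

Lemma integral_le_comb f g h (a b : R) : 0 <= a -> 0 <= b ->
  measurable_fun A f -> measurable_fun A g -> measurable_fun A h ->
  (forall x, A x -> 0 <= f x) -> (forall x, A x -> 0 <= g x) ->
  (forall x, A x -> 0 <= h x) ->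
  (forall x, A x -> f x <= a * g x + b * h x) ->
  (\int[mu]_(x in A) (f x)%:E <=
   a%:E * \int[mu]_(x in A) (g x)%:E + b%:E * \int[mu]_(x in A) (h x)%:E)%E.
Proof.
move=> a0 b0 mf mg mh f0 g0 h0 fgh.
have eg x : A x -> (0 <= (g x)%:E)%E by move=> Ax; rewrite lee_fin g0.
have eh x : A x -> (0 <= (h x)%:E)%E by move=> Ax; rewrite lee_fin h0.
have Mf : measurable_fun A (EFin \o f) by exact/measurable_EFinP.
have Mg : measurable_fun A (EFin \o g) by exact/measurable_EFinP.
have Mh : measurable_fun A (EFin \o h) by exact/measurable_EFinP.
rewrite -ge0_integralZl_EFin// -[X in (_ <= _ + X)%E]ge0_integralZl_EFin//.
rewrite -ge0_integralD//; last 4 first.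
- by move=> x Ax; rewrite mule_ge0 ?eg.
- exact: measurable_funeM.
- by move=> x Ax; rewrite mule_ge0 ?eh.
- exact: measurable_funeM.
apply: ge0_le_integral => //.
- by apply: emeasurable_funD; exact: measurable_funeM.
Qed.

Lemma lee_sqr_perturbation (x y : \bar R) : (0 <= y < +oo)%E ->
  (forall e : R, 0 < e -> (x <= ((1 + e) ^+ 2)%:E * y)%E) -> (x <= y)%E.
Proof.
move: y => [r| |]; rewrite ?ltxx ?andbF//; rewrite lee_fin ltry andbT => r0 H; apply/lee_addgt0Pr => e e0.
pose s := Num.min 1 (e / (3 * (r + 1))).
have q0 : 0 < 3 * (r + 1) by rewrite mulr_gt0// ltr_wpDl.
have s0 : 0 < s by rewrite lt_min ltr01 divr_gt0.
have s1 : s <= 1 by rewrite ge_min lexx.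
have s2 : s * (3 * (r + 1)) <= e by rewrite -ler_pdivlMr// ge_min lexx orbT.
apply: le_trans (H s s0) _; rewrite -EFinM -EFinD lee_fin.
have : s ^+ 2 * r <= s * r by rewrite ler_wpM2r// expr2 ler_piMl// ltW.
rewrite expr2; nra.
Qed.

End integral_comparison.

Section hardy.
Context (R : realType) (n : nat) (F : 'rV[R]_n -> R) (Omega : set 'rV[R]_n).
Hypothesis hF : strongly_convex_norm F.
Implicit Types (x : 'rV[R]_n).

Lemma measurable_norm_comp (A : set 'rV[R]_n) (G : 'rV[R]_n -> 'rV[R]_n) :
  (forall i, measurable_fun A (fun x => G x ord0 i)) ->
  measurable_fun A (fun x => F (G x) ^+ 2).
Proof.
move=> mG; apply: measurable_funX.
apply: (measurableT_comp (continuous_measurable_fun_rV (norm_continuous_rV hF))).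
exact: measurable_fun_rV_on.
Qed.

Lemma measurable_enorm_sqr (A : set 'rV[R]_n) (G : 'rV[R]_n -> 'rV[R]_n) :
  (forall i, measurable_fun A (fun x => G x ord0 i)) ->
  measurable_fun A (fun x => enorm (G x) ^+ 2).
Proof.
move=> mG; apply: (eq_measurable_fun (fun x => \sum_i G x ord0 i * G x ord0 i)).
  by move=> x _; rewrite enorm_sqr.
by apply: measurable_sum => i; exact: measurable_funM.
Qed.

Lemma norm_sqr_le_enorm x : F x ^+ 2 <= norm_basis F ^+ 2 * enorm x ^+ 2.
Proof.
rewrite -exprMn lerXn2r ?nnegrE ?(norm_ge0 hF) ?norm_le_enorm//.
by rewrite mulr_ge0 ?norm_basis_ge0 ?enorm_ge0.
Qed.

Lemma measurable_test phi : test_function Omega phi -> measurable_fun Omega phi.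
Proof.
move=> [Cphi _ _]; apply: (@measurable_funS _ _ _ _ setT) => //.
apply: continuous_measurable_fun_rV => x.
exact: (class_C_continuous (I : setT x) (Cphi 0%N)).
Qed.

Lemma measurable_gradient_test phi i :
  test_function Omega phi -> measurable_fun Omega (fun x => gradient phi x ord0 i).
Proof.
move=> [Cphi _ _]; apply: (eq_measurable_fun (partial i phi)).
  by move=> x _; rewrite mxE.
apply: (@measurable_funS _ _ _ _ setT) => //.
apply: continuous_measurable_fun_rV => x.
exact: (class_C_continuous (I : setT x) (class_C_partial i (Cphi 1%N))).
Qed.

Lemma energy_finite (u : 'rV[R]_n -> R) Du : open Omega -> H1 Omega u Du ->
  (\int[leb R n]_(x in Omega) (F (Du x) ^+ 2)%:E < +oo)%E.
Proof.
move=> oO [_ L2Du _]; have mO := open_measurable_rV oO.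
have mDu i : measurable_fun Omega (fun x => Du x ord0 i) by case: (L2Du i).
apply: (@le_lt_trans _ _ (\int[leb R n]_(x in Omega)
    ((norm_basis F ^+ 2)%:E * \sum_i (Du x ord0 i ^+ 2)%:E))%E).
  apply: ge0_le_integral => //.
  - by move=> x _; rewrite lee_fin sqr_ge0.
  - by apply/measurable_EFinP; exact: measurable_norm_comp.
  - apply: measurable_funeM; apply: emeasurable_sum => i; apply/measurable_EFinP.
    exact: measurable_funX.
  - move=> x _; rewrite sumEFin -EFinM lee_fin; apply: le_trans (norm_sqr_le_enorm _) _.
    rewrite enorm_sqr; apply: eq_ler; congr (_ * _).
have msq i : measurable_fun Omega (fun x => (Du x ord0 i ^+ 2)%:E).
  by apply/measurable_EFinP; exact: measurable_funX.
have sq0 i x : Omega x -> (0 <= (Du x ord0 i ^+ 2)%:E)%E by rewrite lee_fin sqr_ge0.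
rewrite ge0_integralZl_EFin ?sqr_ge0//; last 2 first.
- by move=> x _; apply: sume_ge0 => i _; rewrite lee_fin sqr_ge0.
- exact: emeasurable_sum.
rewrite ge0_integral_sum//; apply: lte_mul_pinfty; rewrite ?lee_fin ?sqr_ge0//.
by apply: lte_sum_pinfty => i _; case: (L2Du i).
Qed.

Lemma integral_truncation (w u : 'rV[R]_n -> R) (X : \bar R) : measurable Omega ->
  measurable_fun Omega w -> measurable_fun Omega u ->
  (forall x, Omega x -> 0 <= w x) ->
  (forall m : nat, (\int[leb R n]_(x in Omega) (u x ^+ 2 * Num.min (w x) m%:R)%:E <= X)%E) ->
  (\int[leb R n]_(x in Omega) (u x ^+ 2 * w x)%:E <= X)%E.
Proof.
move=> mO mw mu w0 H.
pose g m x := (u x ^+ 2 * Num.min (w x) m%:R)%:E.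
have mg m : measurable_fun Omega (g m).
  apply/measurable_EFinP; apply: measurable_funM; first exact: measurable_funX.
  by apply: measurable_minr => //; exact: measurable_cst.
have g0 m x : Omega x -> (0 <= g m x)%E.
  by move=> Ox; rewrite lee_fin mulr_ge0 ?sqr_ge0// le_min w0//= ler0n.
have nd x : Omega x -> nondecreasing_seq (g ^~ x).
  move=> Ox i j ij; rewrite lee_fin ler_wpM2l ?sqr_ge0// le_min ge_min lexx/=.
  by rewrite ge_min ler_nat ij orbT.
have lg x : Omega x -> limn (g ^~ x) = (u x ^+ 2 * w x)%:E.
  move=> Ox; apply: cvg_lim => //; apply: cvg_near_cst.
  exists (Num.truncn (w x)).+1 => // m /= Hm; rewrite /g min_l//.
  by apply: ltW; apply: lt_le_trans (truncnS_gt _) _; rewrite ler_nat.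
rewrite -(eq_integral _ _ (fun x xO => lg x (set_mem xO))).
rewrite monotone_convergence//; apply: lime_le; last by apply: nearW => m; exact: H.
apply: ereal_nondecreasing_is_cvgn => i j ij; apply: ge0_le_integral => //.
- exact: g0.
- by move=> x Ox; exact: nd.
Qed.

(** Passage from test functions to their closure in the energy norm. The weight
    is truncated at [m] because only a bounded weight makes the weighted integral
    continuous for the [L^2] norm; [m] is released by monotone convergence. *)
Lemma hardy_closure (w : 'rV[R]_n -> R) : open Omega ->
  measurable_fun Omega w -> (forall x, Omega x -> 0 <= w x) ->
  (forall phi, test_function Omega phi ->
     (\int[leb R n]_(x in Omega) (phi x ^+ 2 * w x)%:E <=
      \int[leb R n]_(x in Omega) (F (gradient phi x) ^+ 2)%:E)%E) ->
  forall u Du, H01 Omega u Du ->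
  (\int[leb R n]_(x in Omega) (u x ^+ 2 * w x)%:E <=
   \int[leb R n]_(x in Omega) (F (Du x) ^+ 2)%:E)%E.
Proof.
move=> oO mw w0 Hphi u Du [hu [phi [tphi phiu]]].
have mO := open_measurable_rV oO.
have [[mu _] L2Du _] := hu.
have mDu i : measurable_fun Omega (fun x => Du x ord0 i) by case: (L2Du i).
apply: integral_truncation => // m; apply: lee_sqr_perturbation.
  by rewrite (energy_finite oO hu) integral_ge0// => x _; rewrite lee_fin sqr_ge0.
move=> e e0; have e1 : 0 <= 1 + e by rewrite addr_ge0// ltW.
have e2 : 0 <= 1 + e^-1 by rewrite addr_ge0// invr_ge0 ltW.
set X := (\int[leb R n]_(x in Omega) (F (Du x) ^+ 2)%:E)%E.
set I := (X in (X <= _)%E).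
pose N k := H1_normsq Omega (fun x => u x - phi k x) (fun x => Du x - gradient (phi k) x).
pose c := (1 + e) * ((1 + e^-1) * norm_basis F ^+ 2) + (1 + e^-1) * m%:R.
have bound k : (I <= ((1 + e) ^+ 2)%:E * X + c%:E * N k)%E.
  pose v x := u x - phi k x; pose Dv x := Du x - gradient (phi k) x.
  have mphi := measurable_test (tphi k).
  have mgphi i := measurable_gradient_test i (tphi k).
  have mv : measurable_fun Omega v by exact: measurable_funB.
  have mDv i : measurable_fun Omega (fun x => Dv x ord0 i).
    apply: (eq_measurable_fun (fun x => Du x ord0 i - gradient (phi k) x ord0 i)).
      by move=> x _; rewrite !mxE.
    exact: measurable_funB.
  have mN : measurable_fun Omega (fun x => v x ^+ 2 + enorm (Dv x) ^+ 2).
    by apply: measurable_funD; [exact: measurable_funX|exact: measurable_enorm_sqr].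
  have N0 x : Omega x -> 0 <= v x ^+ 2 + enorm (Dv x) ^+ 2.
    by move=> _; rewrite addr_ge0 ?sqr_ge0.
  have I1 : (I <= (1 + e)%:E * \int[leb R n]_(x in Omega) (phi k x ^+ 2 * w x)%:E +
      ((1 + e^-1) * m%:R)%:E * N k)%E.
    apply: integral_le_comb => //; rewrite ?mulr_ge0//.
    - apply: measurable_funM; first exact: measurable_funX.
      by apply: measurable_minr => //; exact: measurable_cst.
    - by apply: measurable_funM => //; exact: measurable_funX.
    - by move=> x Ox; rewrite mulr_ge0 ?sqr_ge0// le_min w0//= ler0n.
    - by move=> x Ox; rewrite mulr_ge0 ?sqr_ge0// w0.
    move=> x Ox; rewrite -[in leLHS](subrK (phi k x) (u x)) addrC -/(v x).
    have wm0 : 0 <= Num.min (w x) m%:R by rewrite le_min w0//= ler0n.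
    apply: le_trans (ler_wpM2r wm0 (sqrD_le _ _ e0)) _.
    rewrite mulrDl; apply: lerD; rewrite -[leLHS]mulrA.
      by rewrite ler_wpM2l// ler_wpM2l ?sqr_ge0// ge_min lexx.
    rewrite -[leRHS]mulrA ler_wpM2l// [leLHS]mulrC; apply: ler_pM => //; first exact: sqr_ge0.
      by rewrite ge_min lexx orbT.
    by rewrite lerDl sqr_ge0.
  have I2 : (\int[leb R n]_(x in Omega) (F (gradient (phi k) x) ^+ 2)%:E <=
      (1 + e)%:E * X + ((1 + e^-1) * norm_basis F ^+ 2)%:E * N k)%E.
    apply: integral_le_comb => //; rewrite ?mulr_ge0 ?norm_basis_ge0 ?sqr_ge0//.
    - exact: measurable_norm_comp.
    - exact: measurable_norm_comp.
    - by move=> x _; exact: sqr_ge0.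
    - by move=> x _; exact: sqr_ge0.
    move=> x Ox; rewrite [in leLHS](_ : gradient (phi k) x = Du x - Dv x); last first.
      by rewrite /Dv opprB addrC subrK.
    have := norm_triangle hF (Du x) (- Dv x); rewrite (normN hF) => tri.
    apply: (@le_trans _ _ ((F (Du x) + F (Dv x)) ^+ 2)).
      by rewrite lerXn2r ?nnegrE ?addr_ge0 ?(norm_ge0 hF).
    apply: le_trans (sqrD_le _ _ e0) _; rewrite lerD2l -mulrA ler_wpM2l//.
    apply: le_trans (norm_sqr_le_enorm _) _.
    by rewrite ler_wpM2l ?sqr_ge0// lerDr sqr_ge0.
  have Nk0 : (0 <= N k)%E by apply: integral_ge0 => x Ox; rewrite lee_fin N0.
  have X0 : (0 <= X)%E by apply: integral_ge0 => x _; rewrite lee_fin sqr_ge0.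
  apply: le_trans I1 _.
  have := lee_wpmul2l (x := (1 + e)%:E) _ (le_trans (Hphi _ (tphi k)) I2).
  rewrite lee_fin => /(_ e1) I3.
  apply: (le_trans (leeD2r _ I3)).
  rewrite ge0_muleDr ?mule_ge0 ?lee_fin ?mulr_ge0 ?norm_basis_ge0//.
  rewrite !muleA -!EFinM -expr2 -addeA leeD2l// /c.
  by rewrite EFinD ge0_muleDl// lee_fin ?mulr_ge0 ?norm_basis_ge0.
have cv : (((1 + e) ^+ 2)%:E * X + c%:E * N k)%E @[k --> \oo] --> (((1 + e) ^+ 2)%:E * X + c%:E * 0)%E.
  apply: cvgeD; first by rewrite mule0 fin_num_adde_defl.
    exact: cvg_cst.
  exact: cvgeZl phiu.
rewrite mule0 adde0 in cv; rewrite -(cvg_lim _ cv)//.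
apply: lime_ge; last by apply: nearW.
by apply/cvg_ex; eexists; exact: cv.
Qed.

End hardy.

(** * The Hardy inequality with logarithmic remainder *)

Theorem theorem4p1 (R : realType) (n : nat) (F : 'rV[R]_n -> R)
    (Omega : set 'rV[R]_n) (hF : strongly_convex_norm F)
    (Omega_open : open Omega) (Omega_connected : connected Omega)
    (Omega_boundary : boundary Omega !=set0)
    (hsuper : superharmonic F Omega (dist_F F Omega))
    (hbounded : has_ubound [set dist_F F Omega x | x in Omega])
    (u : 'rV[R]_n -> R) (Du : 'rV[R]_n -> 'rV[R]_n) (hu : H01 Omega u Du) :
  let d := dist_F F Omega in
  let D := expR 1 * sup [set d x | x in Omega] in
  (\int[leb R n]_(x in Omega) (F (Du x) ^+ 2)%:E
     - (1 / 4)%:E * \int[leb R n]_(x in Omega) (u x ^+ 2 / d x ^+ 2)%:E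
   >= (1 / 4)%:E * \int[leb R n]_(x in Omega)
        (u x ^+ 2 / d x ^+ 2 * (ln (D / d x)) ^- 2)%:E)%E.
Proof.
cbv zeta; set d := dist_F F Omega; set D := expR 1 * sup _.
have mO := open_measurable_rV Omega_open.
have d0 x : Omega x -> 0 < d x by move=> Ox; exact: dist_gt0.
have [mu _] : L2 Omega u by case: hu => [[]].
have mw := measurable_dist_weight hF Omega_boundary Omega_open hbounded.
have main : (\int[leb R n]_(x in Omega) (u x ^+ 2 * hardy_weight D (d x))%:E <=
    \int[leb R n]_(x in Omega) (F (Du x) ^+ 2)%:E)%E.
  apply: (hardy_closure hF Omega_open mw _ _ hu) => [x _|phi tphi].
    exact: hardy_weight_ge0.
  exact: hardy_test.
have finX := energy_finite hF Omega_open hu.1.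
have mf : measurable_fun Omega (fun x => u x ^+ 2 / d x ^+ 2).
  apply: measurable_funM; first exact: measurable_funX.
  apply: open_continuous_measurable_fun_rV => // x Ox.
  have d2 : d x ^+ 2 != 0 by rewrite expf_neq0// gt_eqF// d0.
  have cd : {for x, continuous d} by exact: dist_continuous.
  exact: cvgV d2 (cvgM cd cd).
have weightE x : Omega x -> u x ^+ 2 * hardy_weight D (d x) =
    1 / 4 * (u x ^+ 2 / d x ^+ 2) + 1 / 4 * (u x ^+ 2 / d x ^+ 2 * (ln (D / d x)) ^- 2).
  move=> /d0 dx0; rewrite /hardy_weight; move: (ln _ ^- 2) => q.
  by field; rewrite gt_eqF.
have mg : measurable_fun Omega (fun x => u x ^+ 2 / d x ^+ 2 * (ln (D / d x)) ^- 2).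
  apply: (eq_measurable_fun (fun x => 4 * (u x ^+ 2 * hardy_weight D (d x)) - u x ^+ 2 / d x ^+ 2)).
    by move=> x; rewrite inE => /weightE ->; move: (u x ^+ 2 / _) (ln _ ^- 2) => a b; field.
  apply: measurable_funB => //; apply: measurable_funM => //; apply: measurable_funM => //.
  exact: measurable_funX.
have f0 x : Omega x -> (0 <= (u x ^+ 2 / d x ^+ 2)%:E)%E.
  by rewrite lee_fin mulr_ge0 ?invr_ge0 ?sqr_ge0.
have g0 x : Omega x -> (0 <= (u x ^+ 2 / d x ^+ 2 * (ln (D / d x)) ^- 2)%:E)%E.
  by rewrite lee_fin => _; apply: mulr_ge0; rewrite ?divr_ge0 ?invr_ge0 ?sqr_ge0.
have splitI : (\int[leb R n]_(x in Omega) (u x ^+ 2 * hardy_weight D (d x))%:E =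
    (1 / 4)%:E * \int[leb R n]_(x in Omega) (u x ^+ 2 / d x ^+ 2)%:E +
    (1 / 4)%:E * \int[leb R n]_(x in Omega) (u x ^+ 2 / d x ^+ 2 * (ln (D / d x)) ^- 2)%:E)%E.
  have q0 : 0 <= 1 / 4 :> R by [].
  have Mf := (measurable_EFinP _ _).2 mf; have Mg := (measurable_EFinP _ _).2 mg.
  rewrite -ge0_integralZl_EFin// -[X in (_ = _ + X)%E]ge0_integralZl_EFin//.
  rewrite -ge0_integralD//; last 4 first.
  - by move=> x Ox; apply: mule_ge0; [rewrite lee_fin|exact: f0].
  - exact: measurable_funeM.
  - by move=> x Ox; apply: mule_ge0; [rewrite lee_fin|exact: g0].
  - exact: measurable_funeM.
  apply: eq_integral => x; rewrite inE => /weightE ->.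
  by rewrite -!EFinM -EFinD.
rewrite splitI in main.
have J0 : (0 <= (1 / 4)%:E * \int[leb R n]_(x in Omega) (u x ^+ 2 / d x ^+ 2 * (ln (D / d x)) ^- 2)%:E)%E.
  by apply: mule_ge0; [rewrite lee_fin|exact: integral_ge0].
have I0 : (0 <= (1 / 4)%:E * \int[leb R n]_(x in Omega) (u x ^+ 2 / d x ^+ 2)%:E)%E.
  by apply: mule_ge0; [rewrite lee_fin|exact: integral_ge0].
rewrite leeBrDr 1?addeC//.
rewrite ge0_fin_numE//; apply: le_lt_trans finX; apply: le_trans main.
exact: leeDl.
Qed.
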